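(* In the polarized setting described in the context, let $k=\mathbb C((\tau))$ and suppose $\sigma|_k\ne\mathrm{id}$. Let $\xi\in F^\sigma$ be such that $\mathrm{Nm}_{F/k}(\xi)\in\mu_{m/n}(\mathbb C)$ is a primitive $(m/n)$-th root of unity, and put $\gamma=\mathrm{Nm}_{F/k}(c)\in k^\times$. Let $\mathrm{val}_\tau:k^\times\to\mathbb Z$ be the valuation with $\mathrm{val}_\tau(\tau)=1$. Then $k^\sigma=\mathbb C((\tau^2))$; $\gamma\in k^\sigma$, so $\mathrm{val}_\tau(\gamma)$ is even; $\gamma^{m/n}=\beta\sigma(\beta)$, which implies that $\mathrm{val}_\tau(\beta)$ is divisible by $m/n$. Hence $L_\beta$ splits into $m/n$ factors of $k$ (and $D_i=L_i$ for all $i\in I$), and the graph $Q_\xi$ is a single cycle of length $m/n$. Moreover: (A) Suppose $m/n$ is odd. Then $Q_\xi$ is of type (VE). The unique vertex $i=i^\diamondsuit$ corresponds to the unique $b_i\in k$ such that $b_i^2=\gamma$ and $b_i^{m/n}=\beta$. One has $\sigma_c|_{L_i}\neq\mathrm{id}$, and the factor $\mathbf{Aut}_{k}(M_i,\{\cdot,\cdot\}_i)$ in $H$ is either an orthogonal group or a symplectic group over $k$. The unique arrow $e:j\to j^\diamondsuit$ fixed by $(-)^\diamondsuit$ corresponds to the unique $b_j\in k$ such that $b_j^2=\gamma\,\mathrm{Nm}_{F/k}(\xi^{-1})$ and $b_j^{m/n}=\beta$. One has $\sigma_{c\xi^{-1}}|_{L_j}\ne\mathrm{id}$, and the factor $\mathfrak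 h^{-\epsilon\epsilon_e}(M_j,M_{j^\diamondsuit})$ in $\mathfrak g(\xi)$ is isomorphic to the space of $k/k^\sigma$-Hermitian forms on $M_j$. (B) Suppose $m/n$ is even. Then $Q_\xi$ is of type (VV) or (EE) according to whether the equations $b\sigma(b)=\gamma$, $b^{m/n}=\beta$ have a common solution in $k^\times$. (B1) If these equations have a common solution in $k^\times$, then $Q_\xi$ is of type (VV). The two vertices $i,i'$ fixed by $(-)^\diamondsuit$ correspond to two solutions $b_i$, $b_{i'}=-b_i$ of these equations, and the corresponding factors in $H$ are unitary groups over $k^\sigma$. (B2) If these equations do not have a common solution in $k^\times$, then $Q_\xi$ is of type (EE). The two arrows $e:i\to i^\diamondsuit$ and $e':i'\to i'^\diamondsuit$ fixed by $(-)^\diamondsuit$ correspond to two solutions $b_i$, $b_{i'}=-b_i$ of the system $b\sigma(b)=\gamma\,\mathrm{Nm}_{F/k}(\xi^{-1})$, $b^{m/n}=\beta$, and the corresponding factors in $\mathfrak g(\xi)$ are isomorphic to the space of $k/k^\sigma$-Hermitian forms on $M_i$ and $M_{i'}$.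
   Context: **Setup.** $k$ is a field with $\mathrm{char}(k)\neq2$ (here $k=\mathbb C((\tau))$); $F$ is a finite separable commutative $k$-algebra (possibly a product of fields) with a ring automorphism $\zeta$ of order $n$ such that $F^\zeta=k$; $\mathrm{Nm}_{F/k}(a)=\prod_{j=0}^{n-1}\zeta^j(a)$. $V$ is a finitely generated $F$-module, $\theta:V\to V$ an additive bijection with $\theta(av)=\zeta(a)\theta(v)$ for $a\in F$; $m$ is a multiple of $n$ with $m/n$ invertible in $k$, and $\theta^m=\beta\cdot\mathrm{id}_V$ with $\beta\in k^\times$. $\sigma:F\to F$ is a ring automorphism with $\sigma^2=\mathrm{id}$ commuting with $\zeta$. $\epsilon\in\{\pm1\}$, and $\langle\cdot,\cdot\rangle:V\times V\to F$ is a non-degenerate pairing, $F$-linear in the first variable, with $\langle x,y\rangle=\epsilon\sigma(\langle y,x\rangle)$ and $\langle\theta x,\theta y\rangle=c\,\zeta(\langle x,y\rangle)$ for some $c\in(F^\times)^\sigma$ with $\mathrm{Nm}_{F/k}(c)^{m/n}=\beta\sigma(\beta)$. $\mu_{m/n}(\mathbb C)$ is the group of $(m/n)$-th roots of unity in $\mathbb C^\times$. **Groups.** For a $k_0$-algebra $A$ and an $A$-module $M$ of finite dimension over the field $k_0$, $\mathbf{Aut}_{A/k_0}(M,\{\cdot,\cdot\})$ is the algebraic group over $k_0$ whose $R$-points are the $R\otimes_{k_0}A$-linear automorphisms of $R\otimes_{k_0}M$ preserving the pairing; $\mathbf{Aut}_{k_0}$ stands for $\mathbf{Aut}_{k_0/k_0}$.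 $H$ is the algebraic group over $k^\sigma$ of $F$-linear automorphisms of $V$ commuting with $\theta$ and preserving $\langle\cdot,\cdot\rangle$, and $\mathfrak g(\xi)=\{\varphi\in\mathrm{End}_F(V):\theta\varphi\theta^{-1}=\xi\varphi,\ \langle\varphi x,y\rangle+\langle x,\varphi y\rangle=0\ \forall x,y\}$, with $H$ acting by conjugation. **Algebra.** $A_\beta$ is the quotient of the twisted polynomial ring $F\langle\boldsymbol\theta\rangle$ ($\boldsymbol\theta a=\zeta(a)\boldsymbol\theta$) by the ideal generated by the central element $\boldsymbol\theta^m-\beta$. $V$ is an $A_\beta$-module with $\boldsymbol\theta$ acting as $\theta$. The center of $A_\beta$ is $L_\beta=k[b]\cong k[\mathbf b]/(\mathbf b^{m/n}-\beta)$, $b=\boldsymbol\theta^n$. Write $L_\beta=\prod_{i\in I}L_i$ with $L_i$ fields, so $I=\mathrm{Spec}\,L_\beta$, and let $b_i\in L_i$ be the image of $b$; $A_\beta=\prod_{i\in I}A_i$ with $A_i$ central simple over $L_i$. Fix a simple $A_i$-module $S_i$; $D_i=\mathrm{End}_{A_\beta}(S_i)^{\mathrm{opp}}$ is a central division algebra over $L_i$ acting on $S_i$ from the right. $M_i=\mathrm{Hom}_{A_\beta}(S_i,V)$ is a left $D_i$-module, $(dx)(u)=x(ud)$, and $V=\bigoplus_iS_i\otimes_{D_i}M_i$ via $u\otimes x\mapsto x(u)$. **Quiver.** For an $A_\beta$-module $U$, $U^\xi$ is the $F$-module $U$ with $\boldsymbol\theta$ acting as $\xi\boldsymbol\theta$.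 $\overline\xi:I\to I$ is the permutation of $I=\mathrm{Spec}\,L_\beta$ induced by the $k$-automorphism $b\mapsto\mathrm{Nm}_{F/k}(\xi)b$ of $L_\beta$; there are $A_\beta$-isomorphisms $S_i^\xi\cong S_{\overline\xi(i)}$. $Q_\xi$ is the directed graph with vertex set $I$ and one arrow $i\to\overline\xi(i)$ for each $i$. For $a\in\{c,c\xi^{-1}\}$, $\sigma_a:L_\beta\to L_\beta$ is the ring automorphism that is $\sigma$ on $k$ and sends $b\mapsto\mathrm{Nm}_{F/k}(a)b^{-1}$. The involution $i\mapsto i^\diamondsuit$ on $I$ is defined by $\sigma_c(L_i)=L_{i^\diamondsuit}$; it reverses arrows of $Q_\xi$, sending $e:i\to\overline\xi(i)$ to $e^\diamondsuit:\overline\xi(i)^\diamondsuit\to i^\diamondsuit$. A directed cycle with arrow-reversing involution $(-)^\diamondsuit$ is of type (VV) if exactly two vertices and no arrow are fixed, of type (VE) if exactly one vertex and one arrow are fixed, and of type (EE) if no vertex and exactly two arrows are fixed. **Pairings.** A pairing $\langle\cdot,\cdot\rangle_i:S_i\times S_{i^\diamondsuit}\to F$ is admissible if it is $F$-linear in the first variable, $(F,\sigma)$-semilinear in the second, and $\langle\boldsymbol\theta u,\boldsymbol\theta v\rangle_i=c\,\zeta(\langle u,v\rangle_i)$. Fix perfect admissible pairings and signs $\epsilon_i$ with $\langle v,u\rangle_{i^\diamondsuit}=\epsilon_i\sigma(\langle u,v\rangle_i)$, where $\epsilon_i=1$ if $i\ne i^\diamondsuit$, and for $i=i^\diamondsuit$,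 $\epsilon_i=1$ whenever a perfect admissible pairing with $\langle v,u\rangle_i=\sigma\langle u,v\rangle_i$ exists, and $\epsilon_i=-1$ otherwise. $\{\cdot,\cdot\}'_i:M_i\times M_{i^\diamondsuit}\to D_i$ is the unique pairing with $\langle u\otimes x,v\otimes y\rangle=\langle u\{x,y\}'_i,v\rangle_i$, and $\{x,y\}_i=\mathrm{Trd}_{D_i/L_i}\{x,y\}'_i$ (reduced trace). For each arrow $e:i\to\overline\xi(i)$ fix an $A_\beta$-isomorphism $\eta_e:S_i^\xi\to S_{\overline\xi(i)}$ and a sign $\epsilon_e$ with $\sigma\langle v,\eta_e(u)\rangle_{\overline\xi(i)^\diamondsuit}=\epsilon_e\langle u,\eta_{e^\diamondsuit}(v)\rangle_i$, where $\epsilon_e=1$ if $e\ne e^\diamondsuit$, and for $e=e^\diamondsuit$, $\epsilon_e=1$ whenever an $\eta_e$ with $\langle u,\eta_e(v)\rangle_i=\sigma\langle v,\eta_e(u)\rangle_i$ exists, and $\epsilon_e=-1$ otherwise. $\eta_e^\flat:D_i\to D_{\overline\xi(i)}$ is the isomorphism with $\eta_e(ud)=\eta_e(u)\eta_e^\flat(d)$. For an arrow $e:i\to i^\diamondsuit$ fixed by $(-)^\diamondsuit$ and $\epsilon'\in\{\pm1\}$, $\mathfrak h^{\epsilon'}(M_i,M_{i^\diamondsuit})$ is the set of maps $\varphi:M_i\to M_{i^\diamondsuit}$ with $\varphi(dx)=\eta_e^\flat(d)\varphi(x)$ and $\{y,\varphi(x)\}_i=\epsilon'\sigma_{c\xi^{-1}}(\{x,\varphi(y)\}_i)$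 for all $d\in D_i$, $x,y\in M_i$. **Factors.** An element of $H$ is given by a family $g_i\in\mathrm{Aut}_{D_i}(M_i)$, $g(u\otimes x)=u\otimes g_i(x)$; the factor of $H$ at a vertex $i=i^\diamondsuit$ is the group of those $g_i$ preserving $\{\cdot,\cdot\}_i$. An element of $\mathfrak g(\xi)$ is given by a family $\varphi_e\in\mathrm{Hom}_{D_i}(M_i,M_{\overline\xi(i)})$ (target a $D_i$-module via $\eta_e^\flat$), $\varphi(u\otimes x)=\eta_e(u)\otimes\varphi_e(x)$; for $e=e^\diamondsuit:i\to i^\diamondsuit$ the component $\varphi_e$ ranges over the factor $\mathfrak h^{-\epsilon\epsilon_e}(M_i,M_{i^\diamondsuit})$ of $\mathfrak g(\xi)$.
   Formalization: In (A), b_i² and b_j² become b_iσ(b_i) and b_jσ(b_j) (squares kept when σ(β)=β), and ''orthogonal or symplectic over k'' becomes ''unitary over k^σ''; σ|_k is assumed ℂ-linear; k^σ=ℂ((t²)) for some uniformizer t in place of τ. *)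

(* Defs.v *)
From HB Require Import structures.
From mathcomp Require Import all_boot all_order all_algebra all_field.
From mathcomp Require Import boolp classical_sets reals complex.

Set Implicit Arguments.
Unset Strict Implicit.
Unset Printing Implicit Defensive.

Import GRing.Theory.
Local Open Scope ring_scope.
Local Obligation Tactic := idtac.

(* The ring C[[tau]] of formal power series, with the Cauchy product. *)

Record fps (C : fieldType) := Fps { fcoef : nat -> C }.

HB.instance Definition _ (C : fieldType) := gen_eqMixin (fps C).
HB.instance Definition _ (C : fieldType) := gen_choiceMixin (fps C).

Section PowerSeries.
Variable C : fieldType.
Implicit Types f g h : fps C.

Lemma fpsP f g : (forall n, fcoef f n = fcoef g n) -> f = g.
Proof. by case: f g => f [g] /= e; congr Fps; apply: funext. Qed.

Definition fps_zero : fps C := Fps (fun=> 0).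
Definition fps_opp f : fps C := Fps (fun n => - fcoef f n).
Definition fps_add f g : fps C := Fps (fun n => fcoef f n + fcoef g n).
Definition fps_const (a : C) : fps C := Fps (fun n => if n is 0 then a else 0).
Definition fps_mul f g : fps C :=
  Fps (fun n => \sum_(i < n.+1) fcoef f i * fcoef g (n - i)%N).
Definition fps_tau : fps C := Fps (fun n => (n == 1)%:R).

Fact fps_addA : associative fps_add.
Proof. by move=> f g h; apply: fpsP => n /=; rewrite addrA. Qed.
Fact fps_addC : commutative fps_add.
Proof. by move=> f g; apply: fpsP => n /=; rewrite addrC. Qed.
Fact fps_add0 : left_id fps_zero fps_add.
Proof. by move=> f; apply: fpsP => n /=; rewrite add0r. Qed.
Fact fps_addN : left_inverse fps_zero fps_opp fps_add.
Proof. by move=> f; apply: fpsP => n /=; rewrite addNr. Qed.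

HB.instance Definition _ :=
  GRing.isZmodule.Build (fps C) fps_addA fps_addC fps_add0 fps_addN.

Definition fps_trunc n f : {poly C} := \poly_(i < n.+1) fcoef f i.

Lemma fps_truncE n f i : (i <= n)%N -> (fps_trunc n f)`_i = fcoef f i.
Proof. by move=> le_in; rewrite coef_poly ltnS le_in. Qed.

Lemma fps_mulE n f g (p q : {poly C}) :
    (forall i, (i <= n)%N -> p`_i = fcoef f i) ->
    (forall i, (i <= n)%N -> q`_i = fcoef g i) ->
  forall i, (i <= n)%N -> (p * q)`_i = fcoef (fps_mul f g) i.
Proof.
move=> hp hq i le_in; rewrite coefM /=; apply: eq_bigr => j _.
rewrite hp ?hq //; first by rewrite (leq_trans (leq_subr _ _)).
by rewrite (leq_trans _ le_in) // -ltnS.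
Qed.

Fact fps_mulA : associative fps_mul.
Proof.
move=> f g h; apply: fpsP => n.
have t x := @fps_truncE n x.
rewrite -(fps_mulE (t f) (fps_mulE (t g) (t h))) //.
by rewrite -(fps_mulE (fps_mulE (t f) (t g)) (t h)) // mulrA.
Qed.

Fact fps_mulC : commutative fps_mul.
Proof.
move=> f g; apply: fpsP => n; have t x := @fps_truncE n x.
by rewrite -(fps_mulE (t f) (t g)) // -(fps_mulE (t g) (t f)) // mulrC.
Qed.

Fact fps_mul1 : left_id (fps_const 1) fps_mul.
Proof.
move=> f; apply: fpsP => n; have t x := @fps_truncE n x.
have t1 i : (i <= n)%N -> (1 : {poly C})`_i = fcoef (fps_const 1) i.
  by rewrite coef1; case: i.
by rewrite -(fps_mulE t1 (t f)) // mul1r t.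
Qed.

Fact fps_mulDl : left_distributive fps_mul fps_add.
Proof.
move=> f g h; apply: fpsP => n /=; rewrite -big_split /=.
by apply: eq_bigr => i _; rewrite mulrDl.
Qed.

Fact fps_1neq0 : fps_const 1 != 0 :> fps C.
Proof.
by apply/eqP => /(congr1 (fun f => fcoef f 0)) /= /eqP; rewrite oner_eq0.
Qed.

HB.instance Definition _ := GRing.Zmodule_isComNzRing.Build (fps C)
  fps_mulA fps_mulC fps_mul1 fps_mulDl fps_1neq0.

Definition fps_unit : pred (fps C) := fun f => `[< exists g, g * f = 1 >].
Definition fps_inv f : fps C :=
  if pselect (exists g, g * f = 1) is left e then projT1 (cid e) else f.

Fact fps_mulV : {in fps_unit, left_inverse 1 fps_inv *%R}.
Proof.
move=> f /asboolP fu; rewrite /fps_inv.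
by case: pselect => // e; case: (cid e).
Qed.
Fact fps_unitP f g : g * f = 1 -> fps_unit f.
Proof. by move=> gf; apply/asboolP; exists g. Qed.
Fact fps_inv_out : {in [predC fps_unit], fps_inv =1 id}.
Proof.
by move=> f /asboolP fu; rewrite /fps_inv; case: pselect.
Qed.

HB.instance Definition _ := GRing.ComNzRing_hasMulInverse.Build (fps C)
  fps_mulV fps_unitP fps_inv_out.

Lemma fps_ord f : f != 0 ->
  exists2 n, fcoef f n != 0 & forall i, (i < n)%N -> fcoef f i = 0.
Proof.
move=> f0; have ex : exists n, fcoef f n != 0.
  apply: contrapT => nex; case/eqP: f0; apply: fpsP => n.
  by apply: contrapT => /eqP fn; apply: nex; exists n.
case: (ex_minnP ex) => n fn min_n; exists n => // i lt_in.
by apply/eqP; apply: contraTT lt_in => /min_n; rewrite -leqNgt.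
Qed.

Fact fps_integral : GRing.integral_domain_axiom (fps C).
Proof.
move=> f g fg0; rewrite -[_ || _]negbK negb_or; apply/negP => /andP[f0 g0].
have [a fa fmin] := fps_ord f0; have [b gb gmin] := fps_ord g0.
have : fcoef (f * g) (a + b) = 0 by rewrite fg0.
have lt_a : (a < (a + b).+1)%N by rewrite ltnS leq_addr.
rewrite /= (bigD1 (Ordinal lt_a)) //= big1 => [|i].
  by rewrite addr0 addKn => /eqP; rewrite mulf_eq0 (negPf fa) (negPf gb).
rewrite -val_eqE /= neq_ltn => /orP[/fmin ->|lt_ai]; first by rewrite mul0r.
rewrite [fcoef g _]gmin ?mulr0 // ltn_subLR; last by rewrite -ltnS.
by rewrite ltn_add2r.
Qed.

HB.instance Definition _ :=
  GRing.ComUnitRing_isIntegral.Build (fps C) fps_integral.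

End PowerSeries.

(* C((tau)), as the fraction field of C[[tau]]. *)

Definition laurent (C : fieldType) : fieldType := {fraction (fps C)}.

Section Laurent.
Variable C : fieldType.

Definition ltofrac (f : fps C) : laurent C := tofrac f.
Definition lconst (a : C) : laurent C := ltofrac (fps_const a).
Definition ltau : laurent C := ltofrac (fps_tau C).

(* Every nonzero x is tau^v * u for a unique v and a unique u with nonzero
   constant coefficient; by convention val_tau 0 = 0. *)
Definition val_tau (x : laurent C) : int :=
  xget 0 [set v : int | exists2 u : fps C, fcoef u 0 != 0 &
                          x = ltau ^ v * ltofrac u].

(* For t of positive valuation: x belongs to C((t)), that is,
   x = sum_(j >= 0) a_j t^(v + j) in the tau-adic topology. *)
Definition laurent_in (t x : laurent C) : Prop :=
  exists (v : int) (a : nat -> C), forall N : nat, exists r : fps C,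
    x = \sum_(j < N) lconst (a j) * t ^ (v + j%:Z) + t ^ (v + N%:Z) * ltofrac r.

End Laurent.

Definition scalar_of (k : fieldType) (F : comUnitAlgType k) (x : F) : k :=
  xget 0 [set a : k | x = a%:A].

Definition finite_separable (k : fieldType) (F : comUnitAlgType k) : Prop :=
  exists (r : nat) (K : 'I_r -> fieldExtType k)
         (p : forall j, {lrmorphism F -> K j}),
    [/\ forall j, separable 1%VS {: K j},
        forall x y : F, (forall j, p j x = p j y) -> x = y
      & forall y : (forall j, K j), exists x : F, forall j, p j x = y j].

Definition module_finite (F : comNzRingType) (V : lmodType F) : Prop :=
  exists (r : nat) (e : 'I_r -> V),
    forall v, exists a : 'I_r -> F, v = \sum_j a j *: e j.

(* Signs are encoded by booleans: s stands for (-1) ^+ s. *)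
Record polarized_setup (k : fieldType) := PolarizedSetup {
  ps_char : 2%:R != 0 :> k;
  psF : comUnitAlgType k;
  ps_sep : finite_separable psF;
  zeta : {rmorphism psF -> psF};
  psn : nat;
  ps_n0 : (0 < psn)%N;
  ps_zeta_n : forall a, iter psn zeta a = a;
  ps_zeta_min : forall j, (0 < j < psn)%N -> exists a, iter j zeta a <> a;
  ps_zeta_fix : forall a : psF, zeta a = a <-> exists x : k, a = x%:A;
  psV : lmodType psF;
  ps_fin : module_finite psV;
  theta : psV -> psV;
  ps_thetaD : {morph theta : u v / u + v};
  ps_theta_bij : bijective theta;
  ps_thetaZ : forall (a : psF) v, theta (a *: v) = zeta a *: theta v;
  psm : nat;
  ps_nm : (psn %| psm)%N;
  ps_d0 : (psm %/ psn)%:R != 0 :> k;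
  beta : k;
  ps_beta0 : beta != 0;
  ps_theta_m : forall v, iter psm theta v = (beta%:A : psF) *: v;
  sigma : {rmorphism psF -> psF};
  ps_sigma2 : forall a, sigma (sigma a) = a;
  ps_sigma_zeta : forall a, sigma (zeta a) = zeta (sigma a);
  eps : bool;
  form : psV -> psV -> psF;
  ps_form_lin : forall (a : psF) x y z,
    form (a *: x + y) z = a * form x z + form y z;
  ps_form_sym : forall x y, form x y = (-1) ^+ eps * sigma (form y x);
  ps_form_nondeg : forall x, (forall y, form x y = 0) -> x = 0;
  psc : psF;
  ps_c_unit : psc \is a GRing.unit;
  ps_c_fix : sigma psc = psc;
  ps_form_theta : forall x y,
    form (theta x) (theta y) = psc * zeta (form x y);
  ps_c_norm :
    scalar_of (\prod_(j < psn) iter j zeta psc) ^+ (psm %/ psn) =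
    beta * scalar_of (sigma beta%:A)
}.

Section Setup.
Variables (k : fieldType) (X : polarized_setup k).
Local Notation F := (psF X).
Local Notation n := (psn X).
Local Notation d := (psm X %/ psn X)%N.

(* The product is zeta-invariant, hence the image of a unique scalar. *)
Definition Nm (a : F) : k := scalar_of (\prod_(j < n) iter j (zeta X) a).

Definition sigk (x : k) : k := scalar_of (sigma X x%:A).

Lemma zeta_scalar (x : k) : zeta X x%:A = x%:A.
Proof. by apply/ps_zeta_fix; exists x. Qed.

(* A module over A_beta = F<theta>/(theta^m - beta) is an F-module with a
   zeta-semilinear operator whose m-th power is beta. *)
Record abmod := AbMod {
  abcar :> lmodType F;
  abop : abcar -> abcar;
  abopD : {morph abop : u v / u + v};
  abopZ : forall (a : F) u, abop (a *: u) = zeta X a *: abop u;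
  abop_m : forall u, iter (psm X) abop u = ((beta X)%:A : F) *: u
}.

Definition Vmod : abmod := AbMod (@ps_thetaD k X) (@ps_thetaZ k X) (@ps_theta_m k X).

Record abhom (U W : abmod) := AbHom {
  abfun :> U -> W;
  abfun_lin : forall (a : F) u v, abfun (a *: u + v) = a *: abfun u + abfun v;
  abfun_op : forall u, abfun (abop u) = abop (abfun u)
}.

Lemma abop0 (U : abmod) : abop (0 : U) = 0.
Proof. by have := abopZ 0 (0 : U); rewrite scaler0 rmorph0 scale0r. Qed.

Lemma abopN (U : abmod) (u : U) : abop (- u) = - abop u.
Proof. by apply/eqP; rewrite -addr_eq0 -abopD addNr abop0. Qed.

Lemma abhomP (U W : abmod) (f g : abhom U W) : (forall u, f u = g u) -> f = g.
Proof.
case: f g => f fl fo [g gl go] /= e; have {}e : f = g by apply: funext.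
by case: _ / e gl go => gl go; congr AbHom; apply: Prop_irrelevance.
Qed.

Section HomModule.
Variables U W : abmod.
Implicit Types f g h : abhom U W.

HB.instance Definition _ := gen_eqMixin (abhom U W).
HB.instance Definition _ := gen_choiceMixin (abhom U W).

Program Definition abhom0 : abhom U W := @AbHom U W (fun=> 0) _ _.
Next Obligation. by move=> a u v /=; rewrite scaler0 addr0. Qed.
Next Obligation. by move=> u /=; rewrite abop0. Qed.

Program Definition abhom_opp f : abhom U W := @AbHom U W (fun u => - f u) _ _.
Next Obligation. by move=> f a u v /=; rewrite abfun_lin scalerN opprD. Qed.
Next Obligation. by move=> f u /=; rewrite abfun_op abopN. Qed.

Program Definition abhom_add f g : abhom U W :=
  @AbHom U W (fun u => f u + g u) _ _.
Next Obligation.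
by move=> f g a u v /=; rewrite !abfun_lin scalerDr addrACA.
Qed.
Next Obligation. by move=> f g u /=; rewrite !abfun_op abopD. Qed.

Program Definition abhom_scale (x : k) f : abhom U W :=
  @AbHom U W (fun u => (x%:A : F) *: f u) _ _.
Next Obligation.
by move=> x f a u v /=; rewrite abfun_lin scalerDr !scalerA mulrC.
Qed.
Next Obligation. by move=> x f u /=; rewrite abfun_op abopZ zeta_scalar. Qed.

Fact abhom_addA : associative abhom_add.
Proof. by move=> f g h; apply: abhomP => u /=; rewrite addrA. Qed.
Fact abhom_addC : commutative abhom_add.
Proof. by move=> f g; apply: abhomP => u /=; rewrite addrC. Qed.
Fact abhom_add0 : left_id abhom0 abhom_add.
Proof. by move=> f; apply: abhomP => u /=; rewrite add0r. Qed.
Fact abhom_addN : left_inverse abhom0 abhom_opp abhom_add.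
Proof. by move=> f; apply: abhomP => u /=; rewrite addNr. Qed.

HB.instance Definition _ := GRing.isZmodule.Build (abhom U W)
  abhom_addA abhom_addC abhom_add0 abhom_addN.

Fact abhom_scaleA x y f :
  abhom_scale x (abhom_scale y f) = abhom_scale (x * y) f.
Proof.
by apply: abhomP => u /=; rewrite scalerA -scalerAl mul1r scalerA.
Qed.
Fact abhom_scale1 : left_id 1 abhom_scale.
Proof. by move=> f; apply: abhomP => u /=; rewrite !scale1r. Qed.
Fact abhom_scaleDr : right_distributive abhom_scale +%R.
Proof. by move=> x f g; apply: abhomP => u /=; rewrite scalerDr. Qed.
Fact abhom_scaleDl f : {morph abhom_scale^~ f : x y / x + y}.
Proof. by move=> x y; apply: abhomP => u /=; rewrite !scalerDl. Qed.

HB.instance Definition _ := GRing.Zmodule_isLmodule.Build k (abhom U W)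
  abhom_scaleA abhom_scale1 abhom_scaleDr abhom_scaleDl.

End HomModule.

Program Definition abid (U : abmod) : abhom U U := @AbHom U U id _ _.
Next Obligation. by []. Qed.
Next Obligation. by []. Qed.

Program Definition abcomp (U V W : abmod) (g : abhom V W) (f : abhom U V) :
  abhom U W := @AbHom U W (g \o f) _ _.
Next Obligation. by move=> U V W g f a u v /=; rewrite !abfun_lin. Qed.
Next Obligation. by move=> U V W g f u /=; rewrite !abfun_op. Qed.

(* L_beta = k[b] / (b^(m/n) - beta). *)
Definition Lbeta := {poly %/ ('X^d - (beta X)%:P)}.
Definition bgen : Lbeta := 'qX.

(* b acts on an A_beta-module as theta^n; this is the action of
   a representative p of an element of L_beta. *)
Definition Lact_fun (U : abmod) (p : {poly k}) (u : U) : U :=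
  \sum_(j < size p) ((p`_j)%:A : F) *: iter (n * j) (@abop U) u.

Lemma iter_abopD (U : abmod) j : {morph iter j (@abop U) : u v / u + v}.
Proof.
by elim: j => [//|j IH] u v; rewrite /= [iter j _ (u + v)]IH abopD.
Qed.

Lemma iter_abopZ (U : abmod) j (a : F) (u : U) :
  iter (n * j) (@abop U) (a *: u) = a *: iter (n * j) (@abop U) u.
Proof.
have st i : iter i (@abop U) (a *: u) = iter i (zeta X) a *: iter i (@abop U) u.
  by elim: i => //= i ->; rewrite abopZ.
rewrite st; congr (_ *: _); elim: j {st} => [|j IH]; first by rewrite muln0.
by rewrite mulnS iterD IH ps_zeta_n.
Qed.

Program Definition Lact (U : abmod) (p : {poly k}) : abhom U U :=
  @AbHom U U (Lact_fun p) _ _.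
Next Obligation.
move=> U p a u v; rewrite /Lact_fun scaler_sumr -big_split /=.
apply: eq_bigr => j _.
by rewrite iter_abopD iter_abopZ scalerDr !scalerA mulrC.
Qed.
Next Obligation.
move=> U p u; rewrite /Lact_fun.
rewrite (big_morph _ (@abopD U) (abop0 U)); apply: eq_bigr => j _.
by rewrite abopZ zeta_scalar -iterSr.
Qed.

Definition ab_simple (U : abmod) : Prop :=
  (exists u : U, u <> 0) /\
  forall N : set U,
    N 0 -> (forall u v, N u -> N v -> N (u + v)) ->
    (forall (a : F) u, N u -> N (a *: u)) -> (forall u, N u -> N (abop u)) ->
    (forall u, N u -> u = 0) \/ (forall u, N u).

Definition has_kdim (W : lmodType k) (r : nat) : Prop :=
  exists e : 'I_r -> W, forall w, exists! a : 'rV[k]_r, w = \sum_j a 0 j *: e j.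

Definition admissible (S S' : abmod) (p : S -> S' -> F) : Prop :=
  [/\ forall (a : F) u u' v, p (a *: u + u') v = a * p u v + p u' v,
      forall (a : F) u v v', p u (a *: v + v') = sigma X a * p u v + p u v'
    & forall u v, p (abop u) (abop v) = psc X * zeta X (p u v)].

Definition perfect_pairing (S S' : abmod) (p : S -> S' -> F) : Prop :=
  (forall f : S -> F, (forall (a : F) u v, f (a *: u + v) = a * f u + f v) ->
     exists! v, forall u, f u = p u v) /\
  (forall f : S' -> F,
     (forall (a : F) u v, f (a *: u + v) = sigma X a * f u + f v) ->
     exists! u, forall v, f v = p u v).

(* eta : S^xi -> S' is an isomorphism of A_beta-modules. *)
Definition twist_iso (xi : F) (S S' : abmod) (eta : S -> S') : Prop :=
  [/\ forall (a : F) u v, eta (a *: u + v) = a *: eta u + eta v,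
      forall u, eta (xi *: abop u) = abop (eta u)
    & bijective eta].

(* sigma_a : L_beta -> L_beta. *)
Definition is_sigma_ (a : F) (s : Lbeta -> Lbeta) : Prop :=
  (forall x : k, s x%:A = (sigk x)%:A) /\ s bgen * bgen = (Nm a)%:A.

(* D = End(S)^opp acts on S from the right, so the product d d' of D is
   abcomp d' d.  A ring morphism from D to r x r matrices over an extension K
   of L is a splitting K (x)_L D = M_r(K) as soon as dim_L D = r ^ 2. *)
Definition reduced_trace (S : abmod) (L : fieldExtType k)
    (pi : Lbeta -> L) (t : abhom S S -> L) : Prop :=
  exists (r : nat) (K : fieldType) (io : {rmorphism L -> K})
         (rho : abhom S S -> 'M[K]_r),
    [/\ {morph rho : x y / x + y},
        rho (abid S) = 1%:M /\
        (forall x y, rho (abcomp y x) = rho x *m rho y),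
        forall q : Lbeta, rho (Lact S q) = (io (pi q))%:M,
        has_kdim (abhom S S) (r ^ 2 * \dim {: L})
      & forall x, io (t x) = \tr (rho x)].

(* The data attached to xi.  The vertex set is qI, and the arrow i -> xib i is
   denoted by its source i.  Families indexed by a vertex i and its image
   under an involution are declared on all pairs (i, j), and constrained only
   at the relevant j: this avoids transports along dia (dia i) = i. *)
Record quiver_data (xi : F) := QuiverData {
  qI : finType;
  qL : qI -> fieldExtType k;
  (* L_beta is the product of the qL i, with inclusions inL of the factors. *)
  qpi : forall i, {lrmorphism Lbeta -> qL i};
  inL : forall i, qL i -> Lbeta;
  q_inK : forall i x, qpi i (inL x) = x;
  q_in0 : forall i j (x : qL i), j != i -> qpi j (inL x) = 0;
  q_dec : forall q, \sum_i inL (qpi i q) = q;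
  qS : qI -> abmod;
  q_simple : forall i, ab_simple (qS i);
  q_Sact : forall i q, qpi i q = 0 -> forall u : qS i, Lact (qS i) q u = 0;
  (* xib is Spec of the automorphism b |-> Nm(xi) b. *)
  autL : {lrmorphism Lbeta -> Lbeta};
  q_autL : autL bgen = Nm xi *: bgen;
  xib : qI -> qI;
  q_xib : forall i q, qpi (xib i) q = 0 <-> qpi i (autL q) = 0;
  sLc : {rmorphism Lbeta -> Lbeta};
  q_sLc : is_sigma_ (psc X) sLc;
  sLcxi : {rmorphism Lbeta -> Lbeta};
  q_sLcxi : is_sigma_ (psc X / xi) sLcxi;
  dia : qI -> qI;
  q_dia : forall i q,
    (exists x : qL i, q = sLc (inL x)) <-> (exists y : qL (dia i), q = inL y);
  qpair : forall i j, qS i -> qS j -> F;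
  q_adm : forall i, admissible (@qpair i (dia i));
  q_perf : forall i, perfect_pairing (@qpair i (dia i));
  epsv : qI -> bool;
  q_pair_sym : forall i (u : qS i) (v : qS (dia i)),
    qpair v u = (-1) ^+ epsv i * sigma X (qpair u v);
  q_epsv_ne : forall i, dia i != i -> epsv i = false;
  q_epsv_eq : forall i, dia i = i ->
    (epsv i = false <->
     exists p : qS i -> qS i -> F,
       [/\ admissible p, perfect_pairing p & forall u v, p v u = sigma X (p u v)]);
  eta : forall i, qS i -> qS (xib i);
  q_eta : forall i, twist_iso xi (@eta i);
  epsa : qI -> bool;
  (* the arrow e = i is sent to e^dia = dia (xib i) *)
  q_eta_sym : forall i (u : qS i) (v : qS (dia (xib i))),
    sigma X (qpair v (eta u)) = (-1) ^+ epsa i * qpair u (eta v);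
  q_epsa_ne : forall i, dia (xib i) != i -> epsa i = false;
  q_epsa_eq : forall i, dia (xib i) = i ->
    (epsa i = false <->
     exists e : qS i -> qS (xib i),
       twist_iso xi e /\
       forall u v, qpair u (e v) = sigma X (qpair v (e u)));
  etaflat : forall i, abhom (qS i) (qS i) -> abhom (qS (xib i)) (qS (xib i));
  q_etaflat : forall i (x : abhom (qS i) (qS i)) u,
    eta (x u) = etaflat x (eta u);
  brD : forall i j, abhom (qS i) Vmod -> abhom (qS j) Vmod -> abhom (qS i) (qS i);
  q_brD : forall i (x : abhom (qS i) Vmod) (y : abhom (qS (dia i)) Vmod) u v,
    form (x u : psV X) (y v : psV X) = qpair (brD x y u) v;
  trd : forall i, abhom (qS i) (qS i) -> qL i;
  q_trd : forall i, reduced_trace (qpi i) (@trd i)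
}.

Section Quiver.
Variables (xi : F) (Q : quiver_data xi).

Definition Dv (i : qI Q) := abhom (qS i) (qS i).
Definition Mv (i : qI Q) : lmodType k := abhom (qS i) Vmod.

(* (d x)(u) = x (u d) *)
Definition dact i (x : Dv i) (y : Mv i) : Mv i := abcomp (y : abhom _ _) x.

Definition br i j (x : Mv i) (y : Mv j) : qL i := trd (brD x y).

Definition adia (i : qI Q) : qI Q := dia (xib i).

Definition vertex_at (i : qI Q) (b : k) : Prop := qpi i bgen = b%:A.

Definition Q_cycle (l : nat) : Prop :=
  #|qI Q| = l /\ forall i j : qI Q, fconnect (@xib xi Q) i j.

(* (dia, adia) is an arrow-reversing involution of the quiver. *)
Definition arrow_reversing : Prop :=
  [/\ involutive (@dia xi Q), involutive adia
    & forall i : qI Q, xib (adia i) = dia i].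

Definition num_fixed (f : qI Q -> qI Q) : nat := #|[set i | f i == i]|.

Definition type_VV : Prop :=
  arrow_reversing /\ (num_fixed (@dia xi Q) = 2 /\ num_fixed adia = 0)%N.
Definition type_VE : Prop :=
  arrow_reversing /\ (num_fixed (@dia xi Q) = 1 /\ num_fixed adia = 1)%N.
Definition type_EE : Prop :=
  arrow_reversing /\ (num_fixed (@dia xi Q) = 0 /\ num_fixed adia = 2)%N.

Definition L_trivial (i : qI Q) : Prop :=
  bijective (fun x : k => x%:A : qL i).

(* the map L_i -> D_i given by the action of L_beta on S_i is bijective *)
Definition D_trivial (i : qI Q) : Prop :=
  bijective (fun x : qL i => Lact (qS i) (inL x) : Dv i).

(* restriction of sigma_a to a factor L_i that it preserves *)
Definition restrL (s : Lbeta -> Lbeta) (i : qI Q) (x : qL i) : qL i :=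
  qpi i (s (inL x)).

(* h^(+-1)(M_i, M_(dia i)) for a fixed arrow i -> xib i = dia i *)
Definition hset (s : bool) (i : qI Q) (phi : Mv i -> Mv (xib i)) : Prop :=
  (forall (x : Dv i) y, phi (dact x y) = dact (etaflat x) (phi y)) /\
  (forall x y, br y (phi x) = (-1) ^+ s * restrL (@sLcxi xi Q) (br x (phi y))).

(* The group of points of Aut_(k/k^sigma)(k^r, G), for the sesquilinear form
   x G sigma(y)^T on row vectors.  B is a k-algebra with an involution s
   extending sigma; for sigma nontrivial on k and B^s = A these are exactly the
   A (x)_(k^sigma) k with A a nonzero commutative k^sigma-algebra. *)
Definition isometry_points (r : nat) (G : 'M[k]_r) (B : comNzRingType)
    (s : B -> B) (io : k -> B) (g : 'M[B]_r) : Prop :=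
  (exists g' : 'M[B]_r, g *m g' = 1%:M /\ g' *m g = 1%:M) /\
  g *m map_mx io G *m (map_mx s g)^T = map_mx io G.

(* For L_i = D_i = k and dia i = i: the algebraic group of automorphisms of
   (M_i, {.,.}_i) over k^sigma is the unitary group of a nondegenerate
   k/k^sigma-Hermitian form h.  G is the Gram matrix of {.,.}_i. *)
Definition unitary_factor (i : qI Q) : Prop :=
  exists (r : nat) (e : 'I_r -> Mv i) (G h : 'M[k]_r),
    [/\ forall x, exists! a : 'rV[k]_r, x = \sum_j a 0 j *: e j,
        forall a b : 'rV[k]_r,
          br (\sum_j a 0 j *: e j) (\sum_j b 0 j *: e j) =
          ((a *m G *m (map_mx sigk b)^T) 0 0)%:A,
        h^T = map_mx sigk h,
        h \in unitmx
      & forall (B : comNzRingType) (s : {rmorphism B -> B})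
               (io : {rmorphism k -> B}) (g : 'M[B]_r),
          involutive s -> (forall x, s (io x) = io (sigk x)) ->
          isometry_points G s io g <-> isometry_points h s io g].

Definition herm_form (W : lmodType k) (B : W -> W -> k) : Prop :=
  (forall a x y z, B (a *: x + y) z = a * B x z + B y z) /\
  (forall x y, B y x = sigk (B x y)).

(* automorphism of a D_i-module *)
Definition Daut (i : qI Q) (g : Mv i -> Mv i) : Prop :=
  [/\ {morph g : x y / x + y}, forall x y, g (dact x y) = dact x (g y)
    & bijective g].

(* Isomorphism of k^sigma-vector spaces, compatible with the action of the
   pairs (g, g') in Aut(M_i) x Aut(M_(dia i)) preserving {.,.}_i, which act
   on h by phi |-> g' phi g^-1. *)
Definition hermitian_factor (s : bool) (i : qI Q) : Prop :=
  exists Psi : (Mv i -> Mv (xib i)) -> (Mv i -> Mv i -> k),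
    [/\ forall phi, hset s phi -> herm_form (Psi phi),
        forall phi phi', hset s phi -> hset s phi' -> Psi phi = Psi phi' ->
          phi = phi',
        forall B, herm_form B -> exists2 phi, hset s phi & Psi phi = B,
        forall (a : k) phi phi', sigk a = a -> hset s phi -> hset s phi' ->
          hset s (fun x => a *: phi x + phi' x) /\
          forall x y, Psi (fun x => a *: phi x + phi' x) x y =
                      a * Psi phi x y + Psi phi' x y
      & forall (g : Mv i -> Mv i) (g' : Mv (xib i) -> Mv (xib i)) phi phi',
          Daut g -> Daut g' -> (forall x y, br (g x) (g' y) = br x y) ->
          hset s phi -> hset s phi' -> (forall x, phi' (g x) = g' (phi x)) ->
          forall x y, Psi phi' (g x) (g y) = Psi phi x y].

End Quiver.
End Setup.

(* Main.v *)
(* Put om = Nm xi, gamma = Nm c and s = sigma on k.  The automorphism s preserves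
   the valuation, because the units of C[[tau]] are the elements having roots of
   all orders; hence it negates a uniformizer t, val gamma is even, and
   gamma ^ d = beta * s beta makes beta a d-th power.  The vertices are therefore
   the d roots b_i of X ^ d - beta in k; xib multiplies b_i by om, and dia sends
   b_i to gamma / s b_i, so that the type of the cycle is decided by counting the
   roots of unity solving b * s b = gamma and b * s b = gamma / om.

   To see that A_i splits, choose a Kummer generator y of F, zeta y = omega y.
   On S_i the operators y and theta generate a symbol algebra whose parameters
   a = y ^ n and b_i are classified modulo n-th powers by their valuations; a
   suitable coprime (p, q) makes (y ^ p theta ^ q) ^ n the n-th power of a scalar,
   so that w = y ^ p theta ^ q is diagonalizable over k.  An eigenline of w in S_i
   has multiplicity one, whence D_i = k; in any module, a vector of the same
   eigenvalue is the image of a homomorphism from S_i, whence every module is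
   spanned by such images and {.,.}_i is nondegenerate.  As s is nontrivial, a
   skew-Hermitian form times t is Hermitian, which gives the unitary groups and
   the spaces of Hermitian forms. *)

From HB Require Import structures.
Require Import Defs.
From mathcomp Require Import all_boot all_order all_algebra all_field.
From mathcomp Require Import boolp classical_sets reals complex.
From mathcomp Require Import cyclic zify ring.

Set Implicit Arguments.
Unset Strict Implicit.
Unset Printing Implicit Defensive.

Import Order.TTheory GRing.Theory Num.Theory.
Local Open Scope ring_scope.

(** * Hensel's lemma for power series *)

Section FractionField.
Import FracField generic_quotient.
Local Open Scope quotient_scope.

(** Nothing makes [sigma] continuous on k: it is an abstract automorphism fixing the constants.
    Continuity is recovered once [sigma] is known to preserve C[[tau]] and constant terms, since
    elements can then be compared modulo every power of a uniformizer. Hensel's lemma provides the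
    link between valuations and solvability of [x ^ n = a]. Likewise S_i is an abstract simple
    module and F may be a product of fields, so no matrix model is at hand, and eigenvectors of
    [zeta] in F must first be shown invertible. The splitting of A_i reflects the triviality of the
    Brauer group of C((tau)): modulo n-th powers the nonzero elements of k form a cyclic group of
    order n, so a unimodular change of monomials modulo n makes one of the two parameters of the
    symbol algebra trivial. The second row of that matrix gives the operator [w'], which permutes
    the eigenlines of [w]. Working with exponents modulo n treats composite n directly. *)

Lemma fraction_ratio (R : idomainType) (x : {fraction R}) :
  exists a b : R, b != 0 /\ x = tofrac a / tofrac b.
Proof.
have [a [b [b0 e]]] : exists a b : R, b != 0 /\ x * tofrac b = tofrac a.
  elim/quotW: x => r; exists (frac r).1, (frac r).2.
  split; first exact: denom_ratioP.
  rewrite -[_ * _]/(FracField.mul _ _) !piE; apply/eqmodP.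
  rewrite /= FracField.equivfE /FracField.mulf.
  by rewrite !numden_Ratio ?mulf_neq0 ?denom_ratioP ?mulr1 ?oner_eq0 // mulrC.
by exists a, b; split=> //; rewrite -e mulfK // tofrac_eq0.
Qed.

End FractionField.

Section Hensel.
Variable C : numClosedFieldType.
Implicit Types (f g h : fps C) (P : {poly fps C}).

Local Notation tau := (fps_tau C).
Local Notation cst := (@fps_const C).

Lemma fcoef_tau f i :
  fcoef (tau * f) i = if i is j.+1 then fcoef f j else 0.
Proof.
rewrite /=; case: i => [|i]; first by rewrite big_ord1 mul0r.
rewrite big_ord_recl big_ord_recl /= mul0r add0r mul1r subSS subn0 big1 ?addr0 //.
by move=> j _; rewrite mul0r.
Qed.

Lemma fcoef_tauX n f i :
  fcoef (tau ^+ n * f) i = if (i < n)%N then 0 else fcoef f (i - n).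
Proof.
elim: n i => [|n IH] i; first by rewrite expr0 mul1r ltn0 subn0.
by rewrite exprS -mulrA fcoef_tau; case: i => [//|i]; rewrite IH ltnS subSS.
Qed.

Lemma fps_divtau n f : (forall i, (i < n)%N -> fcoef f i = 0) ->
  f = tau ^+ n * Fps (fun i => fcoef f (i + n)).
Proof.
move=> f0; apply: fpsP => i; rewrite fcoef_tauX /=.
by case: ltnP => [/f0 //|le_ni]; rewrite subnK.
Qed.

Definition fcoef0 f : C := fcoef f 0.
Arguments fcoef0 : simpl never.

Lemma fcoef0_cst a : fcoef0 (cst a) = a. Proof. by []. Qed.

Fact fcoef0_is_zmod_morphism : zmod_morphism fcoef0.
Proof. by []. Qed.
Fact fcoef0_is_monoid_morphism : monoid_morphism fcoef0.
Proof. by split=> // f g; rewrite /fcoef0 /= big_ord1. Qed.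
HB.instance Definition _ :=
  GRing.isZmodMorphism.Build (fps C) C fcoef0 fcoef0_is_zmod_morphism.
HB.instance Definition _ :=
  GRing.isMonoidMorphism.Build (fps C) C fcoef0 fcoef0_is_monoid_morphism.

Fact cst_is_zmod_morphism : zmod_morphism cst.
Proof. by move=> a b; apply: fpsP => -[|i] //=; rewrite subr0. Qed.
Fact cst_is_monoid_morphism : monoid_morphism cst.
Proof.
split=> // a b; apply: fpsP => -[|i] /=; first by rewrite big_ord1.
rewrite big1 // => -[[|j] lt_j] _ /=; last by rewrite mul0r.
by rewrite mulr0.
Qed.
HB.instance Definition _ :=
  GRing.isZmodMorphism.Build C (fps C) cst cst_is_zmod_morphism.
HB.instance Definition _ :=
  GRing.isMonoidMorphism.Build C (fps C) cst cst_is_monoid_morphism.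

Lemma horner_taylor2 (A : comNzRingType) (P : {poly A}) (x h : A) :
  exists r, P.[x + h] = P.[x] + P^`().[x] * h + h ^+ 2 * r.
Proof.
elim/poly_ind: P => [|P c [r IH]].
  by exists 0; rewrite deriv0 !horner0 mul0r mulr0 !addr0.
exists (r * (x + h) + P^`().[x]).
rewrite derivD derivM derivX derivC !hornerE IH; ring.
Qed.

Lemma fcoef0_horner P f g :
  fcoef0 f = fcoef0 g -> fcoef0 P.[f] = fcoef0 P.[g].
Proof. by move=> e; rewrite -!(horner_map fcoef0) /= e. Qed.

(** Newton's method, one coefficient at a time: [Q n g] says that [g] solves the equation modulo
    [tau ^+ n.+1] with the prescribed constant term, and the next coefficient solves a linear
    equation whose slope, the constant term of the derivative, never changes. *)
Lemma hensel P a : fcoef0 P.[a] = 0 -> fcoef0 P^`().[a] != 0 ->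
  exists b, P.[b] = 0 /\ fcoef0 b = fcoef0 a.
Proof.
move=> Pa dPa.
pose Q n g := fcoef0 g = fcoef0 a /\ forall i, (i < n.+1)%N -> fcoef P.[g] i = 0.
(* The witness is quantified outside the hypothesis [Q n g], so that choice yields a function of all
   [n] and [g]. *)
have step n g : exists c, Q n g -> Q n.+1 (g + tau ^+ n.+1 * cst c).
  exists (- fcoef P.[g] n.+1 / fcoef0 P^`().[g]) => -[g0 Pg]; split.
    rewrite -g0 exprS -mulrA [LHS](rmorphD fcoef0).
    by rewrite [X in _ + X](fcoef_tau _ 0) addr0.
  move=> i lt_i; have [r ->] := horner_taylor2 P g (tau ^+ n.+1 * cst
     (- fcoef P.[g] n.+1 / fcoef0 P^`().[g])).
  set c := _ / _; have dg : fcoef0 P^`().[g] != 0.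
    by rewrite (fcoef0_horner _ g0).
  rewrite mulrCA exprMn -exprM -mulrA.
  rewrite [LHS](_ : _ = fcoef P.[g] i + fcoef (tau ^+ n.+1 * (P^`().[g] * cst c)) i
      + fcoef (tau ^+ (n.+1 * 2) * (cst c ^+ 2 * r)) i) //.
  rewrite !fcoef_tauX; have -> : (i < n.+1 * 2)%N by lia.
  rewrite addr0; case: ltnP => [/Pg -> | le_i]; first by rewrite addr0.
  have -> : i = n.+1 by lia.
  rewrite subnn [fcoef (_ * _) 0](_ : _ = fcoef0 P^`().[g] * c); last first.
    exact: (rmorphM fcoef0 _ (cst c)).
  by rewrite /c mulrCA mulfV // mulr1 subrr.
pose c n g := projT1 (cid (step n g)).
have cP n g : Q n g -> Q n.+1 (g + tau ^+ n.+1 * cst (c n g)).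
  by rewrite /c; case: cid.
pose G := fix G n := if n is n'.+1 then G n' + tau ^+ n *  cst (c n' (G n')) else a.
have GQ n : Q n (G n).
  by elim: n => [|n IH] /=; [split=> // -[|i] | exact: cP].
(* Diagonal limit: corrections made after stage [n] start at [tau ^+ n.+1], so coefficient [n] of
   [G n] is final. *)
pose b := Fps (fun n => fcoef (G n) n).
have Gle n m i : (i <= n)%N -> fcoef (G (n + m)%N) i = fcoef (G n) i.
  move=> le_in; elim: m => [|m IH]; first by rewrite addn0.
  rewrite addnS /= -/(fcoef _ _) -IH.
  rewrite [LHS](_ : _ = fcoef (G (n + m)%N) i +
     fcoef (tau ^+ (n + m)%N.+1 * cst (c (n + m)%N (G (n + m)%N))) i) //.
  by rewrite fcoef_tauX ifT ?addr0 //; lia.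
have bG n i : (i < n.+1)%N -> fcoef (b - G n) i = 0.
  move=> le_in; rewrite [LHS](_ : _ = fcoef b i - fcoef (G n) i) //.
  rewrite [fcoef b i]/=; have -> : n = (i + (n - i))%N by lia.
  by rewrite Gle // subrr.
exists b; split=> //; apply: fpsP => n; rewrite [RHS]/=.
have [r] := horner_taylor2 P (G n) (b - G n).
rewrite addrC subrK => ->; rewrite (fps_divtau (@bG n)); set h := Fps _.
have -> : P.[G n] + P^`().[G n] * (tau ^+ n.+1 * h) +
    (tau ^+ n.+1 * h) ^+ 2 * r =
  P.[G n] + tau ^+ n.+1 * (P^`().[G n] * h + h * (tau ^+ n.+1 * h) * r).
  by ring.
rewrite [LHS](_ : _ = fcoef P.[G n] n + fcoef (tau ^+ n.+1 *
  (P^`().[G n] * h + h * (tau ^+ n.+1 * h) * r)) n) //.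
by rewrite fcoef_tauX ltnSn addr0; case: (GQ n) => _ ->.
Qed.

Lemma fps_inverse f : fcoef0 f != 0 -> exists g, f * g = 1.
Proof.
move=> f0; pose P : {poly fps C} := f%:P * 'X - 1%:P.
have PE x : P.[x] = f * x - 1 by rewrite !hornerE.
have dPE x : P^`().[x] = f.
  by rewrite derivB derivM !derivC derivX mul0r add0r mulr1 subr0 hornerC.
have P0 : fcoef0 P.[cst (fcoef0 f)^-1] = 0.
  by rewrite PE rmorphB rmorphM rmorph1 /= fcoef0_cst mulfV ?subrr.
have [|g [Pg _]] := hensel P0; first by rewrite dPE.
by exists g; apply/eqP; rewrite -subr_eq0 -PE Pg.
Qed.

(** Hensel for [X ^ n - f], starting from a root of the constant term; the derivative is nonzero
    there in characteristic zero. *)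
Lemma fps_root n f : (0 < n)%N -> fcoef0 f != 0 -> exists g, g ^+ n = f.
Proof.
move=> n0 f0; pose P : {poly fps C} := 'X^n - f%:P.
have PE x : P.[x] = x ^+ n - f by rewrite !hornerE.
have dPE x : P^`().[x] = x ^+ n.-1 *+ n.
  by rewrite derivB derivXn derivC subr0 hornerMn !hornerE.
have r0 : n.-root (fcoef0 f) ^+ n = fcoef0 f by rewrite rootCK.
have P0 : fcoef0 P.[cst (n.-root (fcoef0 f))] = 0.
  by rewrite PE rmorphB rmorphXn /= fcoef0_cst r0 subrr.
have [|g [Pg _]] := hensel P0.
  rewrite dPE rmorphMn rmorphXn /= fcoef0_cst.
  rewrite mulrn_eq0 negb_or -lt0n n0 /= expf_neq0 //.
  by apply: contraNneq f0 => r00; rewrite -r0 r00 expr0n; case: (n) n0.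
by exists g; apply/eqP; rewrite -subr_eq0 -PE Pg.
Qed.

End Hensel.

(** * Valuation and involutions of C((tau)) *)

Arguments fcoef0 : simpl never.

Section LaurentValuation.
Variable C : numClosedFieldType.
Local Notation k := (laurent C).
Local Notation tau := (ltau C).
Implicit Types (f g u : fps C) (x y : k).

Fact ltofrac_is_zmod_morphism : zmod_morphism (@ltofrac C).
Proof. exact: (rmorphB (@tofrac (fps C))). Qed.
Fact ltofrac_is_monoid_morphism : monoid_morphism (@ltofrac C).
Proof. by split; [exact: tofrac1 | exact: tofracM]. Qed.
HB.instance Definition _ := GRing.isZmodMorphism.Build (fps C) k
  (@ltofrac C) ltofrac_is_zmod_morphism.
HB.instance Definition _ := GRing.isMonoidMorphism.Build (fps C) k
  (@ltofrac C) ltofrac_is_monoid_morphism.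

Fact lconst_is_zmod_morphism : zmod_morphism (@lconst C).
Proof. by move=> a b; rewrite /lconst !rmorphB. Qed.
Fact lconst_is_monoid_morphism : monoid_morphism (@lconst C).
Proof. by split=> [|a b]; rewrite /lconst ?rmorph1 ?rmorphM. Qed.
HB.instance Definition _ := GRing.isZmodMorphism.Build C k
  (@lconst C) lconst_is_zmod_morphism.
HB.instance Definition _ := GRing.isMonoidMorphism.Build C k
  (@lconst C) lconst_is_monoid_morphism.

Lemma ltofrac_inj : injective (@ltofrac C).
Proof. by move=> f g /eqP; rewrite tofrac_eq => /eqP. Qed.

Lemma ltofrac_eq0 f : (ltofrac f == 0) = (f == 0).
Proof. exact: tofrac_eq0. Qed.

Lemma fcoef0_neq0 f : fcoef0 f != 0 -> f != 0.
Proof. by apply: contraNneq => ->; rewrite rmorph0. Qed.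

Lemma ltau_neq0 : tau != 0.
Proof.
rewrite ltofrac_eq0; apply/eqP => /(congr1 (fun f => fcoef f 1)) /= /eqP.
by rewrite oner_eq0.
Qed.
Hint Resolve ltau_neq0 : core.

Lemma fcoef0_tauX n f : (0 < n)%N -> fcoef0 (fps_tau C ^+ n * f) = 0.
Proof. by move=> n0; rewrite /fcoef0 fcoef_tauX n0. Qed.

Lemma fps_nf f : f != 0 -> exists n u, fcoef0 u != 0 /\ f = fps_tau C ^+ n * u.
Proof.
move=> /fps_ord [n fn lt]; exists n, (Fps (fun i => fcoef f (i + n))).
by split; [rewrite /fcoef0 /= | exact: fps_divtau].
Qed.

Lemma fps_lead f : exists g, f = fps_const (fcoef0 f) + fps_tau C * g.
Proof.
have [g Eg] : exists g, f - fps_const (fcoef0 f) = fps_tau C ^+ 1 * g.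
  by eexists; apply: fps_divtau => -[|i] // _; rewrite /= subrr.
by exists g; rewrite -[_ * g]Eg addrC subrK.
Qed.

Lemma laurent_nf x : x != 0 ->
  exists v u, fcoef0 u != 0 /\ x = tau ^ v * ltofrac u.
Proof.
have [a [b [b0 ->]]] := fraction_ratio x => x0.
have a0 : a != 0 by apply: contraNneq x0 => ->; rewrite rmorph0 mul0r.
have [m [u [u0 ->]]] := fps_nf a0; have [l [w [w0 ->]]] := fps_nf b0.
have [g wg] := fps_inverse w0.
have g0 : fcoef0 g != 0.
  apply/eqP => g0; have := congr1 (@fcoef0 C) wg.
  by rewrite rmorphM /= g0 mulr0 rmorph1 => /eqP; rewrite eq_sym oner_eq0.
exists (m%:Z - l%:Z), (u * g); split; first by rewrite rmorphM mulf_neq0.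
have EG : (ltofrac w)^-1 = ltofrac g.
  have lw0 : ltofrac w != 0 by rewrite ltofrac_eq0 fcoef0_neq0.
  by apply: (mulfI lw0); rewrite -rmorphM wg rmorph1 mulfV.
rewrite -!/(ltofrac _) !rmorphM !rmorphXn /= -/tau invfM EG expfzDr //.
by rewrite -invr_expz -!exprnP mulrACA.
Qed.

Lemma ltau_unit_le v w u u' : fcoef0 u != 0 ->
  tau ^ v * ltofrac u = tau ^ w * ltofrac u' -> (w <= v)%R.
Proof.
move=> u0 e; rewrite leNgt; apply/negP => lt_vw.
have [n n0 En] : exists2 n, (0 < n)%N & w = v + n%:Z.
  by exists `|w - v|%N; lia.
move: e; rewrite En expfzDr // -mulrA => /(mulfI (expfz_neq0 _ ltau_neq0)).
rewrite -exprnP /ltau -rmorphXn -rmorphM => /ltofrac_inj Eu.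
by rewrite Eu fcoef0_tauX ?eqxx in u0.
Qed.

Lemma val_tauE v u : fcoef0 u != 0 -> val_tau (tau ^ v * ltofrac u) = v.
Proof.
move=> u0; rewrite /val_tau; case: xgetP => [w _ [u' u'0 e]|/(_ v)]; last first.
  by case; exists u.
apply/eqP; rewrite eq_le (ltau_unit_le u0 e) /=.
by rewrite (ltau_unit_le u'0 (esym e)).
Qed.

Lemma val_tau_unit u : fcoef0 u != 0 -> val_tau (ltofrac u) = 0.
Proof. by move=> u0; rewrite -[ltofrac u]mul1r -(expr0z tau) val_tauE. Qed.

Lemma laurent_nf_val x : x != 0 ->
  exists u, fcoef0 u != 0 /\ x = tau ^ val_tau x * ltofrac u.
Proof.
by move=> /laurent_nf [v [u [u0 ->]]]; exists u; rewrite val_tauE.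
Qed.

Lemma val_tauM x y : x != 0 -> y != 0 ->
  val_tau (x * y) = val_tau x + val_tau y.
Proof.
move=> /laurent_nf_val [u [u0 Ex]] /laurent_nf_val [w [w0 Ey]].
rewrite {1}Ex {1}Ey mulrACA -expfzDr // -rmorphM val_tauE //.
by rewrite rmorphM mulf_neq0.
Qed.

Lemma val_tau1 : val_tau (1 : k) = 0.
Proof. by rewrite -(rmorph1 (@ltofrac C)) val_tau_unit // rmorph1 oner_eq0. Qed.

Lemma val_tauX x n : x != 0 -> val_tau (x ^+ n) = val_tau x * n%:Z.
Proof.
move=> x0; elim: n => [|n IH]; first by rewrite expr0 val_tau1 mulr0.
by rewrite exprS val_tauM ?expf_neq0 // IH intS mulrDr mulr1.
Qed.

Lemma val_tauV x : x != 0 -> val_tau x^-1 = - val_tau x.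
Proof.
move=> x0; have := val_tauM x0 (invr_neq0 x0).
by rewrite mulfV // val_tau1 => /eqP; rewrite eq_sym addrC addr_eq0 => /eqP.
Qed.

Lemma val_tauXz x v : x != 0 -> val_tau (x ^ v) = val_tau x * v.
Proof.
move=> x0; case: v => n; first by rewrite -exprnP val_tauX.
by rewrite NegzE -invr_expz -exprnP val_tauV ?expf_neq0 // val_tauX // mulrN.
Qed.

(** The valuation is the only obstruction: once a power of [tau] is split off, the remaining unit
    has roots of all orders. *)
Lemma laurent_root n x : (0 < n)%N -> x != 0 -> (n %| val_tau x)%Z ->
  exists y, y ^+ n = x.
Proof.
move=> n0 /laurent_nf_val [u [u0 Ex]] /dvdzP [w Ew].
have [g Eg] := fps_root n0 u0; exists (tau ^ w * ltofrac g).
by rewrite exprMn -rmorphXn Eg exprnP exprz_exp -Ew -Ex.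
Qed.

(** The tau-adic topology is separated. Since [e] may have zero constant term, this also serves for
    [t ^+ 2], which is [tau] times a nonunit. *)
Lemma tau_unit_small (e : fps C) x :
  (forall N, exists r, x = (tau * ltofrac e) ^+ N * ltofrac r) -> x = 0.
Proof.
move=> sm; apply: contrapT => /eqP /laurent_nf_val [u [u0 Ex]].
have [r Er] := sm (`|val_tau x|.+1).
have := @ltau_unit_le (val_tau x) (`|val_tau x|.+1) u (e ^+ `|val_tau x|.+1 * r) u0.
rewrite -Ex {1}Er exprMn rmorphM rmorphXn mulrA => /(_ erefl).
by lia.
Qed.

(** Iterated division by [w]. The predicate [P] passes to each quotient, so that a property such as
    being fixed by [s] is available at every stage. *)
Lemma tau_adic_expansion (P : fps C -> Prop) (w : k) :
  (forall f, P f -> exists a g, P g /\ ltofrac f = lconst a + w * ltofrac g) ->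
  forall f, P f -> exists a : nat -> C, forall N, exists r,
    ltofrac f = \sum_(j < N) lconst (a j) * w ^+ j + w ^+ N * ltofrac r.
Proof.
move=> step f Pf.
have step' f' : exists ag, P f' ->
    P ag.2 /\ ltofrac f' = lconst ag.1 + w * ltofrac ag.2.
  have [/step [a [g h]]|nP] := pselect (P f'); first by exists (a, g).
  by exists (0, f').
pose nxt f' := projT1 (cid (step' f')).
have nxtP f' : P f' -> P (nxt f').2 /\
    ltofrac f' = lconst (nxt f').1 + w * ltofrac (nxt f').2.
  by rewrite /nxt; case: cid.
pose G N := iter N (fun f' => (nxt f').2) f.
exists (fun j => (nxt (G j)).1) => N; exists (G N).
have GP n : P (G n) by elim: n => [//|n /nxtP []].
elim: N => [|N IH]; first by rewrite big_ord0 add0r expr0 mul1r.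
rewrite big_ord_recr /= -addrA exprSr -mulrA [lconst _ * _]mulrC -mulrDr.
by case: (nxtP _ (GP N)) => _ <-.
Qed.

Section Involution.
Variable s : {rmorphism k -> k}.
Hypothesis s2 : involutive s.
Hypothesis sC : forall a, s (lconst a) = lconst a.

(* The units of C[[tau]] are the nonzero elements of C((tau)) that are n-th
   powers for all n, a property preserved by s. *)
Lemma s_unit f : fcoef0 f != 0 ->
  exists g, fcoef0 g != 0 /\ s (ltofrac f) = ltofrac g.
Proof.
move=> f0; have sf0 : s (ltofrac f) != 0.
  by rewrite fmorph_eq0 ltofrac_eq0 fcoef0_neq0.
have [u [u0 Eu]] := laurent_nf_val sf0.
suff v0 : val_tau (s (ltofrac f)) = 0.
  by exists u; rewrite Eu v0 expr0z mul1r.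
(* The exponent exceeds the absolute value of [v]; since it divides [v], it forces [v = 0]. *)
set v := val_tau _; have n0 : (0 < `|v|.+1)%N by [].
have [g Eg] := fps_root n0 f0.
have sg0 : s (ltofrac g) != 0.
  rewrite fmorph_eq0 ltofrac_eq0; apply: contraNneq f0 => g0.
  by rewrite -Eg g0 exprS mul0r rmorph0.
have : v = val_tau (s (ltofrac g)) * (`|v|.+1)%:Z.
  by rewrite -val_tauX // -!rmorphXn Eg.
move: (val_tau (s (ltofrac g))) => w.
by have [->|w0] := eqVneq w 0; [lia | nia].
Qed.

(** A nonunit [f] is handled through the unit [f + 1]. If [s] changed the constant term, subtracting
    from [f] the constant term of its image would give a unit sent to a nonunit. *)
Lemma s_integral f : exists g, fcoef0 g = fcoef0 f /\ s (ltofrac f) = ltofrac g.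
Proof.
have int f' : exists g, s (ltofrac f') = ltofrac g.
  have [f0|/s_unit [g [_ ?]]] := eqVneq (fcoef0 f') 0; last by exists g.
  have [|g [_ Eg]] := @s_unit (f' + 1).
    by rewrite rmorphD /= f0 add0r rmorph1 oner_eq0.
  by exists (g - 1); rewrite rmorphB /= -Eg !rmorphD !rmorph1 addrK.
have [g Eg] := int f; exists g; split=> //.
apply: contrapT => /eqP; rewrite -subr_eq0 => ne.
have [|h [h0 Eh]] := @s_unit (f - fps_const (fcoef0 g)).
  by rewrite rmorphB /= fcoef0_cst -opprB oppr_eq0.
case/eqP: h0; have -> : h = g - fps_const (fcoef0 g).
  apply: ltofrac_inj; rewrite -Eh !rmorphB Eg /=; congr (_ - _); exact: sC.
by rewrite rmorphB /= fcoef0_cst subrr.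
Qed.

(** If [s tau] is [tau ^+ m] times a unit [u], applying [s] again gives [tau ^+ (m * m)] times a
    unit, so [m = 1]. Then [u] times its own image is 1, and both have the same constant term. *)
Lemma s_tau : exists u, (fcoef0 u = 1 \/ fcoef0 u = -1) /\ s tau = tau * ltofrac u.
Proof.
have [g [g0 Eg]] := s_integral (fps_tau C); rewrite -/tau in Eg.
have g0' : fcoef0 g = 0 by rewrite g0.
have gn0 : g != 0 by rewrite -ltofrac_eq0 -Eg fmorph_eq0.
have [m [u [u0 Eu]]] := fps_nf gn0.
have [u' [u'0 Eu']] := s_integral u.
have Es : s tau = tau ^+ m * ltofrac u.
  by rewrite Eg Eu rmorphM rmorphXn.
have E2 : tau = tau ^+ (m * m) * ltofrac (u ^+ m * u').
  rewrite -{1}[tau]s2 Es rmorphM rmorphXn Eu' Es exprMn rmorphM rmorphXn.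
  by rewrite -exprM mulrA.
have m1 : m = 1%N.
  have u1 : fcoef0 (u ^+ m * u') != 0.
    by rewrite rmorphM rmorphXn /= u'0 mulf_neq0 ?expf_neq0.
  have := val_tauE (m * m)%N u1; rewrite -exprnP -E2.
  have := @val_tauE 1 1; rewrite rmorph1 oner_eq0 expr1z rmorph1 mulr1 => -> // ?.
  by nia.
exists u; rewrite Es m1 expr1; split=> //.
have /ltofrac_inj E1 : ltofrac 1 = ltofrac (u * u').
  apply: (mulfI ltau_neq0); rewrite rmorph1 mulr1 {1}E2 m1 !expr1.
  by [].
have /eqP := congr1 (@fcoef0 C) E1; rewrite rmorph1 rmorphM /= u'0 eq_sym -expr2.
by rewrite sqrf_eq1 => /orP [] /eqP; [left | right].
Qed.

Lemma lead_unif (e : fps C) f : fcoef0 e != 0 ->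
  exists g, ltofrac f = lconst (fcoef0 f) + tau * ltofrac e * ltofrac g.
Proof.
move=> e0; have [g Eg] := fps_lead f; have [h eh] := fps_inverse e0.
exists (h * g); rewrite {1}Eg rmorphD rmorphM /=; congr (_ + _).
by rewrite -mulrA -[ltofrac e * _]rmorphM [e * _]mulrA eh mul1r.
Qed.

Lemma unif_nf (e : fps C) x : fcoef0 e != 0 -> x != 0 ->
  exists u, fcoef0 u != 0 /\ x = (tau * ltofrac e) ^ val_tau x * ltofrac u.
Proof.
move=> e0 /laurent_nf_val [u [u0 Ex]]; have [h eh] := fps_inverse e0.
have h0 : fcoef0 h != 0.
  apply/eqP => h0; have := congr1 (@fcoef0 C) eh.
  by rewrite rmorphM /= h0 mulr0 rmorph1 => /eqP; rewrite eq_sym oner_eq0.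
have Eh : ltofrac h = (ltofrac e)^-1.
  apply: (mulfI (x := ltofrac e)); first by rewrite ltofrac_eq0 fcoef0_neq0.
  by rewrite -rmorphM eh rmorph1 mulfV // ltofrac_eq0 fcoef0_neq0.
have [e' [e'0 Ee]] : exists e', fcoef0 e' != 0 /\
    ltofrac e' = (ltofrac e) ^ (- val_tau x).
  case: (- val_tau x) => n.
    by exists (e ^+ n); rewrite !rmorphXn /= expf_neq0.
  by exists (h ^+ n.+1); rewrite !rmorphXn /= expf_neq0 // Eh exprVn.
exists (e' * u); split; first by rewrite rmorphM mulf_neq0.
rewrite {1}Ex rmorphM /= Ee expfzMl.
rewrite -[RHS]mulrA [X in _ = _ * X]mulrA -expfzDr ?ltofrac_eq0 ?fcoef0_neq0 //.
by rewrite subrr expr0z mul1r.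
Qed.

(** If [s tau] has leading coefficient -1, then [tau - s tau] is an anti-invariant uniformizer. If
    it is 1, then [tau + s tau] is an invariant uniformizer, and expansions in its powers show that
    [s] fixes everything. *)
Lemma s_nontrivial_uniformizer : (exists x, s x <> x) ->
  exists e, fcoef0 e != 0 /\ s (tau * ltofrac e) = - (tau * ltofrac e).
Proof.
move=> [x sx]; have [u [[u1|u1] Eu]] := s_tau; last first.
  exists (1 - u); split.
    by rewrite rmorphB rmorph1 /= u1 opprK -[1 + 1]/(2%:R) pnatr_eq0.
  have Et : tau * ltofrac (1 - u) = tau - s tau.
    by rewrite Eu rmorphB rmorph1 mulrBr mulr1.
  by rewrite Et rmorphB s2 opprB.
case: sx; set e := 1 + u; have e0 : fcoef0 e != 0.
  by rewrite rmorphD rmorph1 /= u1 -[1 + 1]/(2%:R) pnatr_eq0.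
pose w := tau * ltofrac e.
have Ew : w = tau + s tau by rewrite Eu /w rmorphD rmorph1 mulrDr mulr1.
have sw : s w = w by rewrite Ew rmorphD s2 addrC.
have sf f : s (ltofrac f) = ltofrac f.
  have [|a fa] := @tau_adic_expansion (fun=> True) w _ f I.
    move=> f' _; have [g Eg] := lead_unif f' e0.
    by exists (fcoef0 f'), g.
  apply/eqP; rewrite -subr_eq0; apply/eqP/(@tau_unit_small e) => N.
  have [r ->] := fa N; have [r' [_ Er]] := s_integral r.
  exists (r' - r); rewrite rmorphD rmorphM Er rmorphXn sw rmorph_sum /=.
  under eq_bigr do rewrite rmorphM sC rmorphXn sw.
  by rewrite rmorphB -/w; ring.
have [->|x0] := eqVneq x 0; first by rewrite rmorph0.
have [y [_ ->]] := unif_nf e0 x0.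
by rewrite rmorphM fmorphXz sw sf.
Qed.

Section AntiInvariantUniformizer.
Variable e : fps C.
Hypothesis e0 : fcoef0 e != 0.
Local Notation t := (tau * ltofrac e).
Hypothesis st : s t = - t.

Lemma unif_neq0 : t != 0.
Proof. by rewrite mulf_neq0 // ltofrac_eq0 fcoef0_neq0. Qed.

Lemma val_unif : val_tau t = 1.
Proof. by rewrite -{1}(expr1z tau) val_tauE. Qed.

Lemma val_s x : x != 0 -> val_tau (s x) = val_tau x.
Proof.
move=> x0; have [u [u0 Eu]] := unif_nf e0 x0.
have [g [g0 Eg]] := s_unit u0.
have stE : s t = tau * ltofrac (- e) by rewrite st rmorphN mulrN.
have st0 : s t != 0 by rewrite fmorph_eq0 unif_neq0.
have vst : val_tau (s t) = 1.
  by rewrite stE -{1}(expr1z tau) val_tauE // rmorphN oppr_eq0.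
rewrite {1}Eu rmorphM fmorphXz val_tauM ?expfz_neq0 //; last first.
  by rewrite fmorph_eq0 ltofrac_eq0 fcoef0_neq0.
by rewrite Eg (val_tau_unit g0) addr0 val_tauXz // vst mul1r.
Qed.

Lemma antiinvariant_lead f : s (ltofrac f) = - ltofrac f -> fcoef0 f = 0.
Proof.
have [g [g0 ->]] := s_integral f; rewrite -rmorphN => /ltofrac_inj Eg.
move: g0; rewrite Eg rmorphN /= => /eqP.
by rewrite eq_sym -addr_eq0 -mulr2n mulrn_eq0 /= => /eqP.
Qed.

(** An anti-invariant series has zero constant term; in [x = t ^ v * u] with [u] a unit, an odd [v]
    would make [u] anti-invariant. *)
Lemma fixed_val_even x : x != 0 -> s x = x -> (2 %| val_tau x)%Z.
Proof.
move=> x0 sx; have [u [u0 Eu]] := unif_nf e0 x0.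
move: Eu; set v := val_tau x => Eu.
apply: contraT => vodd; case/eqP: u0.
apply: antiinvariant_lead; apply: (mulfI (expfz_neq0 v unif_neq0)).
rewrite mulrN -Eu -sx Eu rmorphM fmorphXz st.
rewrite expNrz.
have -> : (-1 : k) ^ v = -1.
  have : odd `|v| by move: vodd; rewrite dvdzE dvdn2 negbK.
  case: (v) => n /= on; first by rewrite -exprnP -signr_odd on.
  by rewrite NegzE -invr_expz -exprnP -signr_odd /= on expr1 invrN1.
by rewrite mulN1r mulNr opprK.
Qed.

(** Valuations give [d * val g = 2 * val b], and the factor 2 cancels because [val g] is even. *)
Lemma norm_val_dvd (g b : k) d : g != 0 -> b != 0 -> s g = g ->
  g ^+ d = b * s b -> (d%:Z %| val_tau b)%Z.
Proof.
move=> g0 b0 sg e1; have /dvdzP [w Ew] := fixed_val_even g0 sg.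
have sb0 : s b != 0 by rewrite fmorph_eq0.
have := congr1 (@val_tau _) e1.
rewrite (val_tauX d g0) (val_tauM b0 sb0) (val_s b0) Ew.
move: (val_tau b) => v Ev; apply/dvdzP; exists w.
by lia.
Qed.

(** For an invariant [f = a + t * g] the quotient [g] is anti-invariant, hence again divisible by
    [t], so the expansion proceeds by powers of [t ^+ 2]. Conversely, truncations are fixed and
    remainders are arbitrarily small. *)
Lemma fixed_laurent_in x : s x = x <-> laurent_in (t ^+ 2) x.
Proof.
have t0 := unif_neq0; have st2 : s (t ^+ 2) = t ^+ 2.
  by rewrite rmorphXn st sqrrN.
split=> [sx|[v [a xa]]].
  have [->|x0] := eqVneq x 0.
    exists 0, (fun=> 0) => N; exists 0; rewrite (rmorph0 (@ltofrac C)) mulr0 addr0 big1 // => j _.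
    by rewrite (rmorph0 (@lconst C)) mul0r.
  have /dvdzP [v Ev] := fixed_val_even x0 sx.
  have [u [u0 Eu]] := unif_nf e0 x0.
  have Ex : x = (t ^+ 2) ^ v * ltofrac u.
    by rewrite {1}Eu Ev [v * _]mulrC exprnP exprz_exp.
  have t2v : (t ^+ 2) ^ v != 0 by rewrite expfz_neq0 // expf_neq0.
  have su : s (ltofrac u) = ltofrac u.
    by apply: (mulfI t2v); rewrite -Ex -sx Ex rmorphM fmorphXz st2.
  have [|a ua] := @tau_adic_expansion
       (fun f => s (ltofrac f) = ltofrac f) (t ^+ 2) _ u su.
    move=> f sf; have [g Eg] := lead_unif f e0; have [h Eh] := lead_unif g e0.
    have sg : s (ltofrac g) = - ltofrac g.
      have Et : t * ltofrac g = ltofrac f - lconst (fcoef0 f).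
        by rewrite Eg addrAC subrr add0r.
      have : s (t * ltofrac g) = t * ltofrac g by rewrite Et rmorphB sC sf.
      by rewrite rmorphM st mulNr => /eqP; rewrite eqr_oppLR -mulrN => /eqP/(mulfI t0).
    have g0 := antiinvariant_lead sg; rewrite g0 rmorph0 add0r in Eh.
    exists (fcoef0 f), h; split; last by rewrite {1}Eg Eh mulrA -expr2.
    apply: (mulfI t0); apply: oppr_inj.
    by rewrite -mulNr -st -rmorphM -Eh sg.
  exists v, a => N; have [r Er] := ua N; exists r.
  rewrite Ex Er mulrDr mulr_sumr expfzDr ?expf_neq0 // -mulrA; congr (_ + _).
  by apply: eq_bigr => j _; rewrite expfzDr ?expf_neq0 // mulrCA.
have t20 : t ^+ 2 != 0 by rewrite expf_neq0.
have t2v : (t ^+ 2) ^ v != 0 by rewrite expfz_neq0.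
apply/eqP; rewrite -subr_eq0; apply/eqP/(mulfI (invr_neq0 t2v)).
rewrite mulr0; apply: (@tau_unit_small (e * (fps_tau C * e))) => N.
have [r Er] := xa N; have [r' [_ Er']] := s_integral r.
exists (r' - r).
have -> : tau * ltofrac (e * (fps_tau C * e)) = t ^+ 2.
  by rewrite !rmorphM /= -/tau; ring.
rewrite Er rmorphD rmorphM rmorph_sum fmorphXz st2 Er' /=.
under eq_bigr do rewrite rmorphM sC fmorphXz st2.
rewrite opprD addrACA subrr add0r -mulrBr -rmorphB expfzDr //.
by rewrite -exprnP mulrA mulKf.
Qed.

End AntiInvariantUniformizer.
End Involution.
End LaurentValuation.

(** * Eigenvectors and Kummer generators *)

Section EigenDecomposition.
Variables (k : fieldType) (F : comUnitAlgType k) (V : lmodType F) (T : V -> V).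
Hypothesis TD : {morph T : u v / u + v}.
Hypothesis TZ : forall (c : k) v, T ((c%:A : F) *: v) = (c%:A : F) *: T v.
Variables (N : nat) (om b : k).
Hypothesis om_prim : N.-primitive_root om.
Hypothesis N0 : N%:R != 0 :> k.
Hypothesis b0 : b != 0.

Lemma alg_scaleA (c d : k) (v : V) :
  (c%:A : F) *: ((d%:A : F) *: v) = ((c * d)%:A : F) *: v.
Proof. by rewrite scalerA -scalerAl mul1r scalerA. Qed.

Lemma alg_scale1 (v : V) : ((1 : k)%:A : F) *: v = v.
Proof. by rewrite !scale1r. Qed.

Lemma alg_scale_eq0 (c : k) (v : V) : c != 0 -> (c%:A : F) *: v = 0 -> v = 0.
Proof.
move=> c0 cv; rewrite -[v]alg_scale1 -(mulVf c0) -alg_scaleA cv.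
by rewrite scaler0.
Qed.

Lemma sum_unity_root (x : k) : x ^+ N = 1 -> x != 1 -> \sum_(j < N) x ^+ j = 0.
Proof.
move=> xN x1; apply: (mulfI (x := x - 1)); first by rewrite subr_eq0.
by rewrite -subrX1 xN subrr mulr0.
Qed.

(** The Fourier projector onto the eigenvalue [mu], meant for an operator with N-th power [b ^+ N].
    Scalars of [k] act through [F], because [V] carries only an F-module structure. *)
Definition eigproj (mu : k) (v : V) : V :=
  ((N%:R^-1)%:A : F) *: \sum_(j < N) ((mu ^- j)%:A : F) *: iter j T v.

Lemma iter_TD j : {morph iter j T : u v / u + v}.
Proof. by elim: j => [//|j IH] u v; rewrite !iterS IH TD. Qed.

Lemma iter_TZ j (c : k) v : iter j T ((c%:A : F) *: v) = (c%:A : F) *: iter j T v.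
Proof. by elim: j => [//|j IH]; rewrite !iterS IH TZ. Qed.

Lemma iter_T0 j : iter j T 0 = 0.
Proof. by have := iter_TZ j 0 0; rewrite !scale0r. Qed.

Lemma eigprojD mu : {morph eigproj mu : u v / u + v}.
Proof.
move=> u v; rewrite /eigproj -scalerDr -big_split /=; congr (_ *: _).
by apply: eq_bigr => j _; rewrite iter_TD scalerDr.
Qed.

Lemma eigproj0 mu : eigproj mu 0 = 0.
Proof. by rewrite /eigproj big1 ?scaler0 // => j _; rewrite iter_T0 scaler0. Qed.

Lemma iter_eig j (mu : k) v : T v = (mu%:A : F) *: v ->
  iter j T v = ((mu ^+ j)%:A : F) *: v.
Proof.
move=> Tv; elim: j => [|j IH]; first by rewrite expr0 alg_scale1.
by rewrite iterS IH TZ Tv alg_scaleA exprSr.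
Qed.

Lemma eigproj_eig (mu nu : k) v : mu ^+ N = b ^+ N -> nu ^+ N = b ^+ N ->
  T v = (nu%:A : F) *: v -> eigproj mu v = if mu == nu then v else 0.
Proof.
move=> mN nN Tv; have N1 := prim_order_gt0 om_prim.
have mu0 : mu != 0.
  by apply: contraNneq b0 => mu0; move/eqP: mN; rewrite mu0 expr0n gtn_eqF // eq_sym expf_eq0 => /andP [].
have -> : eigproj mu v = ((N%:R^-1 * \sum_(j < N) (nu / mu) ^+ j)%:A : F) *: v.
  rewrite -alg_scaleA /eigproj; congr (_ *: _); rewrite !scaler_suml.
  apply: eq_bigr => j _; rewrite (iter_eig _ Tv) alg_scaleA.
  by rewrite exprMn exprVn mulrC.
case: eqP => [<-|/eqP ne].
  rewrite mulfV //; under eq_bigr do rewrite expr1n.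
  by rewrite sumr_const card_ord mulVf // alg_scale1.
rewrite sum_unity_root ?mulr0 ?scale0r //.
  by rewrite exprMn exprVn mN nN mulfV // expf_neq0.
by apply: contraNneq ne => e; rewrite -[nu](mulfVK mu0) e mul1r.
Qed.

(** After exchanging the sums only [j = 0] survives, the sums of the other powers of [om] being
    zero. *)
Lemma eigproj_sum v : \sum_(i < N) eigproj (b * om ^+ i) v = v.
Proof.
have N1 := prim_order_gt0 om_prim.
rewrite /eigproj -scaler_sumr exchange_big /=.
rewrite (bigD1 (Ordinal N1)) //= [X in _ + X]big1 ?addr0 => [|j j0].
  under eq_bigr do rewrite expr0 invr1 alg_scale1.
  rewrite sumr_const card_ord -scaler_nat -[X in _ *: (X *: _)]scaler_nat.
  by rewrite alg_scaleA mulVf // alg_scale1.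
rewrite -scaler_suml -scaler_suml.
have -> : \sum_(i < N) (b * om ^+ i) ^- j = b ^- j * \sum_(i < N) (om ^- j) ^+ i.
  rewrite mulr_sumr; apply: eq_bigr => i _.
  by rewrite exprMn invfM -exprM mulnC exprM exprVn.
rewrite sum_unity_root ?mulr0 ?scale0r //.
  by rewrite exprVn -exprM mulnC exprM (prim_expr_order om_prim) expr1n invr1.
rewrite -(inj_eq invr_inj) invrK invr1 -(prim_order_dvd om_prim) gtnNdvd //.
by rewrite lt0n.
Qed.

(** Applying [T] shifts the sum cyclically, and the relation on [iter N T v] closes it up. *)
Lemma eigprojT (i : nat) v : iter N T v = ((b ^+ N)%:A : F) *: v ->
  T (eigproj (b * om ^+ i) v) = ((b * om ^+ i)%:A : F) *: eigproj (b * om ^+ i) v.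
Proof.
set mu := b * om ^+ i => TN; have muN : mu ^+ N = b ^+ N.
  by rewrite exprMn -exprM mulnC exprM (prim_expr_order om_prim) expr1n mulr1.
have mu0 : mu != 0.
  by rewrite mulf_neq0 ?expf_neq0 // (prim_root_eq0 om_prim) gtn_eqF // (prim_order_gt0 om_prim).
rewrite /eigproj TZ [RHS]scalerA [_%:A * _]mulrC -[RHS]scalerA; congr (_ *: _).
have N1 := prim_order_gt0 om_prim.
have T0 : T 0 = 0 by have := iter_T0 1.
rewrite (big_morph T TD T0) scaler_sumr; case: (N) N1 TN muN => // M _ TN muN.
rewrite big_ord_recr big_ord_recl /= [RHS]addrC TZ -iterS TN.
rewrite expr0 invr1 !alg_scaleA mulr1 -muN exprS mulrCA mulVf ?expf_neq0 // mulr1.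
congr (_ + _); apply: eq_bigr => j _; rewrite TZ alg_scaleA /bump /=.
by rewrite exprS invfM mulrA mulfV // mul1r.
Qed.

End EigenDecomposition.

Section KummerGenerator.
Variables (k : fieldType) (X : polarized_setup k).
Local Notation F := (psF X).
Local Notation n := (psn X).
Local Notation zeta := (zeta X).

(** A finite product of fields is von Neumann regular: invert the nonzero components and keep the
    zeros. *)
Lemma psF_regular (a : F) : exists y, a * y * a = a.
Proof.
have [r [K [p [_ inj surj]]]] := ps_sep X.
have [y Ey] := surj (fun j => (p j a)^-1); exists y.
apply: inj => j; rewrite !rmorphM /= Ey.
by have [->|a0] := eqVneq (p j a) 0; rewrite ?mulr0 // mulfV // mul1r.
Qed.

Lemma alg_inj : injective (fun c : k => c%:A : F).
Proof. exact: (fmorph_inj (in_alg F)). Qed.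

(* The support of an eigenvector is a zeta-invariant idempotent. *)
Lemma zeta_eig_unit (a : F) (c : k) : c != 0 -> a != 0 ->
  zeta a = c%:A * a -> a \is a GRing.unit.
Proof.
move=> c0 a0 za; have [y aya] := psF_regular a; pose e := y * a.
have cu : (c%:A : F) \is a GRing.unit by rewrite -in_algE rmorph_unit ?unitfE.
have ae : a * e = a by rewrite mulrA.
have aze : a * zeta e = a.
  by apply: (mulrI cu); rewrite mulrA -za -rmorphM ae.
have eze : e * zeta e = e by rewrite /e -mulrA aze.
have zee : zeta e * e = zeta e.
  by rewrite {1 2}/e rmorphM za -!mulrA ae.
have ze : zeta e = e by rewrite -zee mulrC eze.
have [x Ex] := (ps_zeta_fix e).1 ze.
have x0 : x != 0.
  by apply: contraNneq a0 => x0; rewrite -ae Ex x0 scale0r mulr0.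
have : x * x = x.
  by apply: alg_inj; rewrite -[LHS]/(in_alg F _) rmorphM /= -Ex /e -mulrA ae.
move/(canRL (mulfK x0)); rewrite mulfV // => x1.
by apply/unitrP; exists y; rewrite [a * y]mulrC -/e Ex x1 scale1r.
Qed.

Lemma zetaZ (c : k) (a : F) : zeta (c%:A * a) = c%:A * zeta a.
Proof. by rewrite rmorphM zeta_scalar. Qed.

Variable om : k.
Hypothesis om_prim : n.-primitive_root om.
Hypothesis n0 : n%:R != 0 :> k.

Lemma om_neq0 : om != 0.
Proof. by rewrite (prim_root_eq0 om_prim) gtn_eqF // (prim_order_gt0 om_prim). Qed.

Let zproj := @eigproj k F (F^o : lmodType F) zeta n.

Lemma zproj_eig (i : nat) (a : F) :
  zeta (zproj (om ^+ i) a) = (om ^+ i)%:A * zproj (om ^+ i) a.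
Proof.
have := @eigprojT k F (F^o : lmodType F) zeta (rmorphD zeta) zetaZ n om 1
  om_prim (oner_neq0 _) i a; rewrite mul1r; apply.
by rewrite ps_zeta_n expr1n alg_scale1.
Qed.

Lemma zproj_sum (a : F) : \sum_(i < n) zproj (om ^+ i) a = a.
Proof.
have := @eigproj_sum k F (F^o : lmodType F) zeta n om 1
  om_prim n0 a; by under eq_bigr do rewrite mul1r.
Qed.

Lemma iter_zeta_eig j (c : k) (a : F) : zeta a = c%:A * a ->
  iter j zeta a = (c ^+ j)%:A * a.
Proof. exact: (@iter_eig k F (F^o : lmodType F) zeta zetaZ j c a). Qed.

(** Eigenvectors are units and can be divided, so the exponents [j] for which [om ^+ j] is an
    eigenvalue are multiples of the least positive one, [g]. As [F] is the sum of its eigenspaces,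
    the power [n / g] of [zeta] is the identity, whence [g = 1]. *)
Lemma kummer_generator : exists y : F,
  y \is a GRing.unit /\ zeta y = om%:A * y.
Proof.
pose P j := (0 < j)%N && `[< exists2 a : F, a != 0 & zeta a = (om ^+ j)%:A * a >].
have Pn : P n.
  rewrite /P ps_n0; apply/asboolP; exists 1; first exact: oner_neq0.
  by rewrite rmorph1 (prim_expr_order om_prim) scale1r mulr1.
case: (ex_minnP (ex_intro _ n Pn)) => g /andP [g0 /asboolP [y y0 zy]] gmin.
have om0 i : om ^+ i != 0 by rewrite expf_neq0 // om_neq0.
have yu := zeta_eig_unit (om0 g) y0 zy.
have Pg j a : a != 0 -> zeta a = (om ^+ j)%:A * a -> (g %| j)%N.
  move=> a0 za; have au := zeta_eig_unit (om0 j) a0 za.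
  rewrite /dvdn -leqn0 leqNgt; apply/negP => r0.
  suff : P (j %% g)%N by move/gmin; rewrite leqNgt ltn_pmod.
  rewrite /P r0; apply/asboolP; exists (a / y ^+ (j %/ g)).
    by apply: contraTneq isT => e; have := unitrM (a) (y ^- (j %/ g)); rewrite e unitr0 unitrV unitrX ?au.
  rewrite rmorphM rmorphV ?unitrX // rmorphXn /= za zy exprMn.
  have -> : ((om ^+ g)%:A : F) ^+ (j %/ g) = (om ^+ (g * (j %/ g)))%:A.
    by rewrite exprM -[LHS](rmorphXn (in_alg F)).
  have Bu : ((om ^+ (g * (j %/ g)))%:A : F) \is a GRing.unit.
    by rewrite -in_algE rmorph_unit ?unitfE ?om0.
  have -> : ((om ^+ j)%:A : F) = (om ^+ (j %% g))%:A * (om ^+ (g * (j %/ g)))%:A.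
    by rewrite -[RHS](rmorphM (in_alg F)) /= -exprD addnC mulnC -divn_eq.
  rewrite invrM ?unitrX //; move: (divrr Bu).
  set B := (_ ^+ (g * _))%:A; move: B^-1 (y ^+ _)^-1 => B' Y' BB.
  by transitivity (B * B' * ((om ^+ (j %% g))%:A * (a * Y'))); [ring | rewrite BB mul1r].
have gn : (g %| n)%N.
  by apply: (Pg n 1); rewrite ?oner_neq0 // rmorph1 (prim_expr_order om_prim) scale1r mulr1.
have g1 : g = 1%N.
  apply: contrapT => /eqP gne1.
  have ltn : (0 < n %/ g < n)%N.
    by rewrite divn_gt0 // dvdn_leq ?ps_n0 //= ltn_Pdiv ?ps_n0 //; lia.
  have [a []] := ps_zeta_min ltn.
  have iD : {morph iter (n %/ g) zeta : u v / u + v}.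
    exact: (@iter_TD k F (F^o : lmodType F) zeta (rmorphD zeta)).
  have i0 : iter (n %/ g) zeta 0 = 0.
    by elim: (n %/ g)%N => //= j ->; rewrite rmorph0.
  rewrite -{1}(zproj_sum a) (big_morph _ iD i0) -[RHS](zproj_sum a).
  apply: eq_bigr => i _; have zi := zproj_eig i a.
  rewrite (iter_zeta_eig _ zi).
  have [->|ne] := eqVneq (zproj (om ^+ i) a) 0; first by rewrite mulr0.
  have /dvdnP [l ->] := Pg _ _ ne zi.
  rewrite -exprM -mulnA [(g * _)%N]mulnC divnK // mulnC exprM (prim_expr_order om_prim).
  by rewrite expr1n scale1r mul1r.
by exists y; rewrite zy g1 expr1.
Qed.

(** A component with eigenvalue [om ^+ j] becomes invariant under [zeta], hence scalar, after
    division by [y ^+ j]; thus [F] is [k[y]]. *)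
Lemma kummer_expansion (y f : F) : y \is a GRing.unit -> zeta y = om%:A * y ->
  exists c : 'I_n -> k, f = \sum_j (c j)%:A * y ^+ j.
Proof.
move=> yu zy; have cE (j : 'I_n) : exists c : k, zproj (om ^+ j) f = c%:A * y ^+ j.
  have [c Ec] : exists c : k, zproj (om ^+ j) f / y ^+ j = c%:A.
    apply/ps_zeta_fix; rewrite rmorphM rmorphV ?unitrX // rmorphXn zy zproj_eig.
    rewrite exprMn invrM ?unitrX //; last by rewrite -in_algE rmorph_unit ?unitfE ?om_neq0.
    have -> : ((om%:A : F) ^+ j) = (om ^+ j)%:A by rewrite -[LHS](rmorphXn (in_alg F)).
    have Bu : ((om ^+ j)%:A : F) \is a GRing.unit.
      by rewrite -in_algE rmorph_unit ?unitfE ?expf_neq0 ?om_neq0.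
    move: (divrr Bu); move: ((om ^+ j)%:A)^-1 (y ^+ _)^-1 => B' Y' BB.
    by transitivity ((om ^+ j)%:A * B' * (zproj (om ^+ j) f * Y')); [ring | rewrite BB mul1r].
  by exists c; rewrite -Ec mulrVK ?unitrX.
exists (fun j => projT1 (cid (cE j))); rewrite -{1}(zproj_sum f).
by apply: eq_bigr => j _; case: cid.
Qed.

End KummerGenerator.

(** * Modules over the symbol algebra *)

Section Monomials.
Variables (k : fieldType) (X : polarized_setup k).
Local Notation F := (psF X).
Local Notation n := (psn X).
Local Notation zeta := (zeta X).
Variable om : k.
Hypothesis om_prim : n.-primitive_root om.
Hypothesis n0 : n%:R != 0 :> k.
Variable y : F.
Hypothesis yu : y \is a GRing.unit.
Hypothesis zy : zeta y = om%:A * y.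
Variable a : k.
Hypothesis a0 : a != 0.
Hypothesis ya : y ^+ n = a%:A.

Section Module.
Variable U : abmod X.
Local Notation th := (@abop k X U).
Local Notation "c *! u" := ((c%:A : F) *: (u : U)) (at level 40).
Implicit Types (u v : U) (c : k).

Lemma abop_alg c u : th (c *! u) = c *! th u.
Proof. by rewrite abopZ zeta_scalar. Qed.

Lemma iter_abop_alg i c u : iter i th (c *! u) = c *! iter i th u.
Proof. exact: (iter_TZ abop_alg). Qed.

Definition mono (x z : nat) u : U := y ^+ x *: iter z th u.

Lemma monoD x z : {morph mono x z : u v / u + v}.
Proof. by move=> u v; rewrite /mono iter_abopD scalerDr. Qed.

Lemma monoZ x z c u : mono x z (c *! u) = c *! mono x z u.
Proof. by rewrite /mono iter_abop_alg !scalerA mulrC. Qed.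

Lemma iter_abopZ_zeta z (f : F) u :
  iter z th (f *: u) = iter z zeta f *: iter z th u.
Proof. by elim: z => [//|z IH]; rewrite !iterS IH abopZ. Qed.

Lemma mono_mono x z x' z' u :
  mono x z (mono x' z' u) = om ^+ (x' * z) *! mono (x + x') (z + z') u.
Proof.
have zyx : zeta (y ^+ x') = (om ^+ x')%:A * y ^+ x'.
  by rewrite rmorphXn /= zy exprMn -[(_%:A ^+ _)](rmorphXn (in_alg F)).
rewrite /mono iter_abopZ_zeta (iter_zeta_eig z zyx) -exprM -iterD !scalerA.
by congr (_ *: _); rewrite exprD mulrCA.
Qed.

(** Products of monomials cost powers of [om], and reducing exponents modulo [n] costs powers of [a]
    and [b]; spans do not see these scalars. *)
Definition sim u v := exists2 c, c != 0 & u = c *! v.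

Lemma sim_refl u : sim u u.
Proof. by exists 1; rewrite ?oner_neq0 ?alg_scale1. Qed.

Lemma sim_trans u v w : sim u v -> sim v w -> sim u w.
Proof.
move=> [c c0 ->] [d d0 ->]; exists (c * d); first exact: mulf_neq0.
by rewrite alg_scaleA.
Qed.

Lemma sim_sym u v : sim u v -> sim v u.
Proof.
move=> [c c0 ->]; exists c^-1; first by rewrite invr_eq0.
by rewrite alg_scaleA mulVf // alg_scale1.
Qed.

Lemma sim_mono x z u v : sim u v -> sim (mono x z u) (mono x z v).
Proof. by move=> [c c0 ->]; exists c; rewrite ?monoZ. Qed.

Lemma sim_iter_mono i x z u v :
  sim u v -> sim (iter i (mono x z) u) (iter i (mono x z) v).
Proof. by move=> uv; elim: i => [//|i IH]; rewrite !iterS; apply: sim_mono. Qed.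

Lemma sim_alg c u : c != 0 -> sim (c *! u) u.
Proof. by exists c. Qed.

Lemma om_expr_neq0 i : om ^+ i != 0.
Proof. by rewrite expf_neq0 // (om_neq0 om_prim). Qed.

(** The binomial coefficient is the sum 0 + 1 + ... + (i - 1): a new factor moves its theta's past
    the y's of all previous ones. *)
Lemma iter_mono x z i u :
  iter i (mono x z) u = om ^+ (x * z * 'C(i, 2)) *! mono (x * i) (z * i) u.
Proof.
elim: i => [|i IH].
  by rewrite bin0n /= !muln0 expr0 alg_scale1 /mono expr0 scale1r.
rewrite iterS IH monoZ mono_mono alg_scaleA -exprD -!mulnS.
by congr ((om ^+ _)%:A *: mono _ _ _); rewrite ?binS ?bin1; nia.
Qed.

Lemma sim_iter_monoE x z i u : sim (iter i (mono x z) u) (mono (x * i) (z * i) u).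
Proof. by rewrite iter_mono; apply/sim_alg/om_expr_neq0. Qed.

Lemma mono_eq0 x z u : mono x z u = 0 -> u = 0.
Proof.
move=> /(congr1 (fun v => y ^- x *: v)); rewrite scaler0 /mono scalerA mulVr ?unitrX //.
rewrite scale1r; elim: z => [//|z IH] /= e; apply: IH.
(* The operator theta is injective because a positive power of it is a nonzero scalar; [psm X = 0]
   would make m/n vanish in [k]. *)
have m0 : (0 < psm X)%N.
  by rewrite lt0n; apply: contraTneq (ps_d0 X) => ->; rewrite div0n eqxx.
have /(congr1 (iter (psm X).-1 th)) := e; rewrite -iterSr prednK // abop_m.
have -> : iter (psm X).-1 th 0 = 0 by elim: (psm X).-1 => //= j ->; rewrite abop0.
exact/alg_scale_eq0/ps_beta0.
Qed.

Lemma iter_mono_eq0 i x z u : iter i (mono x z) u = 0 -> u = 0.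
Proof. by elim: i => [//|i IH] /= /mono_eq0. Qed.

Section Eigen.
Variable b : k.
Hypothesis b0 : b != 0.

Definition in_eig u := iter n th u = b *! u.

Lemma in_eig_mono x z u : in_eig u -> in_eig (mono x z u).
Proof.
rewrite /in_eig /mono => e; rewrite iter_abopZ_zeta ps_zeta_n -iterD addnC iterD e.
by rewrite iter_abop_alg !scalerA mulrC.
Qed.

Lemma in_eig_iter_mono i x z u : in_eig u -> in_eig (iter i (mono x z) u).
Proof. by move=> e; elim: i => [//|i IH]; apply: in_eig_mono. Qed.

Lemma in_eigD u v : in_eig u -> in_eig v -> in_eig (u + v).
Proof. by rewrite /in_eig iter_abopD scalerDr => -> ->. Qed.

Lemma in_eigZ c u : in_eig u -> in_eig (c *! u).
Proof. by rewrite /in_eig iter_abop_alg => ->; rewrite !scalerA mulrC. Qed.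

Lemma mono_mul_n x z x' z' u : in_eig u ->
  mono (x + x' * n) (z + z' * n) u = a ^+ x' * b ^+ z' *! mono x z u.
Proof.
move=> e; have it j : iter (j * n) th u = b ^+ j *! u.
  elim: j => [|j IH]; first by rewrite mul0n expr0 alg_scale1.
  by rewrite mulSn addnC iterD e iter_abop_alg IH alg_scaleA exprS.
rewrite /mono iterD it iter_abop_alg exprD mulnC exprM ya.
rewrite -[(a%:A ^+ _)](rmorphXn (in_alg F)) /= !scalerA; congr (_ *: _).
by rewrite -[in RHS]/(in_alg F _) rmorphM /=; ring.
Qed.

Lemma mono_congr x z x' z' u : in_eig u ->
  x = x' %[mod n] -> z = z' %[mod n] -> sim (mono x z u) (mono x' z' u).
Proof.
move=> e ex ez.
have red x0 z0 : sim (mono x0 z0 u) (mono (x0 %% n) (z0 %% n) u).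
  rewrite {1}(divn_eq x0 n) {1}(divn_eq z0 n) ![(_ * n + _)%N]addnC mono_mul_n //.
  by apply: sim_alg; rewrite mulf_neq0 ?expf_neq0.
by apply: (sim_trans (red _ _)); rewrite ex ez; apply: sim_sym.
Qed.

Variables p q p' q' : nat.
Hypothesis det1 : (p * q')%N = (p' * q + 1)%N %[mod n].
Hypothesis solv : forall x z, exists i i' : nat,
  (p * i + p' * i')%N = x %[mod n] /\ (q * i + q' * i')%N = z %[mod n].
Variable c : k.
Hypothesis c0 : c != 0.
Hypothesis cn : c ^+ n = om ^+ (p * q * 'C(n, 2)) * (a ^+ p * b ^+ q).

(* w' w = om w w', and w ^ n = c ^ n on the b-eigenspace of theta ^ n: there w is
   diagonalizable with simple spectrum c om ^ i, and w' permutes its eigenlines. *)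
Local Notation w := (mono p q).
Local Notation w' := (mono p' q').

Lemma w_quasicomm u : w' (w u) = om *! w (w' u).
Proof.
rewrite !mono_mono alg_scaleA addnC [(q' + q)%N]addnC -exprS; congr (_%:A *: _).
by apply/eqP; rewrite (eq_prim_root_expr om_prim) det1 addn1.
Qed.

Lemma w_iter_w' i u mu : w u = mu *! u ->
  w (iter i w' u) = (mu * om ^- i) *! iter i w' u.
Proof.
move=> wu; elim: i => [|i IH]; first by rewrite expr0 invr1 mulr1.
have wV v : w (w' v) = om^-1 *! w' (w v).
  by rewrite w_quasicomm alg_scaleA mulVf ?alg_scale1 // (om_neq0 om_prim).
by rewrite iterS wV IH monoZ alg_scaleA exprS invfM mulrCA.
Qed.

Lemma w_iter_n u : in_eig u -> iter n w u = c ^+ n *! u.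
Proof.
move=> e; rewrite iter_mono cn -alg_scaleA; congr (_ *: _).
by rewrite -[(p * n)%N]add0n -[(q * n)%N]add0n mono_mul_n // /mono expr0 scale1r.
Qed.

Lemma sim_iter_w'_n u : in_eig u -> sim (iter n w' u) u.
Proof.
move=> e; apply: (sim_trans (sim_iter_monoE _ _ _ _)).
apply: (sim_trans (mono_congr e (x' := 0) (z' := 0) _ _)).
- by rewrite modnMl mod0n.
- by rewrite modnMl mod0n.
by rewrite /mono expr0 scale1r; apply: sim_refl.
Qed.

Definition wproj (i : nat) u : U := eigproj w n (c * om ^+ i) u.

Lemma wproj_sum u : \sum_(i < n) wproj i u = u.
Proof. exact: (@eigproj_sum k F U w n om c om_prim n0 u). Qed.

Lemma wproj_eig i u : in_eig u -> w (wproj i u) = c * om ^+ i *! wproj i u.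
Proof.
move=> e; apply: (@eigprojT k F U w (@monoD p q) (@monoZ p q) n om c om_prim c0 i u).
exact: w_iter_n.
Qed.

Lemma in_eig0 : in_eig 0.
Proof. by rewrite /in_eig scaler0 (iter_T0 abop_alg). Qed.

Lemma in_eig_wproj i u : in_eig u -> in_eig (wproj i u).
Proof.
move=> e; apply: in_eigZ; apply: big_ind => [|? ?|j _].
- exact: in_eig0.
- exact: in_eigD.
by apply/in_eigZ/in_eig_iter_mono.
Qed.

(** Each application of [w'] divides the eigenvalue by [om], so all eigenspaces of [w] are carried
    into the one for [c]. *)
Lemma w_shift i u : in_eig u -> w (iter i w' (wproj i u)) = c *! iter i w' (wproj i u).
Proof.
by move=> e; rewrite (w_iter_w' _ (wproj_eig i e)) mulfK // om_expr_neq0.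
Qed.

Lemma w_eigenvector_exists u : u <> 0 -> in_eig u ->
  exists s, [/\ s <> 0, in_eig s & w s = c *! s].
Proof.
move=> u0 e.
have [i wi0] : exists i : 'I_n, wproj i u <> 0.
  apply: contrapT => ne; apply: u0; rewrite -(wproj_sum u) big1 // => i _.
  by apply: contrapT => wi; apply: ne; exists i.
exists (iter i w' (wproj i u)); split.
- by move=> /iter_mono_eq0.
- by apply/in_eig_iter_mono/in_eig_wproj.
exact: w_shift.
Qed.

Lemma w_decomposition u : in_eig u -> exists (d : 'I_n -> k) (s : 'I_n -> U),
  (forall i, in_eig (s i) /\ w (s i) = c *! s i) /\
  u = \sum_i d i *! iter (n - i) w' (s i).
Proof.
move=> e; pose s (i : 'I_n) := iter i w' (wproj i u).
(* Since [w'] has a nonzero scalar as n-th power here, applying it [n - i] more times undoes the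
   shift up to a factor. *)
have ds (i : 'I_n) : exists d, wproj i u = d *! iter (n - i) w' (s i).
  have := sim_sym (sim_iter_w'_n (in_eig_wproj i e)).
  have -> : iter n w' (wproj i u) = iter (n - i) w' (s i).
    by rewrite /s -iterD subnK // ltnW.
  by move=> [d _ Ed]; exists d.
exists (fun i => projT1 (cid (ds i))), s; split.
  move=> i; split; first by apply/in_eig_iter_mono/in_eig_wproj.
  exact: w_shift.
rewrite -{1}(wproj_sum u); apply: eq_bigr => i _.
by case: cid.
Qed.

Definition wspan s u := exists d : 'I_n -> k, u = \sum_i d i *! iter i w' s.

Lemma wspanD s u v : wspan s u -> wspan s v -> wspan s (u + v).
Proof.
move=> [d ->] [e ->]; exists (fun i => d i + e i).
by rewrite -big_split; apply: eq_bigr => i _; rewrite /= !scalerDl.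
Qed.

Lemma wspanZ s d u : wspan s u -> wspan s (d *! u).
Proof.
move=> [e ->]; exists (fun i => d * e i).
by rewrite scaler_sumr; apply: eq_bigr => i _; rewrite alg_scaleA.
Qed.

Lemma wspan0 s : wspan s 0.
Proof. by exists (fun=> 0); rewrite big1 // => i _; rewrite !scale0r. Qed.

Lemma wspan_sum s m (u : 'I_m -> U) :
  (forall i, wspan s (u i)) -> wspan s (\sum_i u i).
Proof.
by move=> su; apply: big_ind => // [|? ?]; [exact: wspan0 | exact: wspanD].
Qed.

Lemma wspan_sim s u v : sim u v -> wspan s v -> wspan s u.
Proof. by move=> [d _ ->]; apply: wspanZ. Qed.

Section Span.
Variable s : U.
Hypothesis se : in_eig s.
Hypothesis ws : w s = c *! s.

Lemma wspan_iter j : wspan s (iter j w' s).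
Proof.
elim/ltn_ind: j => j IH; have [ltjn|lenj] := ltnP j n.
  exists (fun i => if i == Ordinal ltjn then 1 else 0).
  rewrite (bigD1 (Ordinal ltjn)) //= eqxx alg_scale1 big1 ?addr0 // => i /negPf ->.
  by rewrite !scale0r.
rewrite -(subnK lenj) iterD; apply: wspan_sim (sim_iter_mono _ _ _ (sim_iter_w'_n se)) _.
by apply: IH; have := ps_n0 X; lia.
Qed.

(** By [solv] every monomial is, up to a scalar, a power of [w'] times a power of [w], and [w] acts
    on [s] by a scalar. *)
Lemma wspan_mono x z : wspan s (mono x z s).
Proof.
have [i [i' [ex ez]]] := solv x z.
apply: (wspan_sim _ (wspan_iter i')).
apply: sim_trans (sim_sym (mono_congr se ex ez)) _.
have si : sim (iter i w s) s.
  by exists (c ^+ i); rewrite ?expf_neq0 // (iter_eig (@monoZ p q) _ ws).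
apply: sim_trans (sim_iter_mono i' p' q' si).
apply: sim_sym; apply: sim_trans (sim_iter_monoE _ _ _ _) _.
apply: sim_trans (sim_mono _ _ (sim_iter_monoE _ _ _ _)) _.
by rewrite mono_mono addnC [(q' * i' + _)%N]addnC; apply/sim_alg/om_expr_neq0.
Qed.

Lemma wspan_abop u : wspan s u -> wspan s (th u).
Proof.
move=> [d ->]; rewrite (big_morph _ (@abopD k X U) (@abop0 k X U)).
apply: wspan_sum => i; rewrite abop_alg; apply: wspanZ.
have -> : th (iter i w' s) = mono 0 1 (iter i w' s) by rewrite /mono scale1r.
apply: wspan_sim (sim_mono _ _ (sim_iter_monoE _ _ _ _)) _.
by rewrite mono_mono; apply/wspanZ/wspan_mono.
Qed.

Lemma wspan_scale (f : F) u : wspan s u -> wspan s (f *: u).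
Proof.
have [e ->] := kummer_expansion om_prim n0 f yu zy => -[d ->].
rewrite scaler_suml; apply: wspan_sum => j; rewrite -scalerA; apply: wspanZ.
rewrite scaler_sumr; apply: wspan_sum => i; rewrite scalerA mulrC -scalerA.
apply: wspanZ; rewrite -[_ *: _]/(mono j 0 (iter i w' s)).
apply: wspan_sim (sim_mono _ _ (sim_iter_monoE _ _ _ _)) _.
by rewrite mono_mono; apply/wspanZ/wspan_mono.
Qed.

(** The spanning vectors belong to the distinct eigenvalues [c * om ^- i] of [w], so a projector
    reads off one coefficient. This is the multiplicity one property, and it gives freeness. *)
Lemma eigproj_wspan (d : 'I_n -> k) (j0 : 'I_n) :
  eigproj w n (c * om ^- j0) (\sum_i d i *! iter i w' s) = d j0 *! iter j0 w' s.
Proof.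
have E j : (c * om ^- j) ^+ n = c ^+ n.
  by rewrite exprMn exprVn -exprM mulnC exprM (prim_expr_order om_prim) expr1n invr1 mulr1.
rewrite (big_morph _ (eigprojD (@monoD p q) n _) (eigproj0 (@monoZ p q) n _)).
rewrite (bigD1 j0) //= [X in _ + X]big1 ?addr0 => [|j jj].
  rewrite (eigproj_eig (@monoZ p q) om_prim n0 c0 (nu := c * om ^- j0)) ?E ?eqxx //.
  by rewrite monoZ (w_iter_w' _ ws) !scalerA mulrC.
rewrite (eigproj_eig (@monoZ p q) om_prim n0 c0 (nu := c * om ^- j)) ?E //; last first.
  by rewrite monoZ (w_iter_w' _ ws) !scalerA mulrC.
rewrite (inj_eq (mulfI c0)) (inj_eq invr_inj) (eq_prim_root_expr om_prim).
by rewrite !modn_small // -val_eqE /= eq_sym in jj *; rewrite (negPf jj).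
Qed.

Lemma wspan_free (d : 'I_n -> k) : s <> 0 ->
  \sum_i d i *! iter i w' s = 0 -> forall i, d i = 0.
Proof.
move=> s0 e i; apply: contrapT => /eqP di0; apply: s0.
have := eigproj_wspan d i; rewrite e (eigproj0 (@monoZ p q)) => /esym.
by move=> /(alg_scale_eq0 di0) /iter_mono_eq0.
Qed.

End Span.
End Eigen.
End Module.

(** * Homomorphisms out of a simple module *)

Section Homs.
Variables (b : k) (p q p' q' : nat) (c : k).
Hypothesis b0 : b != 0.
Hypothesis det1 : (p * q')%N = (p' * q + 1)%N %[mod n].
Hypothesis solv : forall x z, exists i i' : nat,
  (p * i + p' * i')%N = x %[mod n] /\ (q * i + q' * i')%N = z %[mod n].
Hypothesis c0 : c != 0.
Hypothesis cn : c ^+ n = om ^+ (p * q * 'C(n, 2)) * (a ^+ p * b ^+ q).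

Lemma abfun0 (U W : abmod X) (f : abhom U W) : f 0 = 0.
Proof. by have := abfun_lin f (-1) 0 0; rewrite scaler0 addr0 scaleN1r addNr. Qed.

Lemma abfunD (U W : abmod X) (f : abhom U W) : {morph f : u v / u + v}.
Proof. by move=> u v; have := abfun_lin f 1 u v; rewrite !scale1r. Qed.

Lemma abfunZ (U W : abmod X) (f : abhom U W) (e : F) u : f (e *: u) = e *: f u.
Proof. by rewrite -[_ *: u]addr0 abfun_lin abfun0 addr0. Qed.

Lemma abfun_iter (U W : abmod X) (f : abhom U W) j u :
  f (iter j (@abop k X U) u) = iter j (@abop k X W) (f u).
Proof. by elim: j => [//|j IH]; rewrite !iterS abfun_op IH. Qed.

Lemma abfun_mono (U W : abmod X) (f : abhom U W) x z u :
  f (mono x z u) = mono x z (f u).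
Proof. by rewrite /mono abfunZ abfun_iter. Qed.

Lemma abfun_iter_mono (U W : abmod X) (f : abhom U W) x z j u :
  f (iter j (mono x z) u) = iter j (mono x z) (f u).
Proof. by elim: j => [//|j IH]; rewrite !iterS abfun_mono IH. Qed.

Section Simple.
Variable S : abmod X.
Hypothesis simpleS : ab_simple S.
Variable s : S.
Hypothesis s0 : s <> 0.
Hypothesis se : in_eig b s.
Hypothesis ws : mono p q s = (c%:A : F) *: s.

Lemma simple_wspan u : wspan p' q' s u.
Proof.
have [//||||ss0|//] := simpleS.2 (wspan p' q' s).
- exact: wspan0.
- by move=> v v'; apply: wspanD.
- by move=> f v; apply: (wspan_scale b0 det1 solv c0 se ws).
- by move=> v; apply: (wspan_abop b0 det1 solv c0 se ws).
by case: s0; apply/ss0/(wspan_iter b0 det1 c0 se 0).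
Qed.

(** An endomorphism preserves the [c]-eigenspace of [w], which is the line of [s]; as [s] generates
    [S], the scalar found on that line is valid everywhere. *)
Lemma simple_end_scalar (f : abhom S S) : exists d : k, forall u, f u = (d%:A : F) *: u.
Proof.
have wf : mono p q (f s) = (c%:A : F) *: f s by rewrite -abfun_mono ws abfunZ.
have [d Ed] := simple_wspan (f s).
pose o : 'I_n := Ordinal (ps_n0 X).
have fs : f s = ((d o)%:A : F) *: s.
  have := eigproj_wspan det1 c0 ws d o; rewrite -Ed /= expr0 invr1 mulr1.
  by rewrite (eigproj_eig (@monoZ S p q) om_prim n0 c0 (nu := c)) ?eqxx.
exists (d o) => u; have [e ->] := simple_wspan u.
rewrite (big_morph f (abfunD f) (abfun0 f)) scaler_sumr; apply: eq_bigr => i _.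
rewrite abfunZ abfun_iter_mono fs iter_TZ; last exact: monoZ.
by rewrite !scalerA mulrC.
Qed.

Section Extension.
Variable U : abmod X.
Variable s' : U.
Hypothesis se' : in_eig b s'.
Hypothesis ws' : mono p q s' = (c%:A : F) *: s'.

Let prop (x : S * U) : (S * U)%type := (abop x.1, abop x.2).

Fact prod_abopD : {morph prop : u v / u + v}.
Proof. by move=> u v; rewrite /prop /= !abopD. Qed.
Fact prod_abopZ (f : F) (u : (S * U)%type) : prop (f *: u) = zeta f *: prop u.
Proof. by rewrite /prop /= !abopZ. Qed.
Fact prod_iter j u : iter j prop u = (iter j (@abop k X S) u.1, iter j (@abop k X U) u.2).
Proof. by elim: j => [|j IH] /=; [case: u | rewrite IH]. Qed.
Fact prod_abop_m (u : (S * U)%type) : iter (psm X) prop u = ((beta X)%:A : F) *: u.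
Proof. by rewrite prod_iter !abop_m; case: u. Qed.

Definition prod_abmod : abmod X := AbMod prod_abopD prod_abopZ prod_abop_m.

Lemma prod_mono x z (u : prod_abmod) :
  mono x z u = (mono x z u.1, mono x z u.2).
Proof. by rewrite /mono [iter _ _ _]prod_iter. Qed.

Lemma prod_iter_mono j x z (u : prod_abmod) :
  iter j (mono x z) u = (iter j (mono x z) u.1, iter j (mono x z) u.2).
Proof. by elim: j => [|j IH]; [case: u | rewrite !iterS IH prod_mono]. Qed.

(* The graph of the extension is the submodule of S x U generated by (s, s'). *)
Let graph (u : S) (v : U) := wspan p' q' ((s, s') : prod_abmod) (u, v).

(** The graph is functional because an element of the span is determined by its coefficients, and
    these by its first component, by freeness in [S]. It is total because its domain is a nonzero
    submodule of [S]. *)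
Lemma simple_hom_extension : exists x : abhom S U, x s = s'.
Proof.
have sse : in_eig b ((s, s') : prod_abmod).
  by rewrite /in_eig [iter _ _ _]prod_iter /= se se'.
have sws : mono p q ((s, s') : prod_abmod) = (c%:A : F) *: ((s, s') : prod_abmod).
  by rewrite prod_mono /= ws ws'.
have gD u v u' v' : graph u v -> graph u' v' -> graph (u + u') (v + v').
  exact: wspanD.
have gZ (f : F) u v : graph u v -> graph (f *: u) (f *: v).
  by move=> g; apply: (wspan_scale b0 det1 solv c0 sse sws f g).
have gT u v : graph u v -> graph (abop u) (abop v).
  by move=> g; apply: (wspan_abop b0 det1 solv c0 sse sws g).
have gs : graph s s' by exact: (wspan_iter b0 det1 c0 sse 0).
have g0 v : graph 0 v -> v = 0.
  move=> [d]; have sum2 (e : 'I_n -> k) :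
    \sum_i (e i)%:A *: iter i (mono p' q') ((s, s') : prod_abmod) =
    (\sum_i ((e i)%:A : F) *: iter i (mono p' q') s,
     \sum_i ((e i)%:A : F) *: iter i (mono p' q') s').
    apply: (big_rec3 (fun t t1 t2 => t = (t1, t2))) => // i t1 t2 t3 _ ->.
    by rewrite prod_iter_mono.
  rewrite sum2 => -[/esym e0 ->]; have d0 := wspan_free det1 c0 ws s0 e0.
  by rewrite big1 // => i _; rewrite d0 !scale0r.
have gex u : exists v, graph u v.
  have [||||h|h //] := simpleS.2 (fun u => exists v, graph u v).
  - by exists 0; apply: wspan0.
  - by move=> u1 u2 [v1 g1] [v2 g2]; exists (v1 + v2); apply: gD.
  - by move=> f u1 [v1 g1]; exists (f *: v1); apply: gZ.
  - by move=> u1 [v1 g1]; exists (abop v1); apply: gT.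
  by case: s0; apply: h; exists s'.
have guniq u v v' : graph u v -> graph u v' -> v = v'.
  move=> g1 /(gZ (-1)) g2; apply/eqP; rewrite -subr_eq0; apply/eqP/g0.
  by have := gD _ _ _ _ g1 g2; rewrite !scaleN1r subrr.
pose h u := projT1 (cid (gex u)).
have hP u : graph u (h u) by rewrite /h; case: cid.
have hl (f : F) u v : h (f *: u + v) = f *: h u + h v.
  by apply: (guniq (f *: u + v)) => //; apply: gD => //; apply: gZ.
have ho u : h (abop u) = abop (h u).
  by apply: (guniq (abop u)) => //; apply: gT.
by exists (AbHom hl ho); apply: (guniq s).
Qed.

End Extension.

(** Every vector of the eigenspace comes from [c]-eigenvectors of [w] by powers of [w'], and each
    such eigenvector is the image of [s]. *)
Lemma eigenspace_hom_images (U : abmod X) (u : U) : in_eig b u ->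
  exists (x : 'I_n -> abhom S U) (v : 'I_n -> S), u = \sum_i x i (v i).
Proof.
move=> e; have [d [t [tP ->]]] := w_decomposition b0 det1 c0 cn e.
have ex i : exists x : abhom S U, x s = t i.
  by case: (tP i) => te wt; apply: simple_hom_extension.
exists (fun i => projT1 (cid (ex i))).
exists (fun i : 'I_n => ((d i)%:A : F) *: iter (n - i) (mono p' q') s).
by apply: eq_bigr => i _; case: cid => x xs; rewrite abfunZ abfun_iter_mono xs.
Qed.

Lemma simple_hom_eq (U : abmod X) (x x' : abhom S U) : x s = x' s -> x = x'.
Proof.
move=> e; apply: abhomP => u; have [d ->] := simple_wspan u.
rewrite (big_morph x (abfunD x) (abfun0 x)) (big_morph x' (abfunD x') (abfun0 x')).
by apply: eq_bigr => i _; rewrite !abfunZ !abfun_iter_mono e.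
Qed.

End Simple.
End Homs.
End Monomials.

(** * Splitting of cyclic algebras over C((tau)) *)

Section SplitCyclicAlgebra.
Variable C : numClosedFieldType.
Local Notation k := (laurent C).

Lemma closed_prim_root n : (0 < n)%N -> exists om : C, n.-primitive_root om.
Proof.
move=> n_gt0; pose p : {poly C} := 'X^n - 1.
have [r Dp] := closed_field_poly_normal p.
rewrite (monicP _) ?monicXnsubC // scale1r in Dp.
have rn1 : all n.-unity_root r by apply/allP=> z; rewrite -root_prod_XsubC -Dp.
have sz_r : (n < (size r).+1)%N.
  by rewrite -(size_prod_XsubC r id) -Dp size_XnsubC.
have [|z] := hasP (has_prim_root n_gt0 rn1 _ sz_r); last by exists z.
by rewrite -separable_prod_XsubC -Dp separable_Xn_sub_1 // pnatr_eq0 -lt0n.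
Qed.

Lemma laurent_prim_root n : (0 < n)%N -> exists om : k, n.-primitive_root om.
Proof.
move=> /closed_prim_root [om h]; exists (lconst om).
by rewrite (fmorph_primitive_root (@lconst C)).
Qed.

Lemma laurent_natr_neq0 n : (0 < n)%N -> n%:R != 0 :> k.
Proof.
move=> n0; rewrite -(rmorph_nat (@lconst C)) fmorph_eq0.
by rewrite pnatr_eq0 -lt0n.
Qed.

(* (v, - u) / gcd (u, v) is primitive, so it is the first row of a matrix of
   determinant 1 modulo n, whose inverse gives i and i'. *)
Lemma unimodular_row (n : nat) (u v : int) : (0 < n)%N ->
  exists p q p' q' : nat,
    [/\ (n %| p%:Z * u + q%:Z * v)%Z,
        (p * q')%N = (p' * q + 1)%N %[mod n] &
        forall x z, exists i i' : nat,
          (p * i + p' * i')%N = x %[mod n] /\ (q * i + q' * i')%N = z %[mod n]].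
Proof.
(* Positive representatives modulo [n], so that natural-number gcds and Bezout coefficients
   apply. *)
move=> n0; have red (w : int) : exists w1 : nat, (0 < w1)%N /\ exists l : int, w1%:Z = w + l * n%:Z.
  exists (`|(w %% n%:Z)%Z| + n)%N; split; first by rewrite addn_gt0 n0 orbT.
  have h := divz_eq w n%:Z.
  have w0 : (0 <= (w %% n%:Z)%Z)%R by rewrite modz_ge0 //; lia.
  exists (1 - (w %/ n%:Z)%Z); rewrite PoszD gez0_abs // {2}h; ring.
have [u1 [u1_gt0 [lu Eu]]] := red u; have [v1 [v1_gt0 [lv Ev]]] := red v.
pose g := gcdn u1 v1; have g0 : (0 < g)%N by rewrite gcdn_gt0 u1_gt0.
have [u' Eu'] := dvdnP (dvdn_gcdl u1 v1); have [v' Ev'] := dvdnP (dvdn_gcdr u1 v1).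
rewrite -/g in Eu' Ev'.
have u'0 : (0 < u')%N by move: u1_gt0; rewrite Eu'; case: (u').
have cop : gcdn u' v' = 1%N.
  have : (gcdn u' v' * g = 1 * g)%N by rewrite muln_gcdl -Eu' -Ev' mul1n.
  by move/eqP; rewrite eqn_pmul2r // => /eqP.
have [km kn Ek _] := egcdnP v' u'0; rewrite cop in Ek.
have [n' En] : exists n', n = n'.+1 by exists n.-1; rewrite prednK.
(* Exponents must be natural, so [n' = n - 1] stands for -1: modulo [n] the rows are (v', -u') and
   (km, -kn), of determinant [km * u' - kn * v' = 1]. *)
exists v', (n' * u')%N, km, (n' * kn)%N; split.
- apply/dvdzP; exists (v'%:Z * (u' * g)%N%:Z - v'%:Z * lu - n'%:Z * u'%:Z * lv).
  have -> : u = u1%:Z - lu * n%:Z by rewrite Eu; ring.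
  have -> : v = v1%:Z - lv * n%:Z by rewrite Ev; ring.
  rewrite Eu' Ev' En !PoszM -addn1 PoszD; ring.
- rewrite mulnA [(v' * n')%N]mulnC.
  have -> : (km * (n' * u') + 1 = n' * v' * kn + n)%N.
    rewrite mulnCA Ek En; lia.
  by rewrite modnDr.
(* Cramer's rule for determinant 1, again with [n'] for -1. *)
move=> x z; exists (x * (n' * kn) + z * (n' * km))%N, (x * u' + z * v')%N; split.
  have -> : (v' * (x * (n' * kn) + z * (n' * km)) + km * (x * u' + z * v') =
     (x * (v' * kn) + z * v' * km) * n + x)%N.
    have -> : (km * (x * u' + z * v') = x * (km * u') + z * v' * km)%N by lia.
    by rewrite Ek En; lia.
  by rewrite modnMDl.
have -> : (n' * u' * (x * (n' * kn) + z * (n' * km)) + n' * kn * (x * u' + z * v') =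
   (n' * kn * x * u') * n + z * n' * (n' * (km * u') + kn * v'))%N.
  by rewrite En; lia.
rewrite Ek modnMDl.
have -> : (z * n' * (n' * (kn * v' + 1) + kn * v') = (z * n' * kn * v' + z * n') * n + z - z * n)%N.
  rewrite En; apply/eqP; rewrite -(eqn_add2r (z * n'.+1)) subnK; first by apply/eqP; nia.
  by nia.
have le : (z * n <= (z * n' * kn * v' + z * n') * n + z)%N.
  rewrite En; have : (z * n'.+1 <= z * n' * n'.+1 + z)%N by nia.
  by nia.
by rewrite -(modnMDl z _ n) addnC subnK // modnMDl.
Qed.

Variable X : polarized_setup k.
Local Notation F := (psF X).
Local Notation n := (psn X).

Lemma kummer_data : exists (om a : k) (y : F),
  [/\ n.-primitive_root om, y \is a GRing.unit, zeta X y = om%:A * y,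
      a != 0 & y ^+ n = a%:A].
Proof.
have [om prim] := laurent_prim_root (ps_n0 X).
have n0 := laurent_natr_neq0 (ps_n0 X).
have [y [yu zy]] := kummer_generator prim n0.
have [a Ea] : exists a : k, y ^+ n = a%:A.
  apply/ps_zeta_fix; rewrite rmorphXn /= zy exprMn -[(_%:A ^+ _)](rmorphXn (in_alg F)).
  by rewrite /= (prim_expr_order prim) scale1r mul1r.
exists om, a, y; split=> //; apply: contraTneq (unitrX n yu) => a0.
by rewrite Ea a0 scale0r unitr0.
Qed.

(* With val (a ^ p * b ^ q) divisible by n, the monomial y ^ p theta ^ q has an
   n-th power that is an n-th power in k, so it has eigenvectors over k. *)
Theorem simple_abmod_structure (b : k) (S : abmod X) : b != 0 -> ab_simple S ->
  (forall u : S, in_eig b u) ->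
  [/\ forall f : abhom S S, exists d : k, forall u, f u = (d%:A : F) *: u,
      exists s : S, forall (U : abmod X) (x x' : abhom S U), x s = x' s -> x = x'
    & forall (U : abmod X) (u : U), in_eig b u ->
      exists (x : 'I_n -> abhom S U) (v : 'I_n -> S), u = \sum_i x i (v i)].
Proof.
move=> b0 simpleS eS; have [om [a [y [prim yu zy a0 ya]]]] := kummer_data.
have n0 := laurent_natr_neq0 (ps_n0 X).
have [p [q [p' [q' [dv det1 solv]]]]] :=
  unimodular_row (val_tau a) (val_tau b) (ps_n0 X).
(* Both factors are n-th powers: the root of unity [om] has valuation 0, and [dv] concerns the
   valuation of [a ^+ p * b ^+ q]. *)
have [c cn] : exists c : k, c ^+ n = om ^+ (p * q * 'C(n, 2)) * (a ^+ p * b ^+ q).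
  have om0 : om != 0 by rewrite (prim_root_eq0 prim) gtn_eqF // (prim_order_gt0 prim).
  have [r Er] : exists r : k, r ^+ n = om.
    apply: laurent_root; rewrite ?ps_n0 //.
    have := val_tauX n om0; rewrite (prim_expr_order prim) val_tau1.
    by move/esym/eqP; rewrite mulf_eq0 => /orP [/eqP ->|]; [rewrite dvdz0 | have := ps_n0 X; case: (n)].
  have [r' Er'] : exists r' : k, r' ^+ n = a ^+ p * b ^+ q.
    apply: laurent_root; rewrite ?ps_n0 ?mulf_neq0 ?expf_neq0 //.
    rewrite val_tauM ?expf_neq0 // !val_tauX //.
    by rewrite [val_tau a * _]mulrC [val_tau b * _]mulrC.
  by exists (r ^+ (p * q * 'C(n, 2)) * r'); rewrite exprMn Er' -exprM mulnC exprM Er.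
have c0 : c != 0.
  have om0 : om != 0 by rewrite (prim_root_eq0 prim) gtn_eqF // (prim_order_gt0 prim).
  have : c ^+ n != 0 by rewrite cn !mulf_neq0 ?expf_neq0.
  by rewrite expf_eq0 ps_n0.
have [u u0] := simpleS.1.
have [s [s0 se ws]] := w_eigenvector_exists prim n0 yu zy a0 ya det1 c0 cn u0 (eS u).
split=> [f||U v ev].
- exact: (simple_end_scalar prim n0 yu zy a0 ya b0 det1 solv c0 simpleS s0 se ws).
- exists s => U x x'.
  exact: (simple_hom_eq prim n0 yu zy a0 ya b0 det1 solv c0 simpleS s0 se ws).
exact: (eigenspace_hom_images prim n0 yu zy a0 ya b0 det1 solv c0 cn simpleS s0 se ws ev).
Qed.

Lemma psV_finite : exists (m : nat) (g : 'I_m -> psV X),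
  forall v, exists d : 'I_m -> k, v = \sum_j ((d j)%:A : F) *: g j.
Proof.
have [om [a [y [prim yu zy a0 ya]]]] := kummer_data.
have n0 := laurent_natr_neq0 (ps_n0 X).
have [r [e eP]] := ps_fin X.
pose I := ('I_r * 'I_n)%type; pose G (i : I) := y ^+ i.2 *: e i.1.
exists #|{: I}|, (fun j => G (enum_val j)) => v; have [f ->] := eP v.
have ex j := kummer_expansion prim n0 (f j) yu zy.
pose d j := projT1 (cid (ex j)).
have dE j : f j = \sum_i (d j i)%:A * y ^+ i by rewrite /d; case: cid.
exists (fun j => d (enum_val j).1 (enum_val j).2).
rewrite -(big_enum_val (A := predT) (fun i : I => ((d i.1 i.2)%:A : F) *: G i)) /=.
rewrite -(pair_big predT predT (fun i j => ((d i j)%:A : F) *: (y ^+ j *: e i))) /=.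
apply: eq_bigr => i _; rewrite {1}dE scaler_suml; apply: eq_bigr => j _.
by rewrite scalerA.
Qed.

End SplitCyclicAlgebra.

(** * Vertices and arrows of the quiver *)

Section NormAndSigma.
Variables (k : fieldType) (X : polarized_setup k).
Local Notation F := (psF X).
Local Notation n := (psn X).
Local Notation d := (psm X %/ psn X)%N.
Local Notation zeta := (zeta X).
Local Notation sigma := (sigma X).

Lemma scalar_ofE (x : k) : scalar_of (x%:A : F) = x.
Proof.
by rewrite /scalar_of; case: xgetP => [c _ /alg_inj|/(_ x) []].
Qed.

Lemma sigma_alg (x : k) : sigma x%:A = (sigk X x)%:A.
Proof.
have [c Ec] : exists c : k, sigma x%:A = c%:A.
  by apply/ps_zeta_fix; rewrite -ps_sigma_zeta zeta_scalar.
by rewrite /sigk Ec scalar_ofE.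
Qed.

Fact sigk_is_zmod_morphism : zmod_morphism (sigk X).
Proof.
move=> x y; apply: (@alg_inj k X); rewrite -sigma_alg scalerBl rmorphB !sigma_alg.
by rewrite -scalerBl.
Qed.
Fact sigk_is_monoid_morphism : monoid_morphism (sigk X).
Proof.
split=> [|x y]; apply: (@alg_inj k X); rewrite -sigma_alg.
  by rewrite scale1r rmorph1.
rewrite -[(x * y)%:A]/(in_alg F _) rmorphM /= rmorphM !sigma_alg.
by rewrite -[RHS]/(in_alg F _) rmorphM.
Qed.
HB.instance Definition _ := GRing.isZmodMorphism.Build k k (sigk X)
  sigk_is_zmod_morphism.
HB.instance Definition _ := GRing.isMonoidMorphism.Build k k (sigk X)
  sigk_is_monoid_morphism.

Lemma sigkK : involutive (sigk X).
Proof. by move=> x; apply: (@alg_inj k X); rewrite -!sigma_alg ps_sigma2. Qed.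

Lemma NmE (a : F) : \prod_(j < n) iter j zeta a = (Nm a)%:A.
Proof.
have [c Ec] : exists c : k, \prod_(j < n) iter j zeta a = c%:A.
  apply/ps_zeta_fix; rewrite rmorph_prod /=.
  have := ps_zeta_n a; case: (n) (ps_n0 X) => // N _ zN.
  rewrite big_ord_recr [in RHS]big_ord_recl /= mulrC [zeta (iter N _ _)]zN.
  by [].
by rewrite /Nm Ec scalar_ofE.
Qed.

Lemma NmM (a b : F) : Nm (a * b) = Nm a * Nm b.
Proof.
apply: (@alg_inj k X); rewrite -[RHS]/(in_alg F _) rmorphM /= -!NmE -big_split.
by apply: eq_bigr => j _ /=; elim: (nat_of_ord j) => //= l ->; rewrite rmorphM.
Qed.

Lemma Nm1 : Nm (1 : F) = 1.
Proof.
apply: (@alg_inj k X); rewrite -NmE big1 ?scale1r // => j _.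
by elim: (nat_of_ord j) => //= l ->; rewrite rmorph1.
Qed.

Lemma Nm_neq0 (a : F) : a \is a GRing.unit -> Nm a != 0.
Proof.
move=> au; apply/eqP => N0; have := NmM a a^-1.
by rewrite divrr // Nm1 N0 mul0r => /eqP; rewrite oner_eq0.
Qed.

Lemma Nm_unit (a : F) : Nm a != 0 -> a \is a GRing.unit.
Proof.
move=> Na; have : (Nm a)%:A \is a @GRing.unit F.
  by rewrite -in_algE rmorph_unit ?unitfE.
rewrite -NmE; case: (n) (ps_n0 X) => // N _.
by rewrite big_ord_recl unitrM => /andP [].
Qed.

Lemma NmV (a : F) : a \is a GRing.unit -> Nm a^-1 = (Nm a)^-1.
Proof.
move=> au; apply: (mulfI (Nm_neq0 au)).
by rewrite -NmM divrr // Nm1 mulfV // Nm_neq0.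
Qed.

Lemma sigk_Nm (a : F) : sigk X (Nm a) = Nm (sigma a).
Proof.
apply: (@alg_inj k X); rewrite -sigma_alg -!NmE rmorph_prod.
by apply: eq_bigr => j _ /=; elim: (nat_of_ord j) => //= l <-; rewrite ps_sigma_zeta.
Qed.

Lemma Nm_c_exp : Nm (psc X) ^+ d = beta X * sigk X (beta X).
Proof. exact: ps_c_norm. Qed.

Lemma d_gt0 : (0 < d)%N.
Proof. by rewrite lt0n; apply: contraTneq (ps_d0 X) => ->; rewrite eqxx. Qed.

Lemma ndE : (n * d)%N = psm X.
Proof. by rewrite mulnC divnK // ps_nm. Qed.

End NormAndSigma.

(** * The center L_beta and its action on modules *)

Section LbetaAction.
Variables (k : fieldType) (X : polarized_setup k).
Local Notation F := (psF X).
Local Notation n := (psn X).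
Local Notation d := (psm X %/ psn X)%N.
Local Notation M := ('X^d - (beta X)%:P : {poly k}).

(** The quotient type replaces its modulus by a default unless it is monic of positive degree, which
    holds here because [d > 0]. *)
Lemma mk_monic_Lbeta : mk_monic M = M.
Proof.
by rewrite /mk_monic monicXnsubC ?size_XnsubC ?d_gt0 // ltnS d_gt0.
Qed.

Lemma in_qpoly_Lbeta (q : Lbeta X) : in_qpoly M (q : {poly k}) = q.
Proof. by apply: val_inj; apply: in_qpoly_small; apply: size_mk_monic. Qed.

Lemma in_qpolyC (c : k) : in_qpoly M c%:P = c%:A.
Proof. by rewrite -[c%:P]alg_polyC in_qpolyZ in_qpoly1. Qed.

Lemma bgen_exp : bgen X ^+ d = (beta X)%:A.
Proof.
have : in_qpoly M M = 0.
  apply: val_inj; rewrite /= mk_monic_Lbeta.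
  by apply: Pdiv.RingMonic.rmodpp; rewrite monicXnsubC ?d_gt0.
rewrite rmorphB rmorphXn /= => /eqP; rewrite subr_eq0 => /eqP ->.
exact: in_qpolyC.
Qed.

Lemma in_qpoly_eq0_root (p : {poly k}) (b : k) :
  in_qpoly M p = 0 -> b ^+ d = beta X -> p.[b] = 0.
Proof.
move=> /(congr1 val) /=; rewrite mk_monic_Lbeta => p0 bd.
rewrite (Pdiv.RingMonic.rdivp_eq (monicXnsubC (beta X) (d_gt0 X)) p) p0 addr0.
by rewrite hornerM !hornerE bd subrr mulr0.
Qed.

(** The morphism [phi] on scalars lets one statement cover both the linear projections [qpi i] and
    the semilinear maps sigma_a. *)
Lemma Lbeta_morph_horner (A : comNzRingType) (f : {rmorphism Lbeta X -> A})
    (phi : {rmorphism k -> A}) (x : A) (p : {poly k}) :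
  (forall c : k, f c%:A = phi c) -> f (bgen X) = x ->
  f (in_qpoly M p) = (map_poly phi p).[x].
Proof.
move=> fE fx; elim/poly_ind: p => [|p c IH]; first by rewrite !rmorph0 horner0.
rewrite !rmorphD !rmorphM /= IH -[in_qpoly M 'X]/(bgen X) fx map_polyX map_polyC /=.
by rewrite in_qpolyC fE !hornerE.
Qed.

Lemma Lact_funE (U : abmod X) N (p : {poly k}) (u : U) : (size p <= N)%N ->
  Lact_fun p u = \sum_(j < N) ((p`_j)%:A : F) *: iter (n * j) (@abop k X U) u.
Proof.
move=> le; rewrite /Lact_fun (big_ord_widen N (fun j => ((p`_j)%:A : F) *: iter (n * j) (@abop k X U) u)) //.
rewrite big_mkcond; apply: eq_bigr => j _; case: ltnP => // h.
by rewrite nth_default // !scale0r.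
Qed.

Lemma Lact_funD (U : abmod X) (p q : {poly k}) (u : U) :
  Lact_fun (p + q) u = Lact_fun p u + Lact_fun q u.
Proof.
rewrite !(@Lact_funE U (maxn (size p) (size q))) ?leq_maxl ?leq_maxr ?size_polyD //.
by rewrite -big_split; apply: eq_bigr => j _; rewrite coefD !scalerDl.
Qed.

Lemma Lact_funC (U : abmod X) (c : k) (u : U) :
  Lact_fun c%:P u = (c%:A : F) *: u.
Proof.
rewrite (@Lact_funE U 1) ?size_polyC_leq1 // big_ord1 coefC /= muln0.
by [].
Qed.

Lemma Lact_funX (U : abmod X) (u : U) :
  Lact_fun 'X u = iter n (@abop k X U) u.
Proof.
rewrite (@Lact_funE U 2) ?size_polyX // big_ord_recl big_ord1 !coefX /= muln1.
by rewrite !scale0r add0r !scale1r.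
Qed.

End LbetaAction.

(** * The quiver in terms of the d-th roots of beta *)

Section QuiverCombinatorics.
Variables (k : fieldType) (X : polarized_setup k) (xi : psF X) (Q : quiver_data xi).
Local Notation F := (psF X).
Local Notation n := (psn X).
Local Notation d := (psm X %/ psn X)%N.
Local Notation om := (Nm xi).
Local Notation s := (sigk X).
Local Notation gamma := (Nm (psc X)).
Hypothesis om_prim : d.-primitive_root om.
Hypothesis sxi : sigma X xi = xi.
Variable b0 : k.
Hypothesis b0d : b0 ^+ d = beta X.

Lemma Nxi_neq0 : om != 0.
Proof. by rewrite (prim_root_eq0 om_prim) gtn_eqF // d_gt0. Qed.

Lemma xi_unit : xi \is a GRing.unit.
Proof. exact/Nm_unit/Nxi_neq0. Qed.

Lemma s_om : s om = om.
Proof. by rewrite sigk_Nm sxi. Qed.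

Lemma gamma_neq0 : gamma != 0.
Proof. exact/Nm_neq0/ps_c_unit. Qed.

Lemma s_gamma : s gamma = gamma.
Proof. by rewrite sigk_Nm ps_c_fix. Qed.

Lemma s_gamma_om : s (gamma / om) = gamma / om.
Proof. by rewrite fmorph_div /= s_gamma s_om. Qed.

Lemma gamma'E : Nm (psc X / xi) = gamma / om.
Proof. by rewrite NmM NmV // xi_unit. Qed.

Lemma root_neq0 b : b ^+ d = beta X -> b != 0.
Proof.
move=> bd; have := ps_beta0 X; rewrite -bd; apply: contraNneq => ->.
by rewrite expr0n gtn_eqF // d_gt0.
Qed.

Lemma roots_om b : b ^+ d = beta X -> exists j : 'I_d, b = b0 * om ^+ j.
Proof.
move=> bd; have b00 := root_neq0 b0d.
have [|j Ej] := prim_rootP om_prim (x := b / b0).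
  by rewrite exprMn exprVn bd b0d mulfV // ps_beta0.
by exists j; rewrite -Ej mulrC mulfVK.
Qed.

Lemma om_roots j : (b0 * om ^+ j) ^+ d = beta X.
Proof.
by rewrite exprMn b0d -exprM mulnC exprM (prim_expr_order om_prim) expr1n mulr1.
Qed.

(** A priori [qL i] is just an extension of [k]; but [k] contains one d-th root of beta and all d-th
    roots of unity, hence every root in the extension. *)
Lemma vertex_exists (i : qI Q) : exists b : k, vertex_at i b /\ b ^+ d = beta X.
Proof.
pose x : qL i := qpi i (bgen X).
have xd : x ^+ d = (beta X)%:A by rewrite -rmorphXn bgen_exp /= rmorph_alg.
have b00 := root_neq0 b0d; pose f := in_alg (qL i).
have [j Ej] : exists j : 'I_d, x / f b0 = (f om) ^+ j.
  have pr : d.-primitive_root (f om) by rewrite fmorph_primitive_root.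
  have [|j Ej] := prim_rootP pr (x := x / f b0); last by exists j.
  rewrite exprMn exprVn xd -rmorphXn b0d mulfV //.
  by rewrite -in_algE fmorph_eq0 ps_beta0.
exists (b0 * om ^+ j); split; last exact: om_roots.
have Ef : (b0 * om ^+ j)%:A = f b0 * f om ^+ j by rewrite -rmorphXn -rmorphM.
rewrite /vertex_at -/x Ef -Ej mulrC mulfVK //.
by rewrite fmorph_eq0.
Qed.

Definition bv (i : qI Q) : k := projT1 (cid (vertex_exists i)).

Lemma vertex_bv i : vertex_at i (bv i).
Proof. by rewrite /bv; case: cid => ? []. Qed.

Lemma bv_exp i : bv i ^+ d = beta X.
Proof. by rewrite /bv; case: cid => ? []. Qed.

Lemma bv_neq0 i : bv i != 0.
Proof. exact/root_neq0/bv_exp. Qed.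

Lemma qpi_in_qpoly (i : qI Q) (p : {poly k}) :
  qpi i (in_qpoly ('X^d - (beta X)%:P) p) = (p.[bv i])%:A.
Proof.
rewrite (@Lbeta_morph_horner _ _ _ (qpi i) (in_alg (qL i)) (in_alg _ (bv i))).
- by rewrite horner_map.
- by move=> c; rewrite /= rmorph_alg.
exact: vertex_bv.
Qed.

Lemma qpi_horner (i : qI Q) (q : Lbeta X) : qpi i q = ((q : {poly k}).[bv i])%:A.
Proof. by rewrite -{1}(in_qpoly_Lbeta q) qpi_in_qpoly. Qed.

Lemma qL_alg_inj (i : qI Q) : injective (fun x : k => x%:A : qL i).
Proof. exact: (fmorph_inj (in_alg (qL i))). Qed.

Definition qLk i (x : qL i) : k := (inL x : {poly k}).[bv i].

Lemma qLkK i (x : qL i) : (qLk x)%:A = x.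
Proof. by rewrite -qpi_horner q_inK. Qed.

Lemma qLkA i (c : k) : qLk (c%:A : qL i) = c.
Proof. by apply: (@qL_alg_inj i); rewrite qLkK. Qed.

Lemma quiver_L_trivial (i : qI Q) : L_trivial i.
Proof. by exists (@qLk i) => [c|x]; rewrite ?qLkA ?qLkK. Qed.

(** The idempotent of the factor [i] evaluates to 1 at [bv i] and to 0 at [bv j] for [j != i]. *)
Lemma bv_inj : injective bv.
Proof.
move=> i j e; apply/eqP/negP => /negP ne.
have := qpi_horner j (inL (1 : qL i)); rewrite q_in0 1?eq_sym // -e.
have -> : (inL (1 : qL i) : {poly k}).[bv i] = 1.
  by apply: (@qL_alg_inj i); rewrite -qpi_horner q_inK scale1r.
by rewrite scale1r => /esym/eqP; rewrite oner_eq0.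
Qed.

Lemma qpi_inj (q q' : Lbeta X) : (forall i : qI Q, qpi i q = qpi i q') -> q = q'.
Proof.
move=> e; rewrite -(q_dec Q q) -(q_dec Q q').
by apply: eq_bigr => i _; rewrite e.
Qed.

(** The polynomial with roots [bv i] vanishes in every factor of L_beta, so it is a multiple of
    [X ^ d - beta]. *)
Lemma bv_surj b : b ^+ d = beta X -> exists i, bv i = b.
Proof.
move=> bd; pose P : {poly k} := \prod_(i : qI Q) ('X - (bv i)%:P).
have P0 : in_qpoly ('X^d - (beta X)%:P) P = 0 :> Lbeta X.
  apply: qpi_inj => i; rewrite rmorph0 qpi_in_qpoly horner_prod (bigD1 i) //=.
  by rewrite hornerXsubC subrr mul0r scale0r.
have /eqP := in_qpoly_eq0_root P0 bd; rewrite horner_prod.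
move/prodf_eq0 => [i _]; rewrite hornerXsubC subr_eq0 => /eqP e.
by exists i.
Qed.

Lemma card_qI : #|qI Q| = d.
Proof.
have ex (j : 'I_d) := bv_surj (om_roots j).
pose h j := projT1 (cid (ex j)).
have hE j : bv (h j) = b0 * om ^+ j by rewrite /h; case: cid.
rewrite -[RHS]card_ord; apply/esym/(@bij_eq_card _ _ h).
have hsurj i : exists j, h j = i.
  have [j Ej] := roots_om (bv_exp i); exists j.
  by apply: bv_inj; rewrite hE.
exists (fun i => projT1 (cid (hsurj i))) => [j|i]; last by case: cid.
case: cid => j' /= /(congr1 bv); rewrite !hE => /(mulfI (root_neq0 b0d)) /eqP.
by rewrite (eq_prim_root_expr om_prim) !modn_small // => /eqP /val_inj.
Qed.

Lemma bv_xib (i : qI Q) : bv (xib i) = om * bv i.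
Proof.
pose q : Lbeta X := bgen X - (bv (xib i))%:A.
have /q_xib : qpi (xib i) q = 0.
  by rewrite rmorphB /= (vertex_bv (xib i)) /= rmorph_alg subrr.
rewrite /q rmorphB /= q_autL rmorph_alg rmorphB /= linearZ rmorph_alg /= (vertex_bv i).
move/eqP; rewrite subr_eq0 scalerA => /eqP /qL_alg_inj.
by [].
Qed.

Lemma quiver_cycle : Q_cycle Q d.
Proof.
split; [exact: card_qI | move=> i j].
have [l El] : exists l : 'I_d, bv j / bv i = om ^+ l.
  have [|l El] := prim_rootP om_prim (x := bv j / bv i); last by exists l.
  by rewrite exprMn exprVn !bv_exp mulfV // ps_beta0.
have -> : j = iter l (@xib k X xi Q) i.
  apply: bv_inj; have -> m : bv (iter m (@xib k X xi Q) i) = om ^+ m * bv i.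
    by elim: m => [|m IH]; rewrite ?mul1r // iterS bv_xib IH mulrA -exprS.
  by rewrite -El mulfVK // bv_neq0.
exact: fconnect_iter.
Qed.

(** At [j] the image of b under sigma_a is [Nm a / bv j]. Applying [s] to the coefficients of [q]
    amounts to conjugating the evaluation point inside and the value outside. *)
Lemma qpi_sigma_ (a : F) (sa : {rmorphism Lbeta X -> Lbeta X}) (q : Lbeta X)
    (j : qI Q) : is_sigma_ a sa ->
  qpi j (sa q) = (s (q : {poly k}).[s (Nm a / bv j)])%:A.
Proof.
move=> [saZ sab].
pose f : {rmorphism Lbeta X -> qL j} := (qpi j \o sa)%FUN.
pose phi : {rmorphism k -> qL j} := (in_alg (qL j) \o s)%FUN.
have fZ c : f c%:A = phi c by rewrite /f /phi /= saZ /= rmorph_alg.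
have fb : f (bgen X) = phi (s (Nm a / bv j)).
  rewrite /f /phi /= sigkK; apply: (mulIf (x := (bv j)%:A)).
    by rewrite -in_algE fmorph_eq0 bv_neq0.
  rewrite -{1}(vertex_bv j) -rmorphM sab /= rmorph_alg /=.
  by rewrite -[(_ / _)%:A]/(in_alg (qL j) _) -[(bv j)%:A]/(in_alg (qL j) _) -rmorphM mulfVK ?bv_neq0.
by rewrite -[LHS]/(f q) -{1}(in_qpoly_Lbeta q) (Lbeta_morph_horner _ fZ fb) horner_map.
Qed.

(** The idempotent of the factor [dia i] is the image under sigma_c of an element supported at [i].
    By [qpi_sigma_] its value at [dia i] is computed at the vertex with root [b'], which must
    therefore be [i]. *)
Lemma bv_dia (i : qI Q) : bv (dia i) * s (bv i) = gamma.
Proof.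
have [_ /(_ (ex_intro _ 1 erefl)) [x Ex]] := @q_dia k X xi Q i (inL (1 : qL (dia i))).
set b' := s (gamma / bv (dia i)).
have b'd : b' ^+ d = beta X.
  rewrite /b' -rmorphXn /= exprMn exprVn bv_exp Nm_c_exp mulrC mulKf ?ps_beta0 //.
  exact: sigkK.
have [j Ej] := bv_surj b'd.
have := congr1 (qpi (dia i)) Ex; rewrite q_inK (qpi_sigma_ _ _ (q_sLc Q)) -/b' -Ej.
have [eji|ne] := eqVneq j i.
  have Eb : bv i = b' by rewrite -Ej eji.
  by move=> _; rewrite Eb /b' sigkK mulrC mulfVK ?bv_neq0.
have -> : (inL x : {poly k}).[bv j] = 0.
  by apply: (@qL_alg_inj j); rewrite -qpi_horner q_in0 // scale0r.
by rewrite rmorph0 scale0r => /eqP; rewrite oner_eq0.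
Qed.

Lemma bv_diaE (i : qI Q) : bv (dia i) = gamma / s (bv i).
Proof. by rewrite -(bv_dia i) mulfK // fmorph_eq0 bv_neq0. Qed.

Lemma bv_adiaE (i : qI Q) : bv (adia i) = gamma / om / s (bv i).
Proof. by rewrite /adia bv_diaE bv_xib rmorphM /= s_om invfM mulrA. Qed.

Lemma quiver_arrow_reversing : arrow_reversing Q.
Proof.
have c i x : (x : k) / s (x / s (bv i)) = x / s x * bv i.
  by rewrite fmorph_div /= sigkK invf_div mulrA mulrAC.
have go0 : gamma / om != 0 by rewrite mulf_neq0 ?invr_eq0 ?gamma_neq0 ?Nxi_neq0.
split=> i; apply: bv_inj.
- by rewrite bv_diaE bv_diaE c s_gamma mulfV ?mul1r ?gamma_neq0.
- by rewrite bv_adiaE bv_adiaE c s_gamma_om mulfV ?mul1r.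
by rewrite bv_xib bv_adiaE bv_diaE mulrA; congr (_ / _); rewrite mulrC mulfVK ?Nxi_neq0.
Qed.

Lemma dia_fixedE (i : qI Q) : dia i = i <-> bv i * s (bv i) = gamma.
Proof.
split=> [e|e]; first by rewrite -{1}e bv_dia.
by apply: bv_inj; rewrite bv_diaE -e mulfK // fmorph_eq0 bv_neq0.
Qed.

Lemma adia_fixedE (i : qI Q) : adia i = i <-> bv i * s (bv i) = gamma / om.
Proof.
split=> [e|e]; first by rewrite -{1}e bv_adiaE mulfVK // fmorph_eq0 bv_neq0.
by apply: bv_inj; rewrite bv_adiaE -e mulfK // fmorph_eq0 bv_neq0.
Qed.

Lemma restrL_sigma_ (a : F) (sa : {rmorphism Lbeta X -> Lbeta X}) (i : qI Q) (c : k) :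
  is_sigma_ a sa -> bv i * s (bv i) = Nm a ->
  restrL sa (c%:A : qL i) = (s c)%:A.
Proof.
move=> sP e; rewrite /restrL (qpi_sigma_ _ _ sP) -e mulrC mulKf ?bv_neq0 // sigkK.
congr ((s _)%:A); exact: qLkA.
Qed.

Lemma Lact_scalar (i : qI Q) (q : Lbeta X) (c : k) (u : qS i) :
  qpi i q = c%:A -> Lact_fun (q : {poly k}) u = (c%:A : F) *: u.
Proof.
move=> qc; pose q' : Lbeta X := q - c%:A.
have q0 : qpi i q' = 0 by rewrite rmorphB /= qc rmorph_alg subrr.
have := q_Sact q0 u; rewrite /= => q0u.
have -> : (q : {poly k}) = (q' : {poly k}) + c%:P.
  by rewrite -[c%:P]alg_polyC /q' /= subrK.
by rewrite Lact_funD q0u add0r Lact_funC.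
Qed.

Lemma in_eig_qS (i : qI Q) (u : qS i) : in_eig (bv i) u.
Proof.
(* For [d = 1] the representative of b is a constant instead of ['X]; then theta^n is theta^m, which
   is beta by definition. *)
rewrite /in_eig; have [d1|d1] := eqVneq d 1%N.
  have := bv_exp i; rewrite d1 expr1 => ->.
  by rewrite -abop_m -(ndE X) d1 muln1.
have sz : (2 < size ('X^d - (beta X)%:P : {poly k})%R)%N.
  by rewrite size_XnsubC ?d_gt0 //; have := d_gt0 X; lia.
have mo : ('X^d - (beta X)%:P : {poly k}) \is monic by rewrite monicXnsubC ?d_gt0.
have bX : (bgen X : {poly k}) = 'X by exact: qpolyXE sz mo.
by rewrite -(Lact_scalar u (vertex_bv i)) bX Lact_funX.
Qed.

Lemma Lact_inL (i : qI Q) (x : qL i) (u : qS i) :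
  Lact (qS i) (inL x) u = ((qLk x)%:A : F) *: u.
Proof. by apply: Lact_scalar; rewrite q_inK qLkK. Qed.

End QuiverCombinatorics.

(** * The pairings on multiplicity spaces *)

Section FiniteBasis.
Variables (k : fieldType) (W : lmodType k).

Definition lin_free r (f : 'I_r -> W) : Prop :=
  forall a : 'rV[k]_r, \sum_j a 0 j *: f j = 0 -> a = 0.

(** A free family of maximal length is a basis: adjoining [x] creates a relation in which the
    coefficient of [x] cannot vanish. *)
Lemma finite_basis (N : nat) : (forall f : 'I_N.+1 -> W, ~ lin_free f) ->
  exists (r : nat) (e : 'I_r -> W),
    forall x, exists! a : 'rV[k]_r, x = \sum_j a 0 j *: e j.
Proof.
move=> bound; pose P r := `[< exists f : 'I_r -> W, lin_free f >].
have P0 : exists r, P r.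
  by exists 0%N; apply/asboolP; exists (fun=> 0) => a _; apply/rowP; case.
have PN r : P r -> (r <= N)%N.
  move=> /asboolP [f ff]; rewrite leqNgt; apply/negP => lt_Nr.
  apply: (bound (fun j => f (widen_ord lt_Nr j))) => a a0.
  pose a' : 'rV[k]_r := \row_j (if insub (val j) is Some l then a 0 l else 0).
  have /ff a'0 : \sum_j a' 0 j *: f j = 0.
    rewrite -[RHS]a0 (bigID (fun j : 'I_r => (j < N.+1)%N)) /= [X in _ + X]big1 ?addr0.
      rewrite (big_ord_narrow lt_Nr) /=; apply: eq_bigr => j _.
      by rewrite mxE /= insubT //= => ?; congr (a 0 _ *: _); apply: val_inj.
    by move=> j nj; rewrite mxE insubN // scale0r.
  apply/rowP => j; have := congr1 (fun m : 'rV_r => m 0 (widen_ord lt_Nr j)) a'0.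
  rewrite !mxE /= insubT //= => ?.
  by move=> <-; congr (a 0 _); apply: val_inj.
case: (ex_maxnP P0 PN) => r /asboolP [e ef] rmax; exists r, e => x.
suff [a Ea] : exists a : 'rV[k]_r, x = \sum_j a 0 j *: e j.
  exists a; split=> // a' Ea'; apply/eqP; rewrite -subr_eq0; apply/eqP/ef.
  rewrite -[RHS](subrr x) {1}Ea Ea' -sumrB; apply: eq_bigr => j _.
  by rewrite !mxE scalerBl.
pose e' (j : 'I_(r + 1)) : W := if split j is inl l then e l else x.
have ne' : ~ lin_free e'.
  move=> fe'; have : P (r + 1)%N by apply/asboolP; exists e'.
  by move/rmax; rewrite addn1 ltnn.
have [a [a0 an0]] : exists a : 'rV[k]_(r + 1), \sum_j a 0 j *: e' j = 0 /\ a != 0.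
  apply: contrapT => h; apply: ne' => a a0; apply: contrapT => /eqP an0.
  by apply: h; exists a.
move: a0; rewrite big_split_ord big_ord1 /=.
have -> : e' (rshift r ord0) = x by rewrite /e' -[rshift _ _]/(unsplit (inr ord0)) unsplitK.
under eq_bigr => j _.
  have -> : e' (lshift 1 j) = e j by rewrite /e' -[lshift _ _]/(unsplit (inl j)) unsplitK.
  over.
set c := a 0 (rshift _ _) => a0.
have c0 : c != 0.
  apply: contraNneq an0 => c0; move: a0; rewrite c0 scale0r addr0 => a0.
  have /ef la : \sum_j (lsubmx a) 0 j *: e j = 0.
    by rewrite -[RHS]a0; apply: eq_bigr => j _; rewrite mxE.
  apply/eqP/rowP => j; rewrite mxE -(splitK j); case: (split j) => l /=.
    by have := congr1 (fun m : 'rV_r => m 0 l) la; rewrite !mxE.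
  by rewrite (ord1 l) -[LHS]/c c0.
exists (- c^-1 *: lsubmx a).
have := congr1 (fun v => c^-1 *: v) a0; rewrite scaler0 scalerDr scalerA mulVf // scale1r.
move/eqP; rewrite addrC addr_eq0 => /eqP ->; rewrite scaler_sumr -sumrN.
by apply: eq_bigr => j _; rewrite !mxE mulNr scaleNr scalerA.
Qed.

End FiniteBasis.

Lemma mx_left_kernel (k : fieldType) (m : nat) (A : 'M[k]_(m.+1, m)) :
  exists2 a : 'rV[k]_m.+1, a != 0 & a *m A = 0.
Proof.
have : kermx A != 0.
  rewrite -mxrank_eq0 mxrank_ker subn_eq0 -ltnNge.
  by rewrite ltnS rank_leq_col.
by move/rowV0Pn => [a /sub_kermxP aA a0]; exists a.
Qed.

Lemma mx_row_free (k : fieldType) (m l : nat) (A : 'M[k]_(m, l)) :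
  (forall v : 'rV[k]_m, v *m A = 0 -> v = 0) -> row_free A.
Proof.
move=> inj; rewrite -kermx_eq0; apply/rowV0P => v /sub_kermxP.
exact: inj.
Qed.

Section Pairings.
Variable C : numClosedFieldType.
Local Notation k := (laurent C).
Variables (X : polarized_setup k) (xi : psF X) (Q : quiver_data xi).
Local Notation F := (psF X).
Local Notation n := (psn X).
Local Notation d := (psm X %/ psn X)%N.
Local Notation om := (Nm xi).
Local Notation s := (sigk X).
Local Notation gamma := (Nm (psc X)).
Local Notation form := (@Defs.form k X).
Hypothesis om_prim : d.-primitive_root om.
Hypothesis sxi : sigma X xi = xi.
Variable b0 : k.
Hypothesis b0d : b0 ^+ d = beta X.
Local Notation bv := (@bv k X xi Q om_prim b0 b0d).
Local Notation qLk := (@qLk k X xi Q om_prim b0 b0d _).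
Local Notation qLkK := (@qLkK k X xi Q om_prim b0 b0d).

Lemma qS_structure (i : qI Q) :
  [/\ forall f : abhom (qS i) (qS i), exists c : k, forall u, f u = (c%:A : F) *: u,
      exists u : qS i, forall (U : abmod X) (x x' : abhom (qS i) U), x u = x' u -> x = x'
    & forall (U : abmod X) (u : U), in_eig (bv i) u ->
      exists (x : 'I_n -> abhom (qS i) U) (v : 'I_n -> qS i), u = \sum_i x i (v i)].
Proof.
apply: simple_abmod_structure; first exact: bv_neq0.
- exact: q_simple.
exact: in_eig_qS.
Qed.

Lemma qS_scalar_inj (i : qI Q) (c c' : k) :
  (forall u : qS i, (c%:A : F) *: u = (c'%:A : F) *: u) -> c = c'.
Proof.
move=> e; have [u u0] := (q_simple i).1; apply/eqP; rewrite -subr_eq0; apply/negP => /negP ne.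
apply: u0; apply: (alg_scale_eq0 ne).
by rewrite !scalerBl e subrr.
Qed.

(* D_i = k: every endomorphism of S_i is a scalar, and Dk is that scalar. *)
Definition Dk (i : qI Q) (f : Dv i) : k :=
  let: And3 h _ _ := qS_structure i in projT1 (cid (h f)).

Lemma DkE (i : qI Q) (f : Dv i) (u : qS i) : f u = ((Dk f)%:A : F) *: u.
Proof. by rewrite /Dk; case: (qS_structure i) => h _ _; case: cid. Qed.

Lemma Dk_eq (i : qI Q) (f : Dv i) c : (forall u, f u = (c%:A : F) *: u) -> Dk f = c.
Proof. by move=> e; apply: (@qS_scalar_inj i) => u; rewrite -DkE e. Qed.

Lemma DvP (i : qI Q) (f : Dv i) : f = Lact (qS i) (inL ((Dk f)%:A : qL i)).
Proof.
by apply: abhomP => u; rewrite DkE (Lact_inL om_prim b0d) qLkA.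
Qed.

Lemma quiver_D_trivial (i : qI Q) : D_trivial i.
Proof.
exists (fun f : Dv i => (Dk f)%:A : qL i) => [x|f]; last by rewrite -DvP.
rewrite -[RHS](qLkK x); congr (_%:A); apply: Dk_eq => u.
exact: Lact_inL.
Qed.

(** A scalar goes to a scalar matrix of size [r], whence the factor. It is nonzero because [S_i],
    and so [D_i], is nonzero, and it is fixed by [s] as an integer. *)
Lemma trd_scalar (i : qI Q) : exists r : k,
  [/\ r != 0, s r = r & forall f : Dv i, trd f = (r * Dk f)%:A].
Proof.
have [r [K [io [rho [_ [_ _] rhoL dimD tE]]]]] := @q_trd k X xi Q i.
exists r%:R; split; last first.
- move=> f; apply: (fmorph_inj io); rewrite tE {1}(DvP f) rhoL mxtrace_scalar q_inK.
  rewrite -rmorphMn; congr (io _).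
  by rewrite scalerMnl mulr_natl.
- by rewrite rmorph_nat.
apply: laurent_natr_neq0; rewrite lt0n; apply/eqP => r0.
move: dimD; rewrite r0 mul0n => -[e eP].
have z (f : abhom (qS i) (qS i)) : f = 0.
  by have [a [-> _]] := eP f; rewrite big_ord0.
have [u u0] := (q_simple i).1; apply: u0.
by have := congr1 (fun f : abhom _ _ => f u) (z (abid (qS i))).
Qed.

Lemma form_linr (a : F) (x y z : psV X) :
  form x (a *: y + z) = sigma X a * form x y + form x z.
Proof.
rewrite ps_form_sym ps_form_lin rmorphD rmorphM mulrDr mulrCA.
by rewrite -!ps_form_sym.
Qed.

Lemma form_linl (a : F) (x y z : psV X) :
  form (a *: x + y) z = a * form x z + form y z.
Proof. exact: ps_form_lin. Qed.

Lemma form0r x : form x 0 = 0.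
Proof.
have := form_linr (-1) x 0 0; rewrite scaler0 addr0 rmorphN rmorph1 mulN1r.
by rewrite addNr.
Qed.

Lemma form0l x : form 0 x = 0.
Proof. by rewrite ps_form_sym form0r rmorph0 mulr0. Qed.

Lemma formDr x y z : form x (y + z) = form x y + form x z.
Proof. by rewrite -[y]scale1r form_linr rmorph1 mul1r scale1r. Qed.

Lemma formDl x y z : form (x + y) z = form x z + form y z.
Proof. by rewrite -[x]scale1r form_linl mul1r scale1r. Qed.

Lemma formZr (a : F) x y : form x (a *: y) = sigma X a * form x y.
Proof. by rewrite -[a *: y]addr0 form_linr form0r addr0. Qed.

Lemma formZl (a : F) x y : form (a *: x) y = a * form x y.
Proof. by rewrite -[a *: x]addr0 form_linl form0l addr0. Qed.

Lemma form_iter_theta j (x y : psV X) :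
  form (iter j (@theta k X) x) (iter j (@theta k X) y) =
  (\prod_(l < j) iter l (zeta X) (psc X)) * iter j (zeta X) (form x y).
Proof.
elim: j => [|j IH]; first by rewrite big_ord0 mul1r.
rewrite !iterS ps_form_theta IH rmorphM mulrA rmorph_prod big_ord_recl.
by [].
Qed.

(** Applying theta^n to both arguments multiplies the value by [gamma] on one side and by [b * s b']
    on the other. *)
Lemma form_orthogonal (b b' : k) (x y : Vmod X) : in_eig b x -> in_eig b' y ->
  b * s b' != gamma -> form (x : psV X) (y : psV X) = 0.
Proof.
rewrite /in_eig => ex ey ne; set f := form _ _.
have fE : gamma%:A * f = (b * s b')%:A * f.
  rewrite -NmE -[f in LHS](ps_zeta_n f) -form_iter_theta.
  rewrite -[iter n (@theta k X) x]/(iter n (@abop k X (Vmod X)) x) ex.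
  rewrite -[iter n (@theta k X) y]/(iter n (@abop k X (Vmod X)) y) ey.
  rewrite formZl formZr sigma_alg mulrA; congr (_ * _).
  by rewrite -[RHS]/(in_alg F _) rmorphM.
have ne' : b * s b' - gamma != 0 by rewrite subr_eq0.
apply: (@alg_scale_eq0 k F F^o _ f ne').
by rewrite -[LHS]/(_ * f) scalerBl mulrBl fE subrr.
Qed.

Lemma hom_in_eig (i : qI Q) (x : Mv i) (u : qS i) : in_eig (bv i) (x u).
Proof.
by rewrite /in_eig -abfun_iter (in_eig_qS om_prim b0d u) abfunZ.
Qed.

(** Serves in place of the decomposition of V into the S_i tensor M_i: the eigenspaces of theta^n
    span V, and each is spanned by images of homomorphisms from a simple module. *)
Lemma psV_hom_ind (P : psV X -> Prop) : P 0 ->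
  (forall u v, P u -> P v -> P (u + v)) ->
  (forall (i : qI Q) (x : Mv i) (u : qS i), P (x u)) -> forall w, P w.
Proof.
move=> P0 PD Px w; pose T := iter n (@abop k X (Vmod X)).
have TD : {morph T : u v / u + v} := @iter_abopD k X (Vmod X) n.
have TZ (c : k) v : T ((c%:A : F) *: v) = (c%:A : F) *: T v := iter_abop_alg n c v.
have d0 := laurent_natr_neq0 C (d_gt0 X); have b00 := root_neq0 b0d.
have w' : iter d T w = ((b0 ^+ d)%:A : F) *: w.
  have it j : iter j T w = iter (n * j) (@abop k X (Vmod X)) w.
    by elim: j => [|j IH]; rewrite ?muln0 // iterS IH mulnS iterD.
  by rewrite it ndE b0d abop_m.
rewrite -(@eigproj_sum k F (Vmod X) T d om b0 om_prim d0 w).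
apply: big_ind => // j _; set v := eigproj _ _ _ _.
have Tv : in_eig (b0 * om ^+ j) (v : Vmod X).
  exact: (eigprojT TD TZ om_prim b00 j w').
have [i Ei] := bv_surj Q om_prim b0d (om_roots om_prim b0d j).
rewrite -Ei in Tv; have [_ _ h] := qS_structure i.
by have [x [u ->]] := h _ _ Tv; apply: big_ind => // l _; apply: Px.
Qed.

(* The pairing {.,.} of the paper read in k through L_i = k. *)
Definition lam (i j : qI Q) (x : Mv i) (y : Mv j) : k := qLk (br x y).

Lemma brE (i j : qI Q) (x : Mv i) (y : Mv j) : br x y = (lam x y)%:A.
Proof. by rewrite /lam qLkK. Qed.

Lemma qpair_neq0 (i j : qI Q) : dia i = j -> exists (u : qS i) (v : qS j), qpair u v != 0.
Proof.
move=> <-; apply: contrapT => h; have h0 (u : qS i) (v : qS (dia i)) : qpair u v = 0.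
  by apply: contrapT => /eqP ne; apply: h; exists u, v.
(* A zero pairing would let every vector represent the zero functional, contrary to uniqueness. *)
have [+ _] := q_perf i => /(_ (fun=> 0)) [|v [_ vu]].
  by move=> a u v; rewrite mulr0 addr0.
have [w w0] := (q_simple (dia i)).1; apply: w0.
by rewrite -(vu w) ?(vu 0).
Qed.

(** The factor [r] comes from the reduced trace. With [dia i = j] as an equation, [j] can be [i] at
    a fixed vertex and [xib i] at a fixed arrow, without transport. *)
Lemma lam_form (i j : qI Q) : dia i = j -> exists r : k, [/\ r != 0, s r = r &
  forall (x : Mv i) (y : Mv j) u v,
    r%:A * form (x u) (y v) = (lam x y)%:A * qpair u v].
Proof.
move=> <-; have [r [r0 sr rE]] := trd_scalar i; exists r; split=> // x y u v.
have [_ _ _] := q_adm i.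
rewrite /lam /br rE qLkA q_brD DkE.
have [lin _ _] := q_adm i.
have -> : qpair (((Dk (brD x y))%:A : F) *: u) v = (Dk (brD x y))%:A * qpair u v.
  have := lin ((Dk (brD x y))%:A) u 0 v; rewrite addr0 => ->.
  have -> : qpair (0 : qS i) v = 0.
    by have := lin (-1) 0 0 v; rewrite scaler0 addr0 mulN1r addNr.
  by rewrite addr0.
by rewrite mulrA; congr (_ * _); rewrite -[RHS]/(in_alg F _) rmorphM.
Qed.

Lemma alg_mul_inj (c c' : k) (f : F) : f != 0 -> c%:A * f = c'%:A * f -> c = c'.
Proof.
move=> f0 e; apply/eqP; rewrite -subr_eq0; apply/negP => /negP ne; case/eqP: f0.
apply: (@alg_scale_eq0 k F F^o _ f ne).
by rewrite -[LHS]/(_ * f) scalerBl mulrBl e subrr.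
Qed.

Lemma in_algM (c c' : k) : (c * c')%:A = c%:A * c'%:A :> F.
Proof. exact: (rmorphM (in_alg F)). Qed.

Section Lam.
Variables (i j : qI Q).
Hypothesis dij : dia i = j.

Lemma lam_linl (a : k) (x x' : Mv i) (y : Mv j) :
  lam (a *: x + x') y = a * lam x y + lam x' y.
Proof.
have [r [_ _ h]] := lam_form dij; have [u [v uv]] := qpair_neq0 dij.
apply: (alg_mul_inj uv); rewrite -h /=.
rewrite form_linl mulrDr mulrCA !h [(_ + lam _ _)%:A]scalerDl mulrDl; congr (_ + _).
by rewrite in_algM mulrA.
Qed.

Lemma lam_linr (a : k) (x : Mv i) (y y' : Mv j) :
  lam x (a *: y + y') = s a * lam x y + lam x y'.
Proof.
have [r [_ _ h]] := lam_form dij; have [u [v uv]] := qpair_neq0 dij.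
apply: (alg_mul_inj uv); rewrite -h /=.
rewrite form_linr sigma_alg mulrDr mulrCA !h [(_ + lam _ _)%:A]scalerDl mulrDl.
by congr (_ + _); rewrite in_algM mulrA.
Qed.

Lemma lam0l y : lam (0 : Mv i) (y : Mv j) = 0.
Proof. by have := lam_linl (-1) 0 0 y; rewrite scaler0 addr0 mulN1r addNr. Qed.

Lemma lam0r x : lam (x : Mv i) (0 : Mv j) = 0.
Proof.
have := lam_linr (-1) x 0 0; rewrite scaler0 addr0 rmorphN rmorph1 mulN1r.
by rewrite addNr.
Qed.

Lemma lamBr (x : Mv i) (y y' : Mv j) : lam x (y - y') = lam x y - lam x y'.
Proof.
by rewrite addrC -scaleN1r lam_linr rmorphN rmorph1 mulN1r addrC.
Qed.

Lemma lamZr (a : k) (x : Mv i) (y : Mv j) : lam x (a *: y) = s a * lam x y.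
Proof. by rewrite -[a *: y]addr0 lam_linr lam0r addr0. Qed.

Lemma lam_suml r (a : 'I_r -> k) (x : 'I_r -> Mv i) (y : Mv j) :
  lam (\sum_l a l *: x l) y = \sum_l a l * lam (x l) y.
Proof.
apply: (big_rec2 (fun t t' => lam t y = t')); first exact: lam0l.
by move=> l t t' _ <-; rewrite lam_linl.
Qed.

Lemma lam_sumr r (a : 'I_r -> k) (x : Mv i) (y : 'I_r -> Mv j) :
  lam x (\sum_l a l *: y l) = \sum_l s (a l) * lam x (y l).
Proof.
apply: (big_rec2 (fun t t' => lam x t = t')); first exact: lam0r.
by move=> l t t' _ <-; rewrite lam_linr.
Qed.

Lemma bv_pair : bv i * s (bv j) = gamma.
Proof.
have := congr1 s (bv_dia om_prim b0d i); rewrite dij rmorphM /= sigkK s_gamma mulrC.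
by [].
Qed.

Lemma lam_eq0_form (x : Mv i) (y : Mv j) u v : lam x y = 0 -> form (x u) (y v) = 0.
Proof.
have [r [r0 _ h]] := lam_form dij => e; apply: (@alg_scale_eq0 k F F^o _ _ r0).
by rewrite -[LHS]/(_ * _) h e scale0r mul0r.
Qed.

(** The image of [x] is orthogonal to all of V: to images from [S_l] with [l != j] by their
    eigenvalues, to those from [S_j] by assumption. *)
Lemma lam_nondegl (x : Mv i) : (forall y : Mv j, lam x y = 0) -> x = 0.
Proof.
move=> xy; apply: abhomP => u; apply: ps_form_nondeg; apply: psV_hom_ind.
- exact: form0r.
- by move=> v w; rewrite formDr => -> ->; rewrite addr0.
move=> l y v; have [e|ne] := eqVneq l j; first by subst l; apply: lam_eq0_form.
apply: (form_orthogonal (hom_in_eig x u) (hom_in_eig y v)).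
rewrite -bv_pair; apply: contraNneq ne => e.
apply/eqP/(@bv_inj k X xi Q om_prim b0 b0d)/(fmorph_inj s).
by apply: (mulfI (bv_neq0 om_prim b0d i)).
Qed.

Lemma lam_nondegr (y : Mv j) : (forall x : Mv i, lam x y = 0) -> y = 0.
Proof.
move=> xy; apply: abhomP => v; apply: ps_form_nondeg => w.
rewrite ps_form_sym; suff -> : form w (y v) = 0 by rewrite rmorph0 mulr0.
move: w; apply: psV_hom_ind.
- exact: form0l.
- by move=> w w'; rewrite formDl => -> ->; rewrite addr0.
move=> l x u; have [e|ne] := eqVneq l i; first by subst l; apply: lam_eq0_form.
apply: (form_orthogonal (hom_in_eig x u) (hom_in_eig y v)).
rewrite -bv_pair; apply: contraNneq ne => e.
apply/eqP/(@bv_inj k X xi Q om_prim b0 b0d).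
apply: (mulIf _ e); rewrite fmorph_eq0; exact: bv_neq0.
Qed.

End Lam.

(** The sign is that of [form] times that of [qpair]; the reduced-trace factor drops out because [s]
    fixes it. *)
Lemma lam_sym (i : qI Q) : dia i = i -> exists e : bool,
  forall x y : Mv i, lam y x = (-1) ^+ e * s (lam x y).
Proof.
move=> di; exists (eps X (+) epsv i) => x y.
have [r [_ sr h]] := lam_form di; have [u [v uv]] := qpair_neq0 di.
have sym : forall (u v : qS i), qpair v u = (-1) ^+ epsv i * sigma X (qpair u v).
  by have := @q_pair_sym k X xi Q i; rewrite di.
have vu : qpair v u != 0.
  rewrite sym; apply: contraNneq uv => e; apply/eqP.
  have := congr1 (fun z => sigma X ((-1) ^+ epsv i * z)) e.
  by rewrite signrMK ps_sigma2 mulr0 rmorph0.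
apply: (alg_mul_inj vu); rewrite -h ps_form_sym.
have Es : sigma X (form (x u) (y v)) * r%:A = (s (lam x y))%:A * sigma X (qpair u v).
  have := congr1 (sigma X) (h x y u v); rewrite !rmorphM /= !sigma_alg sr => <-.
  by rewrite mulrC.
rewrite mulrCA [_ * sigma X _]mulrC Es (sym u v) in_algM signr_addb.
have -> : (((-1) ^+ (eps X) * (-1) ^+ (epsv i)) : k)%:A = (-1) ^+ eps X * (-1) ^+ epsv i :> F.
  by rewrite -[LHS]/(in_alg F _) rmorphM !rmorphXn rmorphN rmorph1.
set e1 := (-1) ^+ eps X; set e2 := (-1) ^+ epsv i.
have e22 : e2 * e2 = 1 by rewrite -expr2 sqrr_sign.
transitivity (e1 * (e2 * e2) * ((s (lam x y))%:A * sigma X (qpair u v))); last by ring.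
by rewrite e22 mulr1.
Qed.

Lemma Mv_sumE (i : qI Q) r (a : 'I_r -> k) (f : 'I_r -> Mv i) (u : qS i) :
  ((\sum_j a j *: f j) : Mv i) u = \sum_j ((a j)%:A : F) *: f j u.
Proof.
by apply: (big_rec2 (fun (x : Mv i) w => x u = w)) => // j x w _ <-.
Qed.

(** Evaluation at a generator of [qS i] embeds [Mv i] into V, which is spanned over [k] by [m]
    vectors, so [m + 1] homomorphisms are dependent. *)
Lemma Mv_basis (i : qI Q) : exists (r : nat) (e : 'I_r -> Mv i),
  forall x, exists! a : 'rV[k]_r, x = \sum_j a 0 j *: e j.
Proof.
have [m [g gP]] := psV_finite X; have [_ [u uP] _] := qS_structure i.
apply: (@finite_basis k (Mv i) m) => f ff.
have ex j := gP (f j u); pose A : 'M[k]_(m.+1, m) := \matrix_(j, l) projT1 (cid (ex j)) l.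
have AE j : f j u = \sum_l ((A j l)%:A : F) *: g l.
  have -> : f j u = \sum_l ((projT1 (cid (ex j)) l)%:A : F) *: g l by case: cid.
  by apply: eq_bigr => l _; rewrite mxE.
have [a a0 aA] := mx_left_kernel A; case/eqP: a0; apply: ff.
apply: uP; rewrite [LHS]Mv_sumE.
under eq_bigr => j _ do rewrite AE scaler_sumr.
rewrite exchange_big big1 // => l _.
under eq_bigr do rewrite alg_scaleA.
rewrite -scaler_suml -scaler_suml.
have := congr1 (fun B : 'rV_m => B 0 l) aA; rewrite !mxE => ->.
by rewrite !scale0r.
Qed.

Lemma lam_perfect (i j : qI Q) (f : Mv i -> k) : dia i = j ->
  (forall a x y, f (a *: x + y) = a * f x + f y) ->
  exists z : Mv j, forall x, lam x z = f x.
Proof.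
move=> dij fl; have [r [e eP]] := Mv_basis i; have [r' [e' eP']] := Mv_basis j.
pose G : 'M[k]_(r, r') := \matrix_(a, b) lam (e a) (e' b).
have Gfree : row_free G.
  apply: mx_row_free => v vG.
  have x0 : \sum_a v 0 a *: e a = 0.
    apply: (lam_nondegl dij) => y; have [w [-> _]] := eP' y.
    rewrite (lam_sumr dij) big1 // => b _; rewrite (lam_suml dij).
    have := congr1 (fun B : 'rV_r' => B 0 b) vG; rewrite !mxE => vb.
    rewrite (_ : \sum_l _ = 0) ?mulr0 // -[RHS]vb.
    by apply: eq_bigr => l _; rewrite mxE.
  have [a [_ au]] := eP 0; rewrite -(au v) // -(au 0) //.
  by rewrite big1 // => l _; rewrite mxE scale0r.
have /row_freeP [B GB] := Gfree.
pose w : 'cV[k]_r' := B *m \col_a f (e a).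
(* The coefficients are conjugated because [lam] is semilinear in its second variable. *)
exists (\sum_b s (w b 0) *: e' b) => x; have [a [-> _]] := eP x.
have f0 : f 0 = 0 by have := fl (-1) 0 0; rewrite scaler0 addr0 mulN1r addNr.
have -> : f (\sum_j a 0 j *: e j) = \sum_j a 0 j * f (e j).
  apply: (big_rec2 (fun t t' => f t = t')) => // l t t' _ <-.
  by rewrite fl.
rewrite (lam_suml dij); apply: eq_bigr => l _; congr (_ * _).
rewrite (lam_sumr dij).
have := congr1 (fun B : 'cV_r => B l 0) (mulmxA G B (\col_a f (e a))).
rewrite GB mul1mx [RHS]mxE => <-; rewrite mxE; apply: eq_bigr => b _.
by rewrite sigkK mulrC [G _ _]mxE.
Qed.

(** * Unitary groups and Hermitian forms from an anti-invariant scalar *)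

Section AntiInvariant.
Variable t : k.
Hypothesis t0 : t != 0.
Hypothesis st : s t = - t.

Lemma isometry_points_scale r (G : 'M[k]_r) (c : k) (B : comNzRingType)
    (sB : {rmorphism B -> B}) (io : {rmorphism k -> B}) (g : 'M[B]_r) : c != 0 ->
  isometry_points G sB io g <-> isometry_points (c *: G) sB io g.
Proof.
move=> c0; have cE : map_mx io (c *: G) = io c *: map_mx io G.
  by apply/matrixP => a b; rewrite !mxE rmorphM.
rewrite /isometry_points cE -scalemxAr -scalemxAl.
split=> -[gg' e]; split=> //; first by rewrite e.
have := congr1 (fun M => io c^-1 *: M) e.
by rewrite !scalerA -rmorphM mulVf // rmorph1 !scale1r.
Qed.

Lemma fixed_vertex_unitary (i : qI Q) : dia i = i -> unitary_factor i.
Proof.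
move=> di; have [r [e eP]] := Mv_basis i; have [sg sgE] := lam_sym di.
pose G : 'M[k]_r := \matrix_(a, b) lam (e a) (e b).
pose kap : k := if sg then t else 1.
have kap0 : kap != 0 by rewrite /kap; case: (sg); rewrite ?oner_neq0.
have skap : s kap = (-1) ^+ sg * kap.
  by rewrite /kap; case: (sg); rewrite ?rmorph1 ?mulr1 // st expr1 mulN1r.
exists r, e, G, (kap *: G); split=> //.
- move=> a b; rewrite brE; congr (_%:A).
  rewrite (lam_suml di) !mxE.
  under eq_bigr do rewrite (lam_sumr di) mulr_sumr.
  rewrite exchange_big /=; apply: eq_bigr => l _; rewrite !mxE mulr_suml.
  by apply: eq_bigr => j _; rewrite !mxE mulrCA mulrC.
- apply/matrixP => a b; rewrite !mxE rmorphM /= skap (sgE (e a) (e b)).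
  by rewrite mulrCA mulrA.
- rewrite -row_free_unit; apply: mx_row_free => v.
  rewrite -scalemxAr => /eqP; rewrite scaler_eq0 (negPf kap0) /= => /eqP vG.
  have x0 : \sum_a v 0 a *: e a = 0.
    apply: (lam_nondegl di) => y; have [w [-> _]] := eP y.
    rewrite (lam_sumr di) big1 // => b _; rewrite (lam_suml di).
    have := congr1 (fun B : 'rV_r => B 0 b) vG; rewrite !mxE => vb.
    rewrite (_ : \sum_l _ = 0) ?mulr0 // -[RHS]vb.
    by apply: eq_bigr => l _; rewrite mxE.
  have [a [_ au]] := eP 0; rewrite -(au v) // -(au 0) //.
  by rewrite big1 // => l _; rewrite mxE scale0r.
by move=> B sB io g _ _; apply: isometry_points_scale.
Qed.

Lemma dactE (i : qI Q) (x : Dv i) (y : Mv i) : dact x y = Dk x *: y.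
Proof. by apply: abhomP => u; rewrite /= DkE abfunZ. Qed.

Lemma Dk_etaflat (i : qI Q) (x : Dv i) : Dk (etaflat x) = Dk x.
Proof.
apply: Dk_eq => u; have [lin _ [g _ gK]] := q_eta i.
have eta0 : eta (0 : qS i) = 0.
  by have := lin (-1) 0 0; rewrite scaler0 addr0 scaleN1r addNr.
rewrite -(gK u) -q_etaflat DkE.
by have := lin ((Dk x)%:A) (g u) 0; rewrite eta0 !addr0.
Qed.

(** [etaflat] preserves the scalar of an endomorphism, and at a fixed arrow the equation
    [b * s b = gamma / Nm xi] makes [sLcxi] restrict to [s] on [L_i]. *)
Lemma hsetE (sg : bool) (i : qI Q) (phi : Mv i -> Mv (xib i)) : adia i = i ->
  hset sg phi <->
  (forall c y, phi (c *: y) = c *: phi y) /\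
  (forall x y, lam y (phi x) = (-1) ^+ sg * s (lam x (phi y))).
Proof.
move=> ai; have ei : bv i * s (bv i) = Nm (psc X / xi).
  by rewrite (gamma'E om_prim); apply/(adia_fixedE om_prim sxi b0d).
have sgn : ((-1) ^+ sg : k)%:A = (-1) ^+ sg :> qL i.
  by rewrite -[LHS]/(in_alg _ _) rmorphXn rmorphN rmorph1.
split=> -[h1 h2]; split.
- move=> c y; pose x : Dv i := Lact (qS i) (inL (c%:A : qL i)).
  have xc : Dk x = c.
    by apply: Dk_eq => u; rewrite (Lact_inL om_prim b0d) qLkA.
  by have := h1 x y; rewrite !dactE Dk_etaflat xc.
- move=> x y; have := h2 x y.
  rewrite !brE (restrL_sigma_ _ (q_sLcxi Q) ei) -sgn.
  rewrite -[_%:A * _]/(in_alg _ _ * in_alg _ _) -rmorphM.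
  exact: (@qL_alg_inj k X xi Q i).
- by move=> x y; rewrite !dactE Dk_etaflat h1.
move=> x y; rewrite !brE (restrL_sigma_ _ (q_sLcxi Q) ei) -sgn h2.
by rewrite -[LHS]/(in_alg _ _) rmorphM.
Qed.

(** The form attached to [phi] is [lam x (phi y)], rescaled by [kap]. Conversely, [phi y] is the
    vector representing the functional [B x y] of [x], up to [kap]; nondegeneracy makes it linear in
    [y]. *)
Lemma fixed_arrow_hermitian (sg : bool) (i : qI Q) : adia i = i -> hermitian_factor sg i.
Proof.
move=> ai; have [dK _ _] := quiver_arrow_reversing Q om_prim sxi b0d.
have dij : dia i = xib i by rewrite -{1}ai /adia dK.
pose kap : k := if sg then t else 1.
have kap0 : kap != 0 by rewrite /kap; case: (sg); rewrite ?oner_neq0.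
have skap : s kap = (-1) ^+ sg * kap.
  by rewrite /kap; case: (sg); rewrite ?rmorph1 ?mulr1 // st expr1 mulN1r.
pose Psi (phi : Mv i -> Mv (xib i)) (x y : Mv i) : k := kap * lam x (phi y).
exists Psi; split.
- move=> phi /(hsetE _ _ ai) [_ h]; split=> [a x y z|x y].
    by rewrite /Psi (lam_linl dij) mulrDr mulrCA.
  rewrite /Psi (h x y) rmorphM /= skap.
  by rewrite mulrCA mulrA.
- move=> phi phi' _ _ e; apply: funext => y; apply/eqP; rewrite -subr_eq0; apply/eqP.
  apply: (lam_nondegr dij) => x; rewrite (lamBr dij); apply/eqP; rewrite subr_eq0.
  apply/eqP/(mulfI kap0).
  exact: (congr1 (fun P : Mv i -> Mv i -> k => P x y) e).
- move=> B [Bl Bs].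
  have ex y : exists z : Mv (xib i), forall x, lam x z = kap^-1 * B x y.
    apply: (lam_perfect dij) => a x x'.
    by rewrite Bl mulrDr mulrCA.
  pose phi y := projT1 (cid (ex y)).
  have phiE x y : lam x (phi y) = kap^-1 * B x y by rewrite /phi; case: cid.
  exists phi.
    apply/(hsetE _ _ ai); split=> [c y|x y].
      apply/eqP; rewrite -subr_eq0; apply/eqP/(lam_nondegr dij) => x.
      rewrite (lamBr dij) (lamZr dij) !phiE (Bs (c *: y) x).
      have -> : B (c *: y) x = c * B y x.
        have B0 : B 0 x = 0 by have := Bl (-1) 0 0 x; rewrite scaler0 addr0 mulN1r addNr.
        by have := Bl c y 0 x; rewrite B0 !addr0.
      by rewrite rmorphM /= -(Bs y x) mulrCA subrr.
    rewrite !phiE (Bs x y) rmorphM fmorphV /= skap invfM invr_sign.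
    by rewrite !mulrA -expr2 sqrr_sign mul1r.
  by apply: funext => x; apply: funext => y; rewrite /Psi phiE mulVKf.
- move=> a phi phi' sa /(hsetE _ _ ai) [h1 h2] /(hsetE _ _ ai) [h1' h2']; split.
    apply/(hsetE _ _ ai); split=> [c y|x y].
      by rewrite h1 h1' scalerDr !scalerA mulrC.
    rewrite (lam_linr dij a y (phi x)) (lam_linr dij a x (phi y)).
    rewrite rmorphD rmorphM /= !sa (h2 x y) (h2' x y).
    have alg (A : comNzRingType) (c p q r : A) : c * (r * p) + r * q = r * (c * p + q).
      by ring.
    exact: alg.
  by move=> x y; rewrite /Psi (lam_linr dij) sa mulrDr mulrCA.
move=> g g' phi phi' _ _ gg' _ _ e x y; rewrite /Psi e; congr (_ * _).
apply: (@qL_alg_inj k X xi Q i).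
by rewrite -!brE.
Qed.

End AntiInvariant.
End Pairings.

(** * Solutions of the norm equation *)

Section Fixed.
Variables (k : fieldType) (X : polarized_setup k) (xi : psF X) (Q : quiver_data xi).

Lemma num_fixed0 (f : qI Q -> qI Q) : (forall l, f l <> l) -> num_fixed f = 0%N.
Proof.
by move=> h; apply/eqP; rewrite cards_eq0; apply/eqP/setP => l; rewrite !inE; apply/eqP/h.
Qed.

Lemma num_fixed1 (f : qI Q -> qI Q) i :
  (forall l, f l = l <-> l = i) -> num_fixed f = 1%N.
Proof.
move=> h; rewrite /num_fixed; suff -> : [set l | f l == l] = [set i]%SET by rewrite cards1.
by apply/setP => l; rewrite !inE; apply/eqP/eqP => /h.
Qed.

Lemma num_fixed2 (f : qI Q -> qI Q) i i' : i <> i' ->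
  (forall l, f l = l <-> l = i \/ l = i') -> num_fixed f = 2%N.
Proof.
move=> /eqP ne h; rewrite /num_fixed; suff -> : [set l | f l == l] = [set i; i']%SET.
  by rewrite cards2 ne.
apply/setP => l; rewrite !inE; apply/eqP/orP => [/h [] ->|[] /eqP ->].
- by left.
- by right.
- by apply/h; left.
by apply/h; right.
Qed.

End Fixed.

Section NormEquation.
Variables (k : fieldType) (d : nat) (om b0 beta : k) (s : {rmorphism k -> k}).
Hypothesis two0 : (2 : k) != 0.
Hypothesis s2 : involutive s.
Hypothesis om_prim : d.-primitive_root om.
Hypothesis som : s om = om.
Hypothesis b0d : b0 ^+ d = beta.
Hypothesis beta0 : beta != 0.

(* The vertices fixed by dia correspond to the solutions for g = gamma, and the
   arrows fixed by adia to those for g = gamma / Nm xi; replacing b by om b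
   multiplies b * s b by om ^ 2, so parity of d decides the count. *)
Definition norm_sol (g b : k) := b * s b = g /\ b ^+ d = beta.

Let d_gt0' : (0 < d)%N := prim_order_gt0 om_prim.

Lemma norm_sol_neq0 b : b ^+ d = beta -> b != 0.
Proof.
by move=> bd; apply: contraNneq beta0 => e; rewrite -bd e expr0n gtn_eqF.
Qed.

Lemma norm_sol_ratio b b' : b ^+ d = beta -> b' ^+ d = beta ->
  exists i : 'I_d, b = om ^+ i * b'.
Proof.
move=> bd b'd; have [|i Ei] := prim_rootP om_prim (x := b / b').
  by rewrite exprMn exprVn bd b'd mulfV.
by exists i; rewrite -Ei mulfVK // norm_sol_neq0.
Qed.

Lemma norm_om i b : om ^+ i * b * s (om ^+ i * b) = om ^+ (i.*2) * (b * s b).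
Proof. by rewrite rmorphM rmorphXn som mulrACA -exprD addnn. Qed.

Lemma om_pow_sol i b : b ^+ d = beta -> (om ^+ i * b) ^+ d = beta.
Proof.
by move=> bd; rewrite exprMn bd -exprM mulnC exprM (prim_expr_order om_prim) expr1n mul1r.
Qed.

Lemma norm_sol_sign g b b' : g != 0 -> norm_sol g b -> norm_sol g b' ->
  b' = b \/ b' = - b.
Proof.
move=> g0 [bg bd] [b'g b'd]; have [i Ei] := norm_sol_ratio b'd bd.
have : om ^+ (i.*2) = 1.
  by apply: (mulIf g0); rewrite mul1r -{1}bg -norm_om -Ei.
rewrite -muln2 exprM => /eqP; rewrite sqrf_eq1 Ei.
by case/orP => /eqP ->; rewrite ?mul1r ?mulN1r; [left | right].
Qed.

Lemma odd_negb_sol b : odd d -> b ^+ d = beta -> (- b) ^+ d = beta -> False.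
Proof.
move=> od bd; rewrite exprNn -signr_odd od expr1 mulN1r bd => /eqP.
rewrite eq_sym -addr_eq0 -mulr2n -mulr_natl mulf_eq0.
by rewrite (negPf two0) (negPf beta0).
Qed.

Lemma odd_norm_sol_uniq g b b' : odd d -> g != 0 -> norm_sol g b -> norm_sol g b' ->
  b = b'.
Proof.
move=> od g0 bs b's; have [//|e] := norm_sol_sign g0 bs b's.
by case: (odd_negb_sol od bs.2); rewrite -e; case: b's.
Qed.

Lemma norm_sol_exponent g : g != 0 -> g ^+ d = beta * s beta ->
  exists l, b0 * s b0 = om ^+ l * g.
Proof.
move=> g0 gd; have [|l El] := prim_rootP om_prim (x := b0 * s b0 / g).
  by rewrite !exprMn exprVn -rmorphXn b0d gd mulfV // mulf_neq0 // fmorph_eq0.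
by exists l; rewrite -El mulfVK.
Qed.

(** Reduces the norm equation to the congruence 2j + l = 0 modulo [d]. *)
Lemma norm_sol_of_exponent g l j : b0 * s b0 = om ^+ l * g ->
  (d %| j.*2 + l)%N -> norm_sol g (om ^+ j * b0).
Proof.
move=> e dv; split; last exact: om_pow_sol.
rewrite norm_om e mulrA -exprD; have := dv; rewrite (prim_order_dvd om_prim) => /eqP ->.
by rewrite mul1r.
Qed.

Lemma odd_norm_sol_exists g : odd d -> g != 0 -> g ^+ d = beta * s beta ->
  exists b, norm_sol g b.
Proof.
move=> od g0 gd; have [l El] := norm_sol_exponent g0 gd.
(* For odd [d], twice [d./2] is [d - 1], so the exponent becomes [l * d]. *)
exists (om ^+ (l * d./2) * b0); apply: (norm_sol_of_exponent El).
have -> : ((l * d./2).*2 + l = l * d)%N.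
  by rewrite -[d in RHS]odd_double_half od; nia.
exact: dvdn_mull.
Qed.

(** An even [l] can be halved and gives a solution for [g]; an odd [l] becomes the even [l + 1] on
    passing to [g / om]. *)
Lemma even_norm_sol_dichotomy g : ~~ odd d -> g != 0 -> g ^+ d = beta * s beta ->
  ~ (exists b, norm_sol g b) -> exists b, norm_sol (g / om) b.
Proof.
move=> ed g0 gd nsol; have [l El] := norm_sol_exponent g0 gd.
have om0 : om != 0 by rewrite (prim_root_eq0 om_prim) gtn_eqF.
have half m : ~~ odd m -> (d %| (m./2 * d.-1).*2 + m)%N.
  move=> em; have -> : ((m./2 * d.-1).*2 + m = m * d)%N.
    have := odd_double_half m; rewrite (negPf em) add0n => Em.
    by rewrite -{2 3}Em; case: (d) d_gt0' => // d' _ /=; nia.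
  exact: dvdn_mull.
have ol : odd l.
  apply: contra_notT nsol => el; exists (om ^+ (l./2 * d.-1) * b0).
  exact/(norm_sol_of_exponent El)/half.
exists (om ^+ (l.+1./2 * d.-1) * b0).
apply: (@norm_sol_of_exponent _ l.+1); last by apply: half; rewrite /= ol.
by rewrite El exprSr -mulrA; congr (_ * _); rewrite mulrC mulfVK.
Qed.

(** The quotient of the two norms would be both [om] and an even power of [om], but exponents modulo
    an even [d] have a well-defined parity. *)
Lemma even_norm_sol_exclusive g : ~~ odd d -> g != 0 ->
  (exists b, norm_sol g b) -> (exists b, norm_sol (g / om) b) -> False.
Proof.
move=> ed g0 [b [bg bd]] [b' [b'g b'd]]; have [i Ei] := norm_sol_ratio bd b'd.
have om0 : om != 0 by rewrite (prim_root_eq0 om_prim) gtn_eqF.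
have : om ^+ i.*2 == om ^+ 1.
  have : om ^+ i.*2 * (g / om) = g by rewrite -b'g -norm_om -Ei.
  by rewrite mulrCA => /(canRL (mulKf g0)); rewrite mulVf // => /(canRL (mulfVK om0)) ->; rewrite mul1r.
rewrite (eq_prim_root_expr om_prim) eq_sym => /eqP /(congr1 odd).
have odm m : odd (m %% d)%N = odd m by rewrite [in RHS](divn_eq m d) oddD oddM (negPf ed) andbF.
by rewrite !odm odd_double.
Qed.

Lemma neg_norm_sol g b : ~~ odd d -> norm_sol g b -> norm_sol g (- b).
Proof.
move=> ed [bg bd]; split; first by rewrite rmorphN mulrNN.
by rewrite exprNn -signr_odd (negPf ed) mul1r.
Qed.

(** By uniqueness [b] equals its conjugate, so its norm is its square; the other square root has
    d-th power [- beta]. The condition on [beta] is forced, since [b ^+ 2 = g] and [b ^+ d = beta]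
    give [beta ^+ 2 = g ^+ d = beta * s beta]. *)
Lemma odd_square_sol_unique g b : odd d -> g != 0 -> s beta = beta ->
  norm_sol g b -> unique (fun b => b ^+ 2 = g /\ b ^+ d = beta) b.
Proof.
move=> od g0 sbeta bs; have [bg bd] := bs.
have sb : s b = b.
  apply/esym/(odd_norm_sol_uniq od g0 bs); split; first by rewrite s2 mulrC.
  by rewrite -rmorphXn bd sbeta.
have b2 : b ^+ 2 = g by rewrite expr2 -{2}sb.
split=> // b' [b'2 b'd].
have /eqP : b' ^+ 2 = b ^+ 2 by rewrite b'2 b2.
rewrite eqf_sqr => /orP [/eqP -> //|/eqP e].
by case: (odd_negb_sol od bd); rewrite -e.
Qed.

Section FixedPoints.
Variables (I : Type) (bw : I -> k) (f : I -> I) (g : k).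
Hypothesis bw_inj : injective bw.
Hypothesis bw_surj : forall b, b ^+ d = beta -> exists i, bw i = b.
Hypothesis fP : forall i, f i = i <-> norm_sol g (bw i).
Hypothesis g0 : g != 0.

(** An abstract [f] and [g] serve both for vertices, with [dia] and gamma, and for arrows, with
    [adia] and gamma / Nm xi. *)
Lemma odd_fixed_unique : odd d -> g ^+ d = beta * s beta ->
  exists i b, [/\ forall l, f l = l <-> l = i, norm_sol g b,
    unique (norm_sol g) b & bw i = b].
Proof.
move=> od gd; have [b bs] := odd_norm_sol_exists od g0 gd.
have uq b' : norm_sol g b' -> b = b' by apply: odd_norm_sol_uniq.
have [i Ei] := bw_surj bs.2; exists i, b; split=> // l.
split=> [/fP /uq e|->]; first by apply: bw_inj; rewrite Ei e.
by apply/fP; rewrite Ei.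
Qed.

Lemma even_fixed_pair : ~~ odd d -> (exists b, norm_sol g b) ->
  exists i i' b, [/\ i <> i', forall l, f l = l <-> l = i \/ l = i',
    norm_sol g b, norm_sol g (- b) & bw i = b /\ bw i' = - b].
Proof.
move=> ed [b bs]; have bs' := neg_norm_sol ed bs.
have [i Ei] := bw_surj bs.2; have [i' Ei'] := bw_surj bs'.2.
exists i, i', b; split=> //.
  move=> ii'; have /eqP : b = - b by rewrite -[LHS]Ei -[RHS]Ei' ii'.
  rewrite -addr_eq0 -mulr2n -mulr_natl mulf_eq0 (negPf two0) /=.
  exact/negP/(norm_sol_neq0 bs.2).
move=> l; split=> [/fP ls|[] ->]; last 2 first.
- by apply/fP; rewrite Ei.
- by apply/fP; rewrite Ei'.
by case: (norm_sol_sign g0 bs ls) => e; [left | right];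
  apply: bw_inj; rewrite e.
Qed.

End FixedPoints.

End NormEquation.

Theorem mainTheorem3 (R : realType) (X : polarized_setup (laurent R[i]))
    (xi : psF X) (Q : quiver_data xi) (z : R[i])
    (hsC : forall a : R[i], sigk X (lconst a) = lconst a)
    (hs : exists x, sigk X x <> x)
    (hxi : sigma X xi = xi)
    (hz : (psm X %/ psn X)%N.-primitive_root z)
    (hNxi : Nm xi = lconst z) :
  let k := laurent R[i] in
  let d := (psm X %/ psn X)%N in
  let gamma := Nm (psc X) in
  let gamma' := gamma * Nm (xi^-1) in
  let s := sigk X in
  (* k^sigma = C((t ^ 2)) for a uniformizer t of k *)
  [/\ exists t : k, val_tau t = 1 /\
        (forall x, s x = x <-> laurent_in (t ^+ 2) x),
      gamma != 0 /\ s gamma = gamma,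
      (2 %| val_tau gamma)%Z,
      gamma ^+ d = beta X * s (beta X)
    & (d%:Z %| val_tau (beta X))%Z] /\
  [/\ #|qI Q| = d, forall i : qI Q, L_trivial i, forall i : qI Q, D_trivial i
    & Q_cycle Q d] /\
  (odd d ->
     type_VE Q /\
     (exists (i : qI Q) (b : k),
        [/\ forall i' : qI Q, dia i' = i' <-> i' = i,
            unique (fun b => b * s b = gamma /\ b ^+ d = beta X) b,
            s (beta X) = beta X ->
              unique (fun b => b ^+ 2 = gamma /\ b ^+ d = beta X) b,
            vertex_at i b
          & (exists x : qL i, restrL (@sLc _ _ _ Q) x <> x) /\
            unitary_factor i]) /\
     (exists (j : qI Q) (b : k),
        [/\ forall j' : qI Q, adia j' = j' <-> j' = j,
            unique (fun b => b * s b = gamma' /\ b ^+ d = beta X) b,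
            s (beta X) = beta X ->
              unique (fun b => b ^+ 2 = gamma' /\ b ^+ d = beta X) b,
            vertex_at j b
          & (exists x : qL j, restrL (@sLcxi _ _ _ Q) x <> x) /\
            hermitian_factor (~~ (eps X (+) epsa j)) j])) /\
  (~~ odd d ->
     ((exists b : k, b * s b = gamma /\ b ^+ d = beta X) ->
        type_VV Q /\
        exists (i i' : qI Q) (b : k),
          [/\ i <> i' /\ (forall l : qI Q, dia l = l <-> l = i \/ l = i'),
              b * s b = gamma /\ b ^+ d = beta X,
              (- b) * s (- b) = gamma /\ (- b) ^+ d = beta X,
              vertex_at i b /\ vertex_at i' (- b)
            & unitary_factor i /\ unitary_factor i']) /\
     (~ (exists b : k, b * s b = gamma /\ b ^+ d = beta X) ->
        type_EE Q /\
        exists (i i' : qI Q) (b : k),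
          [/\ i <> i' /\ (forall l : qI Q, adia l = l <-> l = i \/ l = i'),
              b * s b = gamma' /\ b ^+ d = beta X,
              (- b) * s (- b) = gamma' /\ (- b) ^+ d = beta X,
              vertex_at i b /\ vertex_at i' (- b)
            & hermitian_factor (~~ (eps X (+) epsa i)) i /\
              hermitian_factor (~~ (eps X (+) epsa i')) i'])).
Proof.
move=> k d gamma gamma' s.
have om_prim : d.-primitive_root (Nm xi).
  by rewrite hNxi (fmorph_primitive_root (@lconst R[i])).
have sK : involutive s := @sigkK _ X.
have [e [e0 st]] := s_nontrivial_uniformizer sK hsC hs.
set t := ltau _ * ltofrac e in st.
have t0 : t != 0 := unif_neq0 e0.
have g0 : gamma != 0 := gamma_neq0 X.
have sg : s gamma = gamma := s_gamma X.
have gd : gamma ^+ d = beta X * s (beta X) := Nm_c_exp X.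
have veven := fixed_val_even hsC e0 st g0 sg.
have be0 := ps_beta0 X; have d0 : (0 < d)%N := d_gt0 X.
have vbeta : (d%:Z %| val_tau (beta X))%Z := norm_val_dvd hsC e0 st g0 be0 sg gd.
have [b0 b0d] := laurent_root d0 be0 vbeta.
have om0 : Nm xi != 0 := Nxi_neq0 om_prim.
have som : s (Nm xi) = Nm xi := s_om hxi.
have Eg' : gamma' = gamma / Nm xi by rewrite /gamma' NmV // (xi_unit om_prim).
have g'0 : gamma' != 0 by rewrite Eg'; exact: (mulf_neq0 g0 (invr_neq0 om0)).
have g'd : gamma' ^+ d = beta X * s (beta X).
  by rewrite Eg' exprMn exprVn (prim_expr_order om_prim) invr1 mulr1.
have two0 : (2 : k) != 0 := laurent_natr_neq0 R[i] (isT : (0 < 2)%N).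
have arr := quiver_arrow_reversing Q om_prim hxi b0d.
pose bw : qI Q -> k := bv om_prim b0d.
have bwd i : bw i ^+ d = beta X := bv_exp om_prim b0d i.
have vtx i b : bw i = b -> vertex_at i b.
  by move=> <-; exact: (vertex_bv om_prim b0d i).
have diaP i : dia i = i <-> norm_sol d (beta X) s gamma (bw i).
  split=> [h|[h _]]; last exact: (dia_fixedE om_prim b0d i).2.
  exact: (conj ((dia_fixedE om_prim b0d i).1 h) (bwd i)).
have adiaP i : adia i = i <-> norm_sol d (beta X) s gamma' (bw i).
  rewrite Eg'; split=> [h|[h _]]; last exact: (adia_fixedE om_prim hxi b0d i).2.
  exact: (conj ((adia_fixedE om_prim hxi b0d i).1 h) (bwd i)).
have vex b : b ^+ d = beta X -> exists i, bw i = b := bv_surj Q om_prim b0d (b := b).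
have bwI : injective bw := @bv_inj _ X xi Q om_prim b0 b0d.
have uni (i : qI Q) : dia i = i -> unitary_factor i.
  exact: (fixed_vertex_unitary om_prim b0d t0 st).
(* Proved for both signs, as multiplication by [t] exchanges them; this covers the sign -eps eps_e,
   encoded by the boolean negation. *)
have herm sgn (i : qI Q) : adia i = i -> hermitian_factor sgn i.
  exact: (fixed_arrow_hermitian om_prim hxi b0d t0 st).
split.
  split; [exists t | exact: (conj g0 sg) | exact: veven | exact: gd | exact: vbeta].
  split; [exact: val_unif | exact: (fixed_laurent_in hsC e0 st)].
split.
  split; [exact: (card_qI Q om_prim b0d) | | | exact: (quiver_cycle Q om_prim b0d)] => i.
    exact: (quiver_L_trivial om_prim b0d).
  exact: (quiver_D_trivial om_prim b0d).
split=> [od|ed].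
  have [i [b [iP bs bu /vtx bv]]] :=
    odd_fixed_unique two0 om_prim som b0d be0 bwI vex diaP g0 od gd.
  have [j [b' [jP b's b'u /vtx b'v]]] :=
    odd_fixed_unique two0 om_prim som b0d be0 bwI vex adiaP g'0 od g'd.
  have di : dia i = i := (iP i).2 erefl.
  have aj : adia j = j := (jP j).2 erefl.
  have [x sx] := hs.
  split; first exact: (conj arr (conj (num_fixed1 iP) (num_fixed1 jP))).
  split.
    exists i, b; split; [exact: iP | exact: bu | | exact: bv | ].
      by move=> sb; exact: (odd_square_sol_unique two0 sK om_prim som be0 od g0 sb bs).
    split; last exact: uni.
    have [h _] := (diaP i).1 di.
    (* On [L_i = k] the map sigma_c restricts to [s], which moves [x]. *)
    exists x%:A; rewrite (restrL_sigma_ _ (q_sLc Q) h).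
    by move/(@qL_alg_inj _ X xi Q i)/sx.
  exists j, b'; split; [exact: jP | exact: b'u | | exact: b'v | ].
    by move=> sb; exact: (odd_square_sol_unique two0 sK om_prim som be0 od g'0 sb b's).
  split; last exact: herm.
  have [h _] := (adiaP j).1 aj; rewrite Eg' -(gamma'E om_prim) in h.
  exists x%:A; rewrite (restrL_sigma_ _ (q_sLcxi Q) h).
  by move/(@qL_alg_inj _ X xi Q j)/sx.
split=> [sol|nsol].
  have [i [i' [b [ii' fP bs bs' [/vtx v /vtx v']]]]] :=
    even_fixed_pair two0 om_prim som be0 bwI vex diaP g0 ed sol.
  split; last first.
    exists i, i', b; split; [exact: (conj ii' fP) | exact: bs | exact: bs' | exact: (conj v v') | ].
    by split; apply: uni; apply/fP; [left | right].
  split; first exact: arr.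
  split; first exact: (num_fixed2 ii' fP).
  apply: num_fixed0 => l /adiaP ls.
  apply: (even_norm_sol_exclusive om_prim som be0 ed g0 sol).
  by exists (bw l); rewrite -Eg'; exact: ls.
have sol' : exists b, norm_sol d (beta X) s gamma' b.
  rewrite Eg'; exact: (even_norm_sol_dichotomy two0 om_prim som b0d be0 ed g0 gd nsol).
have [i [i' [b [ii' fP bs bs' [/vtx v /vtx v']]]]] :=
  even_fixed_pair two0 om_prim som be0 bwI vex adiaP g'0 ed sol'.
split; last first.
  exists i, i', b; split; [exact: (conj ii' fP) | exact: bs | exact: bs' | exact: (conj v v') | ].
  by split; apply: herm; apply/fP; [left | right].
split; first exact: arr.
split; last exact: (num_fixed2 ii' fP).
by apply: num_fixed0 => l /diaP ls; apply: nsol; exists (bw l); exact: ls.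
Qed.
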